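(* For all $U_0\in\mathcal{H}$, the evolution equation $U_t=\mathcal{A}_dU$, $U(0)=U_0$, admits a unique weak solution $U(t)=e^{t\mathcal{A}_d}U_0\in C^0(\mathbb{R}_+,\mathcal{H})$, where $(e^{t\mathcal{A}_d})_{t\ge0}$ is the $C_0$-semigroup generated by $\mathcal{A}_d$. Moreover, if $U_0\in D(\mathcal{A}_d)$, then it admits a unique strong solution $U(t)=e^{t\mathcal{A}_d}U_0\in C^0(\mathbb{R}_+,D(\mathcal{A}_d))\cap C^1(\mathbb{R}_+,\mathcal{H})$.
   Context: All function spaces consist of complex-valued functions; $\mathbb{R}_+=[0,\infty)$. Let $d\ge2$ and let $\Omega\subset\mathbb{R}^d$ be an open bounded set with boundary $\Gamma$ of class $C^2$. Let $b,c\in L^\infty(\Omega)$ with $b:\Omega\to\mathbb{R}_+$, $c:\Omega\to\mathbb{R}$, and let $\omega_b,\omega_c\subset\Omega$ be such that $b\ge b_0>0$ in $\omega_b$, $c\ge c_0>0$ in $\omega_c$, $c=0$ on $\Omega\setminus\omega_c$, $\mathrm{meas}(\overline{\omega_c}\cap\Gamma)>0$ and $\overline{\omega_b}\cap\overline{\omega_c}=\emptyset$, with $b_0,c_0$ constants. The energy space is $\mathcal{H}=(H_0^1(\Omega)\times L^2(\Omega))^2$ with inner product $\langle U,U_1\rangle_{\mathcal{H}}=\int_\Omega v\overline{v_1}\,dx+\int_\Omega\nabla u\cdot\nabla\overline{u_1}\,dx+\int_\Omega z\overline{z_1}\,dx+\int_\Omega\nabla y\cdot\nabla\overline{y_1}\,dx$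 for $U=(u,v,y,z)^\top$, $U_1=(u_1,v_1,y_1,z_1)^\top$. The operator $\mathcal{A}_d$ has domain $D(\mathcal{A}_d)=\{(u,v,y,z)^\top\in\mathcal{H}: v,z\in H_0^1(\Omega),\ \mathrm{div}(\nabla u+b\nabla v)\in L^2(\Omega),\ \Delta y\in L^2(\Omega)\}$ (with the graph norm) and is given by $\mathcal{A}_d(u,v,y,z)^\top=(v,\ \mathrm{div}(\nabla u+b\nabla v)-cz,\ z,\ \Delta y+cv)^\top$. The equation $U_t=\mathcal{A}_dU$ is the first order form, with $U=(u,u_t,y,y_t)^\top$, of $u_{tt}-\mathrm{div}(\nabla u+b\nabla u_t)+cy_t=0$, $y_{tt}-\Delta y-cu_t=0$ in $\Omega\times(0,\infty)$ with $u=y=0$ on $\Gamma\times(0,\infty)$. ''Weak solution'' is meant in the usual (mild) semigroup sense. *)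

(* Defs.v *)
From HB Require Import structures.
From mathcomp Require Import all_boot all_order all_algebra.
From mathcomp Require Import ring_quotient.
From mathcomp Require Import all_classical all_reals all_analysis.
From mathcomp Require Import complex.

Set Implicit Arguments.
Unset Strict Implicit.
Unset Printing Implicit Defensive.

Import Order.TTheory GRing.Theory Num.Theory.
Import numFieldNormedType.Exports.

Local Open Scope classical_set_scope.
Local Open Scope ring_scope.
Local Open Scope complex_scope.
Local Open Scope quotient_scope.

Definition rV_display : measure_display -> measure_display.
Proof. exact. Qed.

Section rV_measurable.
Context {R : realType}.
Variable n : nat.

(* The product sigma-algebra, that is, the Borel sets of R^n. *)
Definition rV_coord (i : 'I_n) (x : 'rV[R]_n) : measurableTypeR R := x ord0 i.

Let rV_set0 : g_sigma_preimage rV_coord set0.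
Proof. exact: sigma_algebra0. Qed.

Let rV_setC A : g_sigma_preimage rV_coord A -> g_sigma_preimage rV_coord (~` A).
Proof. exact: sigma_algebraC. Qed.

Let rV_bigcup (F : (set 'rV[R]_n)^nat) :
  (forall i, g_sigma_preimage rV_coord (F i)) ->
  g_sigma_preimage rV_coord (\bigcup_i (F i)).
Proof. exact: sigma_algebra_bigcup. Qed.

HB.instance Definition _ := @isMeasurable.Build (rV_display default_measure_display)
  'rV[R]_n (g_sigma_preimage rV_coord) rV_set0 rV_setC rV_bigcup.

End rV_measurable.

Section lebesgue_rV.
Context {R : realType}.

Lemma measurable_rV_coord n (i : 'I_n) : measurable_fun setT (@rV_coord R n i).
Proof.
move=> _ Y mY; rewrite setTI; apply: sub_sigma_algebra => /=.
rewrite -bigcup_seq/=; exists i => /=; first by rewrite mem_index_enum.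
by exists Y => //; rewrite setTI.
Qed.

Lemma measurable_fun_rV d (T : measurableType d) n (f : T -> 'rV[R]_n) :
  (forall i, measurable_fun setT (rV_coord i \o f)) -> measurable_fun setT f.
Proof.
move=> mf _ A mA.
have sub : g_sigma_preimage (fun i => rV_coord i \o f) `<=` measurable.
  apply: smallest_sub; first exact: sigma_algebra_measurable.
  case: n f mf {A mA} => [|n] f mf; first by rewrite big_ord0.
  rewrite -bigcup_mkord_ord; apply: bigcup_sub => i Ii.
  by move=> A [B mB <-]; exact: mf.
by apply: sub; rewrite g_sigma_preimage_comp; exists A.
Qed.

Definition rV_cons n (p : measurableTypeR R * 'rV[R]_n) : 'rV[R]_n.+1 :=
  row_mx (p.1 : R)%:M p.2 : 'rV[R]_(1 + n).

Definition rV_uncons n (x : 'rV[R]_n.+1) : measurableTypeR R * 'rV[R]_n :=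
  (x ord0 ord0, rsubmx (x : 'rV[R]_(1 + n))).

Lemma rV_consK n : cancel (@rV_cons n) (@rV_uncons n).
Proof.
move=> [x w]; rewrite /rV_uncons /rV_cons row_mxKr; congr (_, _).
have -> : (ord0 : 'I_(1 + n)) = lshift n (ord0 : 'I_1) by exact/val_inj.
by rewrite (@row_mxEl _ 1 1 n) mxE.
Qed.

Lemma measurable_rV_cons n : measurable_fun setT (@rV_cons n).
Proof.
apply: measurable_fun_rV => i.
case: (split_ordP (i : 'I_(1 + n))) => j ij.
  rewrite (_ : _ \o _ = fst) //; apply/funext => p /=.
  by rewrite /rV_coord /rV_cons ij (@row_mxEl _ 1 1 n) mxE !ord1.
rewrite (_ : _ \o _ = rV_coord j \o snd).
  by apply: measurableT_comp => //; exact: measurable_rV_coord.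
by apply/funext => p /=; rewrite /rV_coord /rV_cons ij (@row_mxEr _ 1 1 n).
Qed.

Lemma measurable_rV_uncons n : measurable_fun setT (@rV_uncons n).
Proof.
apply/measurable_fun_pairP; split.
  exact: (measurable_rV_coord (ord0 : 'I_n.+1)).
apply: measurable_fun_rV => i.
rewrite (_ : _ \o _ = rV_coord (rshift 1 i)); first exact: measurable_rV_coord.
by apply/funext => x; rewrite /rV_coord /= mxE.
Qed.

Section step.
Variables (n : nat) (m : {sigma_finite_measure set 'rV[R]_n -> \bar R}).

Definition lebesgue_rVS : set 'rV[R]_n.+1 -> \bar R :=
  pushforward ((@lebesgue_measure R) \x m)%E (@rV_cons n).

Let lebesgue_rVS0 : lebesgue_rVS set0 = 0%E.
Proof. by rewrite /lebesgue_rVS /pushforward preimage_set0 measure0. Qed.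

Let lebesgue_rVS_ge0 A : (0 <= lebesgue_rVS A)%E.
Proof. by rewrite /lebesgue_rVS /pushforward measure_ge0. Qed.

Let lebesgue_rVS_sigma_additive : semi_sigma_additive lebesgue_rVS.
Proof.
by apply: measure_semi_sigma_additive; exact: measurable_rV_cons.
Qed.

HB.instance Definition _ := isMeasure.Build _ _ _ lebesgue_rVS
  lebesgue_rVS0 lebesgue_rVS_ge0 lebesgue_rVS_sigma_additive.

Let sigma_finite_lebesgue_rVS : sigma_finite setT lebesgue_rVS.
Proof.
have /sigma_finiteP[F [FT ndF Foo]] := sigma_finiteT (@lebesgue_measure R).
have /sigma_finiteP[G [GT ndG Goo]] := sigma_finiteT m.
exists (fun k => @rV_uncons n @^-1` (F k `*` G k)).
  apply/seteqP; split=> // x _.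
  have [/= i _ Fi] : (\bigcup_k F k) (rV_uncons x).1 by rewrite -FT.
  have [/= j _ Gj] : (\bigcup_k G k) (rV_uncons x).2 by rewrite -GT.
  exists (maxn i j) => //; split.
  - by move: Fi; exact/subsetPset/ndF/leq_maxl.
  - by move: Gj; exact/subsetPset/ndG/leq_maxr.
move=> k; have [mF Fk] := Foo k; have [mG Gk] := Goo k; split.
  rewrite -[X in measurable X]setTI; apply: measurable_rV_uncons => //.
  exact: measurableX.
rewrite /lebesgue_rVS /pushforward (_ : _ @^-1` _ = F k `*` G k).
  by rewrite product_measure1E// lte_mul_pinfty// ge0_fin_numE.
by rewrite -comp_preimage (_ : _ \o _ = id) //; apply/funext/rV_consK.
Qed.

HB.instance Definition _ := Measure_isSigmaFinite.Build _ _ _ lebesgue_rVS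
  sigma_finite_lebesgue_rVS.

End step.

Fixpoint lebesgue_rV n : {sigma_finite_measure set 'rV[R]_n -> \bar R} :=
  if n is k.+1 then lebesgue_rVS (lebesgue_rV k) else \d_(0 : 'rV[R]_0).

End lebesgue_rV.

Section regularity.
Context {R : realType} {n : nat}.

Definition iter_partial (s : seq 'I_n) (f : 'rV[R]_n -> R) : 'rV[R]_n -> R :=
  foldr (fun i g => 'D_(delta_mx ord0 i) g) f s.

Definition is_Ck (k : nat) (f : 'rV[R]_n -> R) : Prop :=
  forall s : seq 'I_n, (size s <= k)%N ->
    continuous (iter_partial s f) /\
    ((size s < k)%N -> forall i x,
      derivable (iter_partial s f) x (delta_mx ord0 i)).

Definition smooth (f : 'rV[R]_n -> R) : Prop := forall k, is_Ck k f.

End regularity.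

Section hypersurfaces.
Context {R : realType} {n : nat}.
Implicit Types A C : set 'rV[R]_n.

Definition boundary A : set 'rV[R]_n := closure A `\` A^°.

(* Near each boundary point, in suitable orthonormal coordinates, A is the
   strict epigraph of a C^2 function of n - 1 of the coordinates ([col' i]
   drops the i-th one). *)
Definition C2_boundary A : Prop :=
  forall x0, boundary A x0 ->
    exists (Q : 'M[R]_n) (i : 'I_n) (gamma : 'rV[R]_n.-1 -> R),
      [/\ Q *m Q^T = 1%:M,
          is_Ck 2 gamma &
          \forall x \near x0,
            A x <-> gamma (col' i (x *m Q)) < (x *m Q) ord0 i].

Definition edist (x y : 'rV[R]_n) : R :=
  Num.sqrt (\sum_(i < n) (x ord0 i - y ord0 i) ^+ 2).

Definition ediam C : \bar R :=
  ereal_sup [set r | r = 0%E \/ exists x y, [/\ C x, C y & r = (edist x y)%:E]].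

(* The k-dimensional Hausdorff outer measure, up to the usual normalizing
   constant (k > 0). *)
Definition hausdorff_content (k : nat) (delta : R) A : \bar R :=
  ereal_inf [set r | exists C : (set 'rV[R]_n)^nat,
    [/\ A `<=` \bigcup_j C j, forall j, (ediam (C j) <= delta%:E)%E &
        r = (\sum_(0 <= j <oo) ediam (C j) ^+ k)%E]].

Definition hausdorff (k : nat) A : \bar R :=
  ereal_sup [set hausdorff_content k delta A | delta in [set r : R | 0 < r]].

End hypersurfaces.

Section measurable_functions.
Context {R : realType} {n : nat}.
Variable Omega : set 'rV[R]_n.

Definition cmeasurable : {pred 'rV[R]_n -> R[i]^o} :=
  [pred f | `[< measurable_fun Omega (fun x => complex.Re (f x)) /\
                measurable_fun Omega (fun x => complex.Im (f x)) >]].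

Lemma cmeasurable_submod : submod_closed cmeasurable.
Proof.
split.
  by apply/asboolP; split; exact: measurable_cst.
move=> a f g /asboolP[mRf mIf] /asboolP[mRg mIg]; apply/asboolP.
case: a => a1 a2; split.
- rewrite (_ : (fun _ => _) = (fun x => a1 * complex.Re (f x)
      - a2 * complex.Im (f x) + complex.Re (g x))).
    apply: measurable_realfun.measurable_funD => //; apply: measurable_realfun.measurable_funB; exact: measurable_realfun.measurable_funM.
  by apply/funext => x; rewrite !fctE /GRing.scale /=; case: (f x); case: (g x).
- rewrite (_ : (fun _ => _) = (fun x => a1 * complex.Im (f x)
      + a2 * complex.Re (f x) + complex.Im (g x))).
    apply: measurable_realfun.measurable_funD => //; apply: measurable_realfun.measurable_funD; exact: measurable_realfun.measurable_funM.
  by apply/funext => x; rewrite !fctE /GRing.scale /=; case: (f x); case: (g x).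
Qed.

HB.instance Definition _ :=
  GRing.isSubmodClosed.Build _ _ cmeasurable cmeasurable_submod.

Record cmfun := CMFun {
  cmfun_val :> 'rV[R]_n -> R[i]^o;
  _ : cmfun_val \in cmeasurable }.

HB.instance Definition _ := [isSub for cmfun_val].
HB.instance Definition _ := [Choice of cmfun by <:].
HB.instance Definition _ := [SubChoice_isSubLmodule of cmfun by <:].

Definition null_fun : {pred cmfun} :=
  [pred f : cmfun | `[< {ae @lebesgue_rV R n, forall x, Omega x -> f x = 0} >]].

Lemma null_fun_submod : submod_closed null_fun.
Proof.
split; first by apply/asboolP/aeW.
move=> a f g /asboolP f0 /asboolP g0; apply/asboolP.
apply: filterS2 f0 g0 => x fx gx Ox.
by rewrite /= !fctE fx// gx// scaler0 addr0.
Qed.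

HB.instance Definition _ :=
  GRing.isSubmodClosed.Build _ _ null_fun null_fun_submod.

(* Measurable functions Omega -> C, up to equality a.e. on Omega. *)
Definition aefun : Type := Quotient.quot null_fun.
HB.instance Definition _ := Choice.on aefun.
HB.instance Definition _ := EqQuotient.on aefun.
HB.instance Definition _ := GRing.Zmodule.on aefun.

Lemma aefun_eqP (f g : cmfun) :
  \pi_aefun f = \pi_aefun g <->
  {ae @lebesgue_rV R n, forall x, Omega x -> f x = g x}.
Proof.
split=> [fg|fg].
  have /asboolP : f - g \in null_fun by rewrite Quotient.idealrBE; exact/eqP.
  by apply: filterS => x fgx Ox; apply/eqP; rewrite -subr_eq0; exact/eqP/fgx.
apply/eqP; rewrite -[_ == _]Quotient.idealrBE; apply/asboolP.
by apply: filterS fg => x fgx Ox; apply/eqP; rewrite subr_eq0; exact/eqP/fgx.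
Qed.

Definition aefun_scale (a : R[i]) (u : aefun) : aefun :=
  \pi_aefun (a *: repr u).

Lemma aefun_scaleE a f : aefun_scale a (\pi_aefun f) = \pi_aefun (a *: f).
Proof.
have /aefun_eqP : \pi_aefun (repr (\pi_aefun f)) = \pi_aefun f by rewrite reprK.
move=> h; apply/aefun_eqP; move: h; apply: filterS => x rf Ox.
exact: (congr1 (fun z : R[i]^o => a *: z) (rf Ox)).
Qed.

Let aefun_piD f g : \pi_aefun (f + g) = \pi_aefun f + \pi_aefun g.
Proof. exact: Quotient.pi_add. Qed.

Let aefun_scaleA a b u : aefun_scale a (aefun_scale b u) = aefun_scale (a * b) u.
Proof.
by elim/quotW: u => f; rewrite [aefun_scale b _]aefun_scaleE !aefun_scaleE scalerA.
Qed.

Let aefun_scale1 : left_id 1 aefun_scale.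
Proof. by elim/quotW=> f; rewrite aefun_scaleE scale1r. Qed.

Let aefun_scaleDr : right_distributive aefun_scale +%R.
Proof.
move=> a; elim/quotW=> f; elim/quotW=> g.
by rewrite -aefun_piD !aefun_scaleE scalerDr aefun_piD.
Qed.

Let aefun_scaleDl u : {morph aefun_scale^~ u : a b / a + b}.
Proof.
by elim/quotW: u => f a b; rewrite !aefun_scaleE scalerDl aefun_piD.
Qed.

HB.instance Definition _ := GRing.Zmodule_isLmodule.Build R[i] aefun
  aefun_scaleA aefun_scale1 aefun_scaleDr aefun_scaleDl.

End measurable_functions.

Section function_spaces.
Context {R : realType} {n : nat}.
Variable Omega : set 'rV[R]_n.
Local Notation mu := (@lebesgue_rV R n).
Local Notation aefun := (aefun Omega).

Definition cintegral (f : 'rV[R]_n -> R[i]) : R[i] :=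
  (\int[mu]_(x in Omega) complex.Re (f x)) +i*
  (\int[mu]_(x in Omega) complex.Im (f x)).

(* The class of f; only meaningful if f is measurable on Omega. *)
Definition aeclass (f : 'rV[R]_n -> R[i]^o) : aefun :=
  \pi_aefun (insubd (0 : cmfun Omega) f).

Definition mulf (a : 'rV[R]_n -> R) (u : aefun) : aefun :=
  aeclass (fun x => (a x)%:C * (repr u x : R[i])).

Definition Linfty (a : 'rV[R]_n -> R) : Prop :=
  measurable_fun Omega a /\
  exists M : R, {ae mu, forall x, Omega x -> `|a x| <= M}.

Definition L2 : set aefun := [set u : aefun |
  (\int[mu]_(x in Omega)
     (complex.Re (repr u x) ^+ 2 + complex.Im (repr u x) ^+ 2)%:E < +oo)%E].

Definition dotL2 (u w : aefun) : R[i] :=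
  cintegral (fun x => (repr u x : R[i]) * conjc (repr w x : R[i])).

Definition test_function (phi : 'rV[R]_n -> R[i]) : Prop :=
  let supp := closure [set x | phi x != 0] in
  [/\ smooth (fun x => complex.Re (phi x)), smooth (fun x => complex.Im (phi x)),
      compact supp & supp `<=` Omega].

Definition cpartial (i : 'I_n) (phi : 'rV[R]_n -> R[i]) (x : 'rV[R]_n) : R[i] :=
  ('D_(delta_mx ord0 i) (fun x => complex.Re (phi x)) x) +i*
  ('D_(delta_mx ord0 i) (fun x => complex.Im (phi x)) x).

Definition weak_partial (i : 'I_n) (u g : aefun) : Prop :=
  forall phi, test_function phi ->
    cintegral (fun x => (repr u x : R[i]) * cpartial i phi x) =
    - cintegral (fun x => (repr g x : R[i]) * phi x).

(* For Omega open and u in H1 there is exactly one such class; otherwise the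
   value may be junk. The same applies to [divergence] and [div_in_L2]. *)
Definition grad (u : aefun) : 'I_n -> aefun :=
  fun i => xget 0 [set g | L2 g /\ weak_partial i u g].

Definition H1 : set aefun := [set u : aefun |
  L2 u /\ forall i, exists2 g, L2 g & weak_partial i u g].

Definition dotgrad (u w : aefun) : R[i] :=
  \sum_(i < n) dotL2 (grad u i) (grad w i).

Definition normH1 (u : aefun) : R :=
  Num.sqrt (complex.Re (dotL2 u u + dotgrad u u)).

Definition H10 : set aefun := [set u : aefun | H1 u /\
  forall e : R, 0 < e ->
    exists2 phi, test_function phi & normH1 (u - aeclass phi) < e].

Definition weak_div (p : 'I_n -> aefun) (f : aefun) : Prop :=
  forall phi, test_function phi ->
    \sum_(i < n) cintegral (fun x => (repr (p i) x : R[i]) * cpartial i phi x) =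
    - cintegral (fun x => (repr f x : R[i]) * phi x).

Definition div_in_L2 (p : 'I_n -> aefun) : Prop :=
  exists2 f, L2 f & weak_div p f.

Definition divergence (p : 'I_n -> aefun) : aefun :=
  xget 0 [set f | L2 f /\ weak_div p f].

Definition state : lmodType R[i] := (aefun * aefun * aefun * aefun)%type.

Definition energy_space : set state := [set U |
  let: (u, v, y, z) := U in [/\ H10 u, L2 v, H10 y & L2 z]].

Definition dotE (U U1 : state) : R[i] :=
  let: (u, v, y, z) := U in let: (u1, v1, y1, z1) := U1 in
  dotL2 v v1 + dotgrad u u1 + dotL2 z z1 + dotgrad y y1.

Definition normE (U : state) : R := Num.sqrt (complex.Re (dotE U U)).

Section operator.
Variables b c : 'rV[R]_n -> R.

Definition flux (u v : aefun) : 'I_n -> aefun :=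
  fun i => grad u i + mulf b (grad v i).

Definition domAd : set state := [set U | energy_space U /\
  let: (u, v, y, z) := U in
  [/\ H10 v, H10 z, div_in_L2 (flux u v) & div_in_L2 (grad y)]].

Definition Ad (U : state) : state :=
  let: (u, v, y, z) := U in
  (v, divergence (flux u v) - mulf c z, z, divergence (grad y) + mulf c v).

End operator.
End function_spaces.

Arguments energy_space {R n} Omega _.
Arguments normE {R n} Omega _.

Section evolution.
Context {R : realType} {E : lmodType R[i]}.
(* The Banach space is the subspace X of E; N is a norm on X only. *)
Variables (X : set E) (N : E -> R).

Definition semigroup_C0 (T : R -> E -> E) : Prop :=
  [/\ forall t, 0 <= t -> forall x, X x -> X (T t x),
      forall t, 0 <= t -> forall (a : R[i]) x y, X x -> X y ->
        T t (a *: x + y) = a *: T t x + T t y,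
      forall t, 0 <= t -> exists M : R, forall x, X x -> N (T t x) <= M * N x,
      (forall x, X x -> T 0 x = x) /\
      (forall s t, 0 <= s -> 0 <= t -> forall x, X x ->
        T (s + t) x = T s (T t x)) &
      forall x, X x -> N (T t x - x) @[t --> 0^'+] --> 0].

(* (D, A) is exactly the infinitesimal generator of T. *)
Definition generates (D : set E) (A : E -> E) (T : R -> E -> E) : Prop :=
  forall x y, (D x /\ y = A x) <->
    [/\ X x, X y & N ((t^-1)%:C *: (T t x - x) - y) @[t --> 0^'+] --> 0].

Definition is_C0_semigroup_generated_by (D : set E) (A : E -> E) T : Prop :=
  semigroup_C0 T /\ generates D A T.

Definition continuous_Rplus (Y : set E) (M : E -> R) (U : R -> E) : Prop :=
  forall t, 0 <= t ->
    Y (U t) /\ M (U s - U t) @[s --> within [set s | 0 <= s] (nbhs t)] --> 0.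

(* One-sided derivative at t = 0. *)
Definition is_derivative_Rplus (U : R -> E) (t : R) (l : E) : Prop :=
  N (((s - t)^-1)%:C *: (U s - U t) - l)
    @[s --> within [set s | 0 <= s] t^'] --> 0.

Definition C1_Rplus (U : R -> E) : Prop :=
  continuous_Rplus X N U /\
  exists2 U', continuous_Rplus X N U' &
    forall t, 0 <= t -> is_derivative_Rplus U t (U' t).

Definition is_Riemann_integral (U : R -> E) (t : R) (I : E) : Prop :=
  X I /\ forall e : R, 0 < e -> exists2 delta : R, 0 < delta &
    forall (m : nat) (s tau : nat -> R), s 0%N = 0 -> s m = t ->
      (forall k, (k < m)%N ->
         s k <= tau k <= s k.+1 /\ s k.+1 - s k < delta) ->
      N (\sum_(k < m) (s k.+1 - s k)%:C *: U (tau k) - I) < e.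

Variables (D : set E) (A : E -> E) (U0 : E).

(* The integrated equation U(t) = U0 + A \int_0^t U(s) ds, the integral being
   required to lie in D. *)
Definition mild_solution (U : R -> E) : Prop :=
  continuous_Rplus X N U /\
  forall t, 0 <= t -> exists I : E,
    [/\ is_Riemann_integral U t I, D I & U t = U0 + A I].

Definition graph_norm (x : E) : R := N x + N (A x).

Definition strong_solution (U : R -> E) : Prop :=
  [/\ continuous_Rplus D graph_norm U, C1_Rplus U, U 0 = U0 &
      forall t, 0 <= t -> is_derivative_Rplus U t (A (U t))].

End evolution.

Definition unique_solution {R : realType} {E : Type}
    (sol : (R -> E) -> Prop) (U : R -> E) : Prop :=
  sol U /\ forall V, sol V -> forall t, 0 <= t -> V t = U t.

(* Main.v *)
(* The operator [Ad] is dissipative: Re <Ad U, U> = - \int b |grad v|^2, the coupling terms cancelling.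
   It is onto with a bounded inverse: Ad U = (f, g, h, k) forces v = f and z = h, and then u and y
   solve two Dirichlet problems, by the Riesz theorem and the Poincare inequality. Hence l - Ad is
   onto for every l > 0, the resolvents are contractions, and backward Euler steps converge to a
   contraction semigroup. All the uniqueness claims rest on one remark: if W has left derivative
   A W and A is dissipative, then |W(t)| <= |W(t) - h A W(t)| <= |W(t - h)| + o(h), so |W| does not
   increase. For mild solutions it is applied to the difference of the two integrals; for a second
   semigroup with generator A, the required continuity comes from a gliding hump argument. *)
From mathcomp Require Import all_boot all_order all_algebra.
From mathcomp Require Import all_classical all_reals all_analysis measurable_realfun.
From mathcomp Require Import complex ring lra.
Require Import Defs.

Set Implicit Arguments.
Unset Strict Implicit.
Unset Printing Implicit Defensive.

Import Order.TTheory GRing.Theory Num.Theory.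
Import numFieldNormedType.Exports.

Local Open Scope classical_set_scope.
Local Open Scope ring_scope.
Local Open Scope complex_scope.
Local Open Scope quotient_scope.

(** * The Borel sigma-algebra and integration by parts on R^n *)

(** [grad] and [divergence] are choices among classes of functions, so nothing can be computed about
    them before weak derivatives are known to be unique. This explains the long start: Borel sets of
    R^n, integration by parts, smooth bumps and a Dynkin argument on boxes lead to the fundamental
    lemma of the calculus of variations. Backward Euler steps take the place of the exponentials of
    the Yosida approximation: only resolvents are iterated, and they are contractions commuting with
    [A]. The price is that the error estimates involve [A (A x)], hence vectors [x] with [x] and
    [A x] in the domain. Such vectors are dense for the graph norm, and contractivity carries each
    conclusion over to the other vectors. Density of the domain comes from dissipativity and the
    range condition; invariance of the domain under the limit semigroup comes from commutation with
    a resolvent. Surjectivity of [A] serves a second time: if [x = A w], the integral of the orbit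
    of [x] is [T t w - w], by telescoping Riemann sums, so mild solutions become explicit. *)

Section rV_borel.
Context {R : realType} {n : nat}.
Implicit Types A : set 'rV[R]_n.

Lemma rV_ballE (x : 'rV[R]_n) (e : R) : 0 < e ->
  ball x e = [set y | forall i, `|x ord0 i - y ord0 i| < e].
Proof.
move=> e0; apply/seteqP; split=> y.
  by move=> [_ h] i; exact: h.
by move=> h; split => // i j; rewrite ord1; exact: h.
Qed.

Lemma measurable_rV_forall (B : 'I_n -> set (measurableTypeR R)) :
  (forall i, measurable (B i)) ->
  measurable [set x : 'rV[R]_n | forall i, B i (x ord0 i)].
Proof.
move=> mB.
rewrite (_ : [set _ | _] = \bigcap_(i in setT) (rV_coord i @^-1` B i)).
  apply: fin_bigcap_measurable => // i _.
  by rewrite -[X in measurable X]setTI; exact: measurable_rV_coord.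
by apply/seteqP; split => [x h i _|x h i]; exact: h.
Qed.

Lemma rV_ball_measurable (x : 'rV[R]_n) (e : R) : 0 < e -> measurable (ball x e).
Proof.
move=> e0; rewrite rV_ballE//.
apply: (@measurable_rV_forall (fun i => [set t : measurableTypeR R | `|x ord0 i - t| < e])) => i.
rewrite (_ : [set _ | _] = ball (x ord0 i) e) //; exact: open_measurable (ball_open _ _).
Qed.

(** A countable family of balls, empty as soon as the doubled ball leaves [A]. The doubling leaves
    room for the closed box with the same centre and radius, which must lie in [A] when bumps are
    placed on it. *)
Definition open_cover_ball A (k : 'rV[rat]_n * nat) : set 'rV[R]_n :=
  let q : 'rV[R]_n := map_mx ratr k.1 in let e : R := k.2.+1%:R^-1 in
  [set x | ball q e x /\ ball q (2 * e) `<=` A].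

Lemma open_cover_ballE A : open A ->
  A = \bigcup_k open_cover_ball A k.
Proof.
move=> oA; apply/seteqP; split=> x; last first.
  move=> [[q k] _ [qx]]; apply; apply: le_ball qx.
  by rewrite ler_peMl// ler1n.
move=> /oA /nbhs_ballP[e /= e0 xA].
(* A point of the doubled ball is within [3 / k.+1] of [x]: one radius from [x] to the rational
   centre and two from the centre to the point. *)
have [k ke] : exists k : nat, k.+1%:R^-1 < e / 3.
  have [k _ /(_ k (leqnn k)) hk] :=
    near_infty_natSinv_lt (PosNum (divr_gt0 e0 (ltr0Sn R 2))).
  by exists k.
have /choice[q hq] : forall i, exists q : rat, `|ratr q - x ord0 i| < k.+1%:R^-1.
  move=> i; have [] := @dense_rat R (ball (x ord0 i) k.+1%:R^-1).
  - by exists (x ord0 i); exact: ballxx.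
  - exact: ball_open.
  by move=> y [xq [q _ qE]]; exists q; rewrite distrC qE.
exists (\row_i q i, k) => //=; split.
  by rewrite rV_ballE// => i /=; rewrite !mxE.
apply: subset_trans xA => y; rewrite !rV_ballE//= => h i.
have := h i; rewrite !mxE => {}h.
rewrite (le_lt_trans (ler_distD (ratr (q i)) _ _))//.
rewrite distrC.
by move: (hq i) h ke; move: (_^-1) => w; lra.
Qed.

Lemma open_cover_ball_cases A k : open_cover_ball A k = set0 \/
  exists q e, [/\ 0 < e, open_cover_ball A k = ball q e & ball q (2 * e) `<=` A].
Proof.
have [kA|kA] := pselect (ball (map_mx ratr k.1 : 'rV[R]_n) (2 * k.2.+1%:R^-1) `<=` A).
  right; exists (map_mx ratr k.1 : 'rV[R]_n), k.2.+1%:R^-1; split => //.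
  by apply/seteqP; split => [x []|x].
by left; rewrite -subset0 => x [].
Qed.

(** The sigma-algebra is generated by the coordinates, so an open set has to be exhibited as a
    countable union of balls, which for the sup norm are products of intervals. *)
Lemma rV_open_measurable A : open A -> measurable A.
Proof.
move=> /open_cover_ballE ->; apply: countable_bigcupT_measurable => // k.
have [->|[q [e [e0 -> _]]]] := open_cover_ball_cases A k; first exact: measurable0.
exact: rV_ball_measurable.
Qed.

Lemma rV_continuous_measurable (f : 'rV[R]_n -> R) D :
  continuous f -> measurable_fun D f.
Proof.
move=> cf; apply: (@measurable_funS _ _ _ _ setT) => //.
apply: (measurability _ (RGenOpens.measurableE R)).
move=> _ [_ [a [b ->] <-]]; rewrite setTI.
by apply: rV_open_measurable; move/continuousP: cf; apply; exact: interval_open.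
Qed.

End rV_borel.

(** * Functions vanishing off a cube *)

Section compact_support.
Context {R : realType}.

Definition sup_box n (M : R) : set 'rV[R]_n := [set x | forall i, `|x ord0 i| <= M].

(** A cube is used in place of a support because the property passes to the slices [rV_cons (t, _)]
    and [rV_cons (_, x)], as the induction on the dimension requires. *)
Definition vanishes_off n (M : R) (f : 'rV[R]_n -> R) : Prop :=
  forall (x : 'rV[R]_n) i, M < `|x ord0 i| -> f x = 0.

Lemma compact_sup_box n (M : R) : compact (@sup_box n M).
Proof.
rewrite (_ : sup_box _ = [set v : 'rV[R]_n | forall i, `[- M, M]%classic (v ord0 i)]).
  by apply: (@rV_compact _ _ (fun=> `[- M, M]%classic)) => _; exact: segment_compact.
by apply/seteqP; split => x h i; move: (h i); rewrite /= in_itv /= ler_norml.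
Qed.

Lemma measurable_sup_box n (M : R) : measurable (@sup_box n M).
Proof.
apply: (@measurable_rV_forall _ _ (fun i => [set t : measurableTypeR R | `|t| <= M])) => i.
rewrite (_ : [set _ | _] = `[- M, M]%classic) //.
by apply/seteqP; split => x /=; rewrite in_itv /= ler_norml.
Qed.

Lemma vanishes_off_outside n (M : R) (f : 'rV[R]_n -> R) x :
  vanishes_off M f -> ~ sup_box M x -> f x = 0.
Proof. by move=> fM /existsNP[i /negP]; rewrite -ltNge; exact: fM. Qed.

Lemma vanishes_off_bounded n (M : R) (f : 'rV[R]_n -> R) :
  continuous f -> vanishes_off M f -> exists K : R, forall x, `|f x| <= K.
Proof.
move=> cf fM.
have [K []] : bounded_set (f @` sup_box M).
  apply: compact_bounded; apply: continuous_compact; last exact: compact_sup_box.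
  exact: continuous_subspaceT.
move=> _ /(_ (`|K| + 1)) hK; exists (`|K| + 1) => x.
have [xM|xM] := pselect (sup_box M x).
  by apply: hK; [rewrite (le_lt_trans (ler_norm _))// ltrDl|exists x].
by rewrite (vanishes_off_outside fM xM) normr0 addr_ge0.
Qed.

Lemma lebesgue_rV_sup_box n (M : R) : (lebesgue_rV n (@sup_box n M) < +oo)%E.
Proof.
elim: n => [|n IHn] /=.
  by rewrite diracE ltry.
rewrite /lebesgue_rVS /pushforward.
rewrite (_ : _ @^-1` _ = `[- M, M]%classic `*` @sup_box n M).
  rewrite product_measure1E//; last exact: measurable_sup_box.
  have fin : ((@lebesgue_measure R) `[(- M)%R, M]%classic < +oo)%E.
    by rewrite lebesgue_measure_itv/=; case: ifPn => // _; rewrite -?EFinD ltry.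
  by apply: lte_mul_pinfty => //; rewrite ge0_fin_numE.
apply/seteqP; split=> -[t x]; rewrite /sup_box /rV_cons /= in_itv /= -ler_norml.
  move=> h; split=> [|i].
    by have := h (lshift n ord0 : 'I_(1 + n)); rewrite (@row_mxEl _ 1 1 n) mxE mulr1n.
  by have := h (rshift 1 i : 'I_(1 + n)); rewrite (@row_mxEr _ 1 1 n).
move=> [ht hx] i; case: (split_ordP (i : 'I_(1 + n))) => j ->.
  by rewrite (@row_mxEl _ 1 1 n) mxE !ord1 mulr1n.
by rewrite (@row_mxEr _ 1 1 n).
Qed.

Lemma bounded_lebesgue_rV n (A : set 'rV[R]_n) :
  bounded_set A -> measurable A -> (lebesgue_rV n A < +oo)%E.
Proof.
move=> [M [_ AM]] mA; apply: le_lt_trans (lebesgue_rV_sup_box n (`|M| + 1)).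
apply: le_measure; rewrite ?inE //; first exact: measurable_sup_box.
move=> x Ax i; have := AM (`|M| + 1).
rewrite (le_lt_trans (ler_norm _)) ?ltrDl// => /(_ isT x Ax).
apply: le_trans; rewrite [leRHS]mx_normrE.
exact: (@le_bigmax _ _ _ 0 (fun i => `|x i.1 i.2|) (ord0, i)).
Qed.

Lemma integrable_vanishes_off n (M : R) (f : 'rV[R]_n -> R) :
  continuous f -> vanishes_off M f ->
  (lebesgue_rV n).-integrable setT (EFin \o f).
Proof.
move=> cf fM.
rewrite (_ : EFin \o f = (EFin \o f) \_ (sup_box M)); last first.
  apply/funext => x; rewrite /patch; case: ifPn => //; rewrite notin_setE => /=.
  by move/(vanishes_off_outside fM) => ->.
rewrite -integrable_mkcond; last exact: measurable_sup_box.
apply: measurable_bounded_integrable.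
- exact: measurable_sup_box.
- exact: lebesgue_rV_sup_box.
- exact: rV_continuous_measurable.
- have [K hK] := vanishes_off_bounded cf fM.
  by exists K; split; [exact: num_real|move=> x Kx y _; exact: le_trans (hK y) (ltW Kx)].
Qed.

Lemma integral_derivative_compact_support (M : R) (f g : R -> R) :
  continuous g -> (forall t : R, is_derive t 1 f (g t)) ->
  (forall t : R, M < `|t| -> f t = 0) -> (forall t : R, M < `|t| -> g t = 0) ->
  (\int[lebesgue_measure]_t (g t)%:E = 0)%E.
Proof.
move=> cg df f0 g0.
have cf : continuous f.
  by move=> t; apply: differentiable_continuous; apply/derivable1_diffP; case: (df t).
(* Positive whatever the sign of [M], and larger than [M], so that both end points [N] and [- N] lie
   where [f] vanishes. *)
pose N : R := `|M| + 1.
have N0 : 0 < N by rewrite ltr_wpDl.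
have MN : M < N by rewrite (le_lt_trans (ler_norm _))// ltrDl.
transitivity (\int[lebesgue_measure]_(t in `[(- N)%R, N]) (g t)%:E)%E.
  rewrite [RHS]integral_mkcond; apply: eq_integral => t _.
  rewrite /patch; case: ifPn => //; rewrite notin_setE /= in_itv /= -ler_norml => /negP.
  by rewrite -ltNge => /(lt_trans MN) /g0 ->.
rewrite (@continuous_FTC2 _ g f).
- by rewrite (f0 N) ?(f0 (- N)) ?normrN ?(gtr0_norm N0)// subee.
- by rewrite gtrN.
- exact: continuous_subspaceT.
- split => [t _||]; first by case: (df t).
  + by apply: cvg_at_right_filter; exact: cf.
  + by apply: cvg_at_left_filter; exact: cf.
- by move=> t _; rewrite derive1E; exact: derive_val.
Qed.

Lemma rV_consE0 n t (x : 'rV[R]_n) : rV_cons (t, x) ord0 ord0 = t.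
Proof. exact: (congr1 fst (rV_consK (t, x))). Qed.

Lemma rV_consES n t (x : 'rV[R]_n) j : rV_cons (t, x) ord0 (lift ord0 j) = x ord0 j.
Proof.
rewrite /rV_cons /= (_ : lift ord0 j = rshift 1 j :> 'I_(1 + n)); last exact/val_inj.
by rewrite (@row_mxEr _ 1 1 n).
Qed.

Lemma rV_cons_eq n (t : R) (x : 'rV[R]_n) (y : 'rV[R]_n.+1) :
  y ord0 ord0 = t -> (forall j, y ord0 (lift ord0 j) = x ord0 j) -> y = rV_cons (t, x).
Proof.
move=> h0 hS; apply/rowP => i.
by case: (unliftP ord0 i) => [j|] ->; rewrite ?rV_consES ?rV_consE0.
Qed.

Lemma continuous_rV_cons n : continuous (@rV_cons R n).
Proof.
move=> [t x] A /nbhs_ballP[e /= e0 eA]; apply/nbhs_ballP; exists e => //= -[s y] [/= ts xy].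
apply: eA; rewrite rV_ballE// => i /=.
case: (unliftP ord0 i) => [j|] ->; rewrite ?rV_consES ?rV_consE0//.
by move: xy; rewrite rV_ballE// => /(_ j).
Qed.
End compact_support.

(** * The integral of a partial derivative *)

Section integral_partial.
Context {R : realType}.

(** A directional derivative depends only on the values along one line. This moves derivatives
    between spaces of different dimensions, in particular between R^n and R. *)
Lemma is_derive_comp_shift (V W : normedModType R) (F : V -> R) (G : W -> R)
    (x v : V) (y w : W) (l : R) :
  (forall h : R, F (h *: v + x) = G (h *: w + y)) -> is_derive y w G l ->
  is_derive x v F l.
Proof.
move=> FG [dG <-].
have FG0 : F x = G y by have := FG 0; rewrite !scale0r !add0r.
have E : (fun h : R => h^-1 *: (F (h *: v + x) - F x)) =
         (fun h : R => h^-1 *: (G (h *: w + y) - G y)).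
  by apply/funext => h; rewrite FG FG0.
by split; rewrite /derivable /derive /comp /shift /= E.
Qed.

(** Induction on the dimension with Fubini. If the differentiated coordinate is not the first one,
    each slice with the first coordinate fixed has integral zero by induction. If it is the first
    one, the integral over that coordinate is taken inside and vanishes by the fundamental theorem
    of calculus. *)
Lemma integral_partial_compact_support n (i : 'I_n) (M : R) (f g : 'rV[R]_n -> R) :
  continuous g -> (forall x, is_derive x (delta_mx ord0 i) f (g x)) ->
  vanishes_off M f -> vanishes_off M g ->
  (\int[lebesgue_rV n]_x (g x)%:E = 0)%E.
Proof.
elim: n i f g => [[]//|n IHn] i f g cg df f0 g0.
have mg : measurable_fun setT (EFin \o g) by apply/measurable_EFinP; exact: rV_continuous_measurable.
have mgc : measurable_fun setT ((EFin \o g) \o @rV_cons R n).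
  by apply: measurableT_comp => //; exact: measurable_rV_cons.
have ig : (@lebesgue_measure R \x lebesgue_rV n)%E.-integrable setT ((EFin \o g) \o @rV_cons R n).
  have /integrableP[_] := integrable_vanishes_off cg g0.
  rewrite /= [lebesgue_rVS _]/(pushforward _ _) ge0_integral_pushforward//=; last 2 first.
  - exact: measurable_rV_cons.
  - by apply/measurable_EFinP; apply: measurableT_comp => //; exact: rV_continuous_measurable.
  by rewrite preimage_setT => gfin; apply/integrableP; split.
rewrite /= [lebesgue_rVS _]/(pushforward _ _) integral_pushforward//=; last first.
  exact: measurable_rV_cons.
rewrite preimage_setT.
have ccons (t : R) : continuous (fun x : 'rV[R]_n => rV_cons (t, x)).
  move=> x A /(@continuous_rV_cons _ _ (t, x))[[P Q] /= [Pt Qx] PQ].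
  by apply: filterS Qx => y Qy; apply: (PQ (t, y)); split=> //=; exact: nbhs_singleton.
have ccons' (x : 'rV[R]_n) : continuous (fun t : R => rV_cons (t, x)).
  move=> t A /(@continuous_rV_cons _ _ (t, x))[[P Q] /= [Pt Qx] PQ].
  by apply: filterS Pt => s Ps; apply: (PQ (s, x)); split=> //=; exact: nbhs_singleton.
case: (unliftP ord0 i) df => [j|] -> df.
  rewrite -integral12_prod_meas1//.
  rewrite /fubini_F integral0_eq// => t _ /=.
  apply: (IHn j (fun x => f (rV_cons (t, x)))).
  - by move=> x; apply: continuous_comp; [exact: ccons|exact: cg].
  - move=> x; apply: is_derive_comp_shift (df (rV_cons (t, x))) => h.
    congr f; symmetry; apply: rV_cons_eq => [|k] /=; rewrite mxE ?rV_consE0 ?rV_consES !mxE.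
      by rewrite andbF mulr0 add0r.
    by rewrite (inj_eq (@lift_inj _ _)).
  - by move=> x k Mx; apply: (f0 _ (lift ord0 k)); rewrite rV_consES.
  - by move=> x k Mx; apply: (g0 _ (lift ord0 k)); rewrite rV_consES.
rewrite -integral21_prod_meas1//.
rewrite /fubini_G integral0_eq// => x _ /=.
apply: (@integral_derivative_compact_support _ M (fun t => f (rV_cons (t, x)))).
- by move=> t; apply: continuous_comp; [exact: ccons'|exact: cg].
- move=> t; apply: is_derive_comp_shift (df (rV_cons (t, x))) => h.
  congr f; symmetry; apply: rV_cons_eq => [|k] /=; rewrite mxE ?rV_consE0 ?rV_consES !mxE.
    by [].
  by rewrite andbF mulr0 add0r.
- by move=> t Mt; apply: (f0 _ ord0); rewrite rV_consE0.
- by move=> t Mt; apply: (g0 _ ord0); rewrite rV_consE0.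
Qed.

End integral_partial.

(** * Smooth bump functions *)

Section Ck_algebra.
Context {R : realType} {n : nat}.
Implicit Types (f g : 'rV[R]_n -> R) (i : 'I_n).
Local Notation "'e_ i" := (delta_mx ord0 i : 'rV[R]_n) (at level 8, i at level 2).

Lemma iter_partial_rcons (s : seq 'I_n) i f :
  iter_partial (rcons s i) f = iter_partial s ('D_('e_ i) f).
Proof. by rewrite /iter_partial foldr_rcons. Qed.

Lemma is_Ck0P f : is_Ck 0 f <-> continuous f.
Proof.
split=> [/(_ [::] (leqnn 0))[]//|cf [|//] _]; split=> //.
Qed.

(** The last index of the list in [iter_partial] is the first derivative taken. Peeling it off with
    [rcons] turns [is_Ck] into a recursion on [k], which is the form used in every induction
    below. *)
Lemma is_CkSP k f : is_Ck k.+1 f <->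
  continuous f /\ forall i, (forall x, derivable f x ('e_ i)) /\ is_Ck k ('D_('e_ i) f).
Proof.
split=> [fk|[cf df] s].
  split=> [|i]; first by have [] := fk [::] (leq0n _).
  have [_ /(_ isT) df] := fk [::] (leq0n _).
  split=> [x|s sk]; first exact: df.
  have := fk (rcons s i); rewrite size_rcons ltnS => /(_ sk)[cs ds].
  by rewrite -iter_partial_rcons.
case: (lastP s) => [_|s' i]; first by split=> // _ i x; have [] := df i.
rewrite size_rcons ltnS iter_partial_rcons => sk.
by have [_ /(_ s' sk)[? h]] := df i; split.
Qed.

Lemma is_Ck_continuous k f : is_Ck k f -> continuous f.
Proof. by move=> /(_ [::] (leq0n _))[]. Qed.

Lemma is_CkW k f : is_Ck k.+1 f -> is_Ck k f.
Proof.
move=> fk s sk; have [cs ds] := fk s (leqW sk); split=> // sk'.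
by apply: ds; exact: leqW.
Qed.

Lemma is_Ck_cst k (a : R) : is_Ck k (cst a : 'rV[R]_n -> R).
Proof.
elim: k a => [|k IHk] a; first exact/is_Ck0P/cst_continuous.
apply/is_CkSP; split=> [|i]; first exact: cst_continuous.
split=> [x|]; first exact: derivable_cst.
rewrite (_ : 'D_('e_ i) _ = cst 0) //.
by apply/funext => x; rewrite derive_cst.
Qed.

Lemma is_CkD k f g : is_Ck k f -> is_Ck k g -> is_Ck k (f + g).
Proof.
elim: k f g => [|k IHk] f g.
  by move=> /is_Ck0P cf /is_Ck0P cg; apply/is_Ck0P => x; exact: (continuousD (cf x) (cg x)).
move=> /is_CkSP[cf df] /is_CkSP[cg dg]; apply/is_CkSP.
split=> [x|i]; first by exact: (continuousD (cf x) (cg x)).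
have [{}df dfk] := df i; have [{}dg dgk] := dg i.
split=> [x|]; first exact: derivableD.
have := IHk _ _ dfk dgk; congr (is_Ck k _).
by apply/funext => x; rewrite deriveD.
Qed.

Lemma is_CkM k f g : is_Ck k f -> is_Ck k g -> is_Ck k (f * g).
Proof.
elim: k f g => [|k IHk] f g.
  by move=> /is_Ck0P cf /is_Ck0P cg; apply/is_Ck0P => x; exact: (continuousM (cf x) (cg x)).
move=> fk gk; have [cf df] := (is_CkSP _ _).1 fk; have [cg dg] := (is_CkSP _ _).1 gk.
apply/is_CkSP; split=> [x|i]; first by exact: (continuousM (cf x) (cg x)).
have [{}df dfk] := df i; have [{}dg dgk] := dg i.
split=> [x|]; first exact: derivableM.
have := is_CkD (IHk _ _ (is_CkW fk) dgk) (IHk _ _ (is_CkW gk) dfk); congr (is_Ck k _).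
by apply/funext => x; rewrite deriveM.
Qed.

Lemma is_CkZ k (a : R) f : is_Ck k f -> is_Ck k (fun x => a * f x).
Proof. by move=> fk; have := is_CkM (@is_Ck_cst k a) fk; congr (is_Ck k _); exact/funext. Qed.

Lemma is_Ck_prod k (I : Type) (r : seq I) (F : I -> 'rV[R]_n -> R) :
  (forall j, is_Ck k (F j)) -> is_Ck k (fun x => \prod_(j <- r) F j x).
Proof.
move=> Fk; elim: r => [|j r IHr].
  have := @is_Ck_cst k 1; congr (is_Ck k _).
  by apply/funext => x; rewrite big_nil.
have := is_CkM (Fk j) IHr; congr (is_Ck k _).
by apply/funext => x; rewrite big_cons.
Qed.

Lemma smooth_continuous f : smooth f -> continuous f.
Proof. by move=> /(_ 0%N); exact: is_Ck_continuous. Qed.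

Lemma smooth_partial i f : smooth f -> smooth ('D_('e_ i) f).
Proof. by move=> sf k; have [_ /(_ i)[]] := (is_CkSP _ _).1 (sf k.+1). Qed.

Lemma smooth_is_derive i f x : smooth f -> is_derive x ('e_ i) f ('D_('e_ i) f x).
Proof.
move=> /(_ 1) /is_CkSP[_ /(_ i)[df _]]; exact/derivableP/df.
Qed.

End Ck_algebra.

(** * The functions p(1/t) exp(-1/t) *)

Section flat_exponential.
Context {R : realType}.
Implicit Types p : {poly R}.

(** The polynomial factor makes the family closed under differentiation, so smoothness of exp(-1/t)
    reduces to one derivative computation for all [p] at once. *)
Definition flat_exp p (t : R) : R := if 0 < t then p.[t^-1] * expR (- t^-1) else 0.

Lemma flat_exp_bounded p : exists K : R, forall t, `|flat_exp p t| <= K.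
Proof.
(* Here [u] stands for [1 / t]. The factor [u ^+ 0] prepares the induction on [p], whose hypothesis
   has to cover all powers of [u]: multiplying [p] by the variable raises the power by one. *)
suff [K hK] : exists K : R, forall u, 0 < u -> `|p.[u]| * u ^+ 0 * expR (- u) <= K.
  exists (Num.max K 0) => t; rewrite /flat_exp; case: ifPn => [t0|_]; last first.
    by rewrite normr0 le_max lexx orbT.
  have := hK t^-1; rewrite invr_gt0 t0 => /(_ isT).
  by rewrite expr0 mulr1 normrM (gtr0_norm (expR_gt0 _)) le_max => ->.
(* With [u = m * v], exp(u) is the [m]-th power of exp(v), and v is below exp(v); hence the bound
   [m%:R ^+ m]. *)
have powexp m : exists K : R, forall u, 0 < u -> u ^+ m * expR (- u) <= K.
  exists (m%:R ^+ m) => u u0.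
  case: m => [|m]; first by rewrite !expr0 mul1r -expR0 ler_expR oppr_le0 ltW.
  rewrite expRN ler_pdivrMr ?expR_gt0//.
  have -> : u = m.+1%:R * (u / m.+1%:R) by rewrite mulrC divfK.
  rewrite expRM_natl exprMn ler_pM2l ?exprn_gt0 ?ltr0n//.
  rewrite lerXn2r ?nnegrE ?expR_ge0 ?divr_ge0 ?ler0n ?ltW//.
  by apply: lt_le_trans (expR_ge1Dx _); rewrite ltrDr.
elim/poly_ind: p 0%N => [|p c IHp] m.
  by exists 0 => u _; rewrite horner0 normr0 !mul0r.
have [K hK] := IHp m.+1; have [L hL] := powexp m.
exists (K + `|c| * L) => u u0; rewrite hornerMXaddC.
have e0 := expR_ge0 (- u).
have um0 : 0 <= u ^+ m by rewrite exprn_ge0 ?ltW.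
apply: (@le_trans _ _ (`|p.[u]| * u ^+ m.+1 * expR (- u) + `|c| * (u ^+ m * expR (- u)))).
  rewrite !mulrA -mulrDl ler_wpM2r// exprS mulrA -mulrDl ler_wpM2r//.
  by rewrite (le_trans (ler_normD _ _))// normrM (gtr0_norm u0).
by rewrite lerD ?hK// ler_wpM2l// hL.
Qed.

(** For positive [t], [flat_exp ('X^2 * p) t] is [flat_exp p t] divided by [t ^+ 2], and it is
    bounded by the previous lemma. Quadratic decay is what gives a zero derivative at the origin. *)
Lemma flat_exp_le p : exists K : R, forall t, `|flat_exp p t| <= K * t ^+ 2.
Proof.
have [K hK] := flat_exp_bounded ('X^2 * p); exists K => t.
rewrite /flat_exp; case: ifPn => [t0|]; last first.
  rewrite normr0 => _; apply: mulr_ge0; last exact: sqr_ge0.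
  exact: le_trans (normr_ge0 _) (hK 0).
have := hK t; rewrite /flat_exp t0 hornerM hornerXn exprVn -mulrA normrM.
by rewrite normfV (ger0_norm (sqr_ge0 t)) ler_pdivrMl ?exprn_gt0// (mulrC _ K).
Qed.

(** With [u = 1 / t] the chain rule multiplies by [- u ^ 2], and differentiating p(u) exp(-u) gives
    (p' - p)(u) exp(-u): this is the new polynomial. At the origin the difference quotient is O(t)
    by [flat_exp_le]. *)
Lemma is_derive_flat_exp p (t : R) :
  is_derive t 1 (flat_exp p) (flat_exp ('X^2 * (p - p^`())) t).
Proof.
have [t0|t0|->] := ltgtP t 0.
- have -> : flat_exp ('X^2 * (p - p^`())) t = 0 by rewrite /flat_exp ltNge ltW.
  apply: (@near_eq_is_derive _ _ _ (cst 0)) (is_derive_cst _ _ _).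
  near=> s; rewrite /flat_exp /= ltNge ltW//; near: s.
  exact: lt_nbhsl.
- have tn : t != 0 by rewrite gt_eqF.
  pose f (s : R) := p.[s^-1] * expR (- s^-1).
  apply: (@near_eq_is_derive _ _ _ f).
    near=> s; rewrite /flat_exp /f ifT//; near: s.
    exact: lt_nbhsr.
  have dV : is_derive t 1 (fun s : R => s^-1) (- t ^- 2).
    by apply: is_derive_eq (is_deriveV _ (is_derive_id _ _)) _ => //; rewrite /GRing.scale /= mulr1.
  have dN : is_derive t 1 (fun s : R => - s^-1) (t ^- 2).
    by apply: is_derive_eq (is_deriveN dV) _; rewrite opprK.
  have d1 := is_derive1_comp (is_derive_poly p t^-1) dV.
  have d2 := @is_derive1_comp _ expR (fun s : R => - s^-1) t _ _ (is_derive_expR (- t^-1)) dN.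
  apply: is_derive_eq (is_deriveM d1 d2) _.
  rewrite /flat_exp t0 !hornerE /GRing.scale /= exprVn; ring.
- have [K hK] := flat_exp_le p.
  have K0 : 0 <= K by have := hK 1; rewrite expr1n mulr1; exact: le_trans.
  have E q : flat_exp q 0 = 0 by rewrite /flat_exp ltxx.
  have L : (fun h : R => h^-1 *: (flat_exp p (h *: (1 : R) + 0) - flat_exp p 0)) @ 0^' --> (0 : R).
    apply/cvgr0Pnorm_lt => e e0.
    near=> h; rewrite E subr0 addr0 /GRing.scale /= mulr1 normrM normfV.
    have h0 : 0 < `|h| by rewrite normr_gt0; near: h; exact: nbhs_dnbhs_neq.
    rewrite ltr_pdivrMl// (le_lt_trans (hK h))// -real_normK ?num_real// expr2 mulrCA mulrC.
    rewrite [ltLHS]mulrC ltr_pM2l//.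
    rewrite (@le_lt_trans _ _ ((K + 1) * `|h|))//.
      by rewrite ler_wpM2r// lerDl.
    rewrite -ltr_pdivlMl ?ltr_wpDl//.
    near: h; apply: dnbhs0_lt; by rewrite mulr_gt0// invr_gt0 ltr_wpDl.
  rewrite E; split; first by apply/cvg_ex; exists 0.
  exact/cvg_lim.
Unshelve. all: by end_near. Qed.

End flat_exponential.

(** * Open boxes as a generating system stable under intersection *)

Section open_boxes.
Context {R : realType} {n : nat}.
Implicit Types a b x : 'rV[R]_n.

Definition open_box a b : set 'rV[R]_n :=
  [set x | forall i, a ord0 i < x ord0 i < b ord0 i].

Definition open_boxes : set_system 'rV[R]_n := [set A | exists a b, A = open_box a b].

Lemma open_box_measurable a b : measurable (open_box a b).
Proof.
apply: (@measurable_rV_forall _ _ (fun i => `]a ord0 i, b ord0 i[%classic : set (measurableTypeR R))) => i.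
exact: measurable_itv.
Qed.

Lemma open_boxI a b a' b' : open_box a b `&` open_box a' b' =
  open_box (\row_i Num.max (a ord0 i) (a' ord0 i)) (\row_i Num.min (b ord0 i) (b' ord0 i)).
Proof.
apply/seteqP; split => x.
  by move=> [h h'] i; rewrite !mxE gt_max lt_min; have /andP[-> ->] := h i; have /andP[-> ->] := h' i.
by move=> h; split => i; have := h i; rewrite !mxE gt_max lt_min => /andP[/andP[? ?] /andP[? ?]]; apply/andP.
Qed.

Lemma setI_closed_open_boxes : setI_closed open_boxes.
Proof.
by move=> _ _ [a [b ->]] [a' [b' ->]]; rewrite open_boxI; eexists; eexists.
Qed.

Lemma measurable_open_boxes : @measurable _ 'rV[R]_n = <<s open_boxes >>.
Proof.
apply/seteqP; split; last first.
  apply: smallest_sub; first exact: sigma_algebra_measurable.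
  by move=> _ [a [b ->]]; exact: open_box_measurable.
apply: smallest_sub; first exact: smallest_sigma_algebra.
move=> A; rewrite -bigcup_seq => -[i /= _ [B mB <-]]; rewrite setTI.
have : (@RGenOpens.G R).-sigma.-measurable B by rewrite -RGenOpens.measurableE.
move: B {mB}; apply: smallest_sub => [|_ [x [y ->]]] /=.
  split => /=.
  - by rewrite preimage_set0; exact: (@measurable0 _ (g_sigma_algebraType open_boxes)).
  - by move=> B; rewrite setTD preimage_setC; exact: (@measurableC _ (g_sigma_algebraType open_boxes)).
  - move=> F mF; rewrite preimage_bigcup.
    exact: (@bigcupT_measurable _ (g_sigma_algebraType open_boxes)).
(* A slab constraining only the coordinate [i] is the union of the boxes whose other sides are []-k,
   k[]. *)
pose a (k : nat) : 'rV[R]_n := \row_j (if j == i then x else - k%:R).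
pose b (k : nat) : 'rV[R]_n := \row_j (if j == i then y else k%:R).
rewrite (_ : _ @^-1` _ = \bigcup_k open_box (a k) (b k)).
  apply: (@bigcupT_measurable _ (g_sigma_algebraType open_boxes)) => k.
  by apply: sub_sigma_algebra; exists (a k), (b k).
apply/seteqP; split => [v|v [k _ /(_ i)]]; last first.
  by rewrite /= !mxE eqxx in_itv.
rewrite /preimage /rV_coord /= in_itv /= => vxy.
pose M := \sum_j `|v ord0 j|.
have vM j : `|v ord0 j| <= M by rewrite /M (bigD1 j)//= lerDl sumr_ge0.
exists (Num.bound M) => // j; rewrite !mxE; case: ifPn => [/eqP -> //|_].
rewrite -ltr_norml (le_lt_trans (vM j))// archi_boundP//.
exact: le_trans (vM i).
Qed.

Lemma ball_open_box (q : 'rV[R]_n) (e : R) : 0 < e ->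
  ball q e = open_box (q - const_mx e) (q + const_mx e).
Proof.
move=> e0; rewrite rV_ballE//; apply/seteqP; split => x h i; have := h i;
  by rewrite /= !mxE ltr_norml => /andP[? ?]; apply/andP; split; lra.
Qed.

End open_boxes.

Section box_bumps.
Context {R : realType} {n : nat}.
Implicit Types a b x : 'rV[R]_n.

Lemma is_Ck_flat_exp_coord k (p : {poly R}) (i : 'I_n) (c d : R) :
  is_Ck k (fun x : 'rV[R]_n => flat_exp p (c * x ord0 i + d)).
Proof.
have cont q : continuous (fun x : 'rV[R]_n => flat_exp q (c * x ord0 i + d)).
  move=> x; apply: (@continuous_comp _ _ _ (fun x : 'rV[R]_n => c * x ord0 i + d)).
    apply: (@continuousD _ _ _ (fun x : 'rV[R]_n => c * x ord0 i) (cst d)); last exact: cst_continuous.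
    apply: (@continuousM _ _ (cst c) (fun x : 'rV[R]_n => x ord0 i)); first exact: cst_continuous.
    exact: coord_continuous.
  apply: differentiable_continuous; apply/derivable1_diffP.
  by case: (is_derive_flat_exp q (c * x ord0 i + d)).
elim: k p => [|k IHk] p; first exact/is_Ck0P.
apply/is_CkSP; split=> [|j]; first exact: cont.
pose p' := 'X^2 * (p - p^`()).
pose d' x := (c * (i == j)%:R) * flat_exp p' (c * x ord0 i + d).
have D x : is_derive x (delta_mx ord0 j) (fun x : 'rV[R]_n => flat_exp p (c * x ord0 i + d)) (d' x).
  pose s : R := c * (i == j)%:R; pose y := c * x ord0 i + d.
  have dG : is_derive (0 : R) 1 (flat_exp p \o (fun t => s * t + y)) (d' x).
    have dA : is_derive (0 : R) 1 (fun t : R => s * t + y) s.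
      have := is_deriveD (is_deriveZ s (is_derive_id (0 : R) 1)) (is_derive_cst y (0 : R) (1 : R)).
      by rewrite /GRing.scale /= mulr1 addr0.
    have dF := is_derive_flat_exp p (s * 0 + y).
    have /is_derive_eq := @is_derive1_comp _ (flat_exp p) (fun t => s * t + y) 0 _ _ dF dA.
    by apply; rewrite mulr0 add0r mulrC.
  apply: is_derive_comp_shift dG => h.
  rewrite /= !mxE eqxx /= /s /y /GRing.scale /=; congr flat_exp; ring.
split=> [x|]; first by case: (D x).
have := is_CkZ (c * (i == j)%:R) (IHk p'); congr (is_Ck k _).
by apply/funext => x; have /@derive_val := D x.
Qed.

(** The factor [k] dilates exp(-1/t), which tends to 1 at infinity; so the bumps tend to the
    indicator of the open box while staying supported in its closure for every [k]. *)
Definition box_bump a b (k : nat) x : R :=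
  \prod_i (flat_exp 1 (k%:R * (x ord0 i - a ord0 i)) * flat_exp 1 (k%:R * (b ord0 i - x ord0 i))).

Lemma box_bump_smooth a b k : smooth (box_bump a b k).
Proof.
move=> m; apply: (@is_Ck_prod _ _ _ _ _ (fun i x => flat_exp 1 (k%:R * (x ord0 i - a ord0 i)) *
  flat_exp 1 (k%:R * (b ord0 i - x ord0 i)))) => i.
have h c d := @is_Ck_flat_exp_coord m 1 i c d.
have := is_CkM (h k%:R (- (k%:R * a ord0 i))) (h (- k%:R) (k%:R * b ord0 i)).
by congr (is_Ck m _); apply/funext => x; congr (flat_exp _ _ * flat_exp _ _); ring.
Qed.

Lemma flat_exp1_ge0 (t : R) : 0 <= flat_exp 1 t.
Proof. by rewrite /flat_exp; case: ifPn => // _; rewrite hornerC mul1r expR_ge0. Qed.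

Lemma flat_exp1_le1 (t : R) : flat_exp 1 t <= 1.
Proof.
rewrite /flat_exp; case: ifPn => // t0.
by rewrite hornerC mul1r -expR0 ler_expR oppr_le0 invr_ge0 ltW.
Qed.

Lemma box_bump_bounds a b k x : 0 <= box_bump a b k x <= 1.
Proof.
rewrite /box_bump; apply: (big_ind (fun y => 0 <= y <= 1)) => [|y z|i _].
- by rewrite ler01 lexx.
- by move=> /andP[y0 y1] /andP[z0 z1]; rewrite mulr_ge0//= mulr_ile1.
- by rewrite mulr_ge0 ?flat_exp1_ge0//= mulr_ile1 ?flat_exp1_ge0 ?flat_exp1_le1.
Qed.

Lemma box_bump_off a b k x : ~ open_box a b x -> box_bump a b k x = 0.
Proof.
move=> /existsNP[i /negP]; rewrite negb_and -!leNgt => abx.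
rewrite /box_bump (bigD1 i)//= /flat_exp.
by case/orP: abx => h; rewrite [X in X * _](_ : _ = 0) ?mul0r//;
  [rewrite ifF ?mul0r//|rewrite [X in _ * X]ifF ?mulr0//];
  apply/negbTE; rewrite -leNgt mulr_ge0_le0// subr_le0.
Qed.

Lemma box_bump_cvg a b x :
  box_bump a b k x @[k --> \oo] --> (\1_(open_box a b) x : R).
Proof.
have [abx|abx] := pselect (open_box a b x); last first.
  rewrite indicE memNset//; under eq_fun do rewrite box_bump_off//.
  exact: cvg_cst.
rewrite indicE mem_set//.
have cv (u : R) : 0 < u -> flat_exp 1 (k%:R * u) @[k --> \oo] --> (1 : R).
  move=> u0.
  have : expR (- (k%:R^-1) * u^-1) @[k --> \oo] --> expR (- 0 * u^-1).
    apply: (@continuous_cvg _ _ _ _ _ _ expR); first exact: continuous_expR.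
    by apply: cvgMl; apply: cvgN; apply/gtr0_cvgV0; [near=> k; rewrite ltr0n; near: k; exists 1|exact: cvgr_idn].
  rewrite oppr0 mul0r expR0; apply: cvg_trans; apply: near_eq_cvg; near=> k.
  rewrite /flat_exp ifT ?mulr_gt0 ?ltr0n//; last by near: k; exists 1%N.
  by rewrite hornerC mul1r invfM mulNr.
rewrite (_ : (true%:R : R) = \prod_(i < n) (1 * 1)); last by rewrite big1// => i _; rewrite mulr1.
rewrite /box_bump; elim: (index_enum _) => [|i r IHr].
  by rewrite big_nil; under eq_fun do rewrite big_nil; exact: cvg_cst.
rewrite big_cons; under eq_fun do rewrite big_cons.
have /andP[ha hb] := abx i.
by apply: cvgM => //; apply: cvgM; apply: cv; rewrite subr_gt0.
Unshelve. all: by end_near. Qed.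

End box_bumps.

(** * The fundamental lemma of the calculus of variations *)

Section du_Bois_Reymond.
Context {R : realType} {n : nat}.
Local Notation mu := (@lebesgue_rV R n).
Implicit Types (Omega : set 'rV[R]_n) (a b x : 'rV[R]_n).

Definition closed_box a b : set 'rV[R]_n :=
  [set x | forall i, a ord0 i <= x ord0 i <= b ord0 i].

Lemma closed_box_compact a b : compact (closed_box a b).
Proof.
rewrite (_ : closed_box _ _ = [set v : 'rV[R]_n | forall i, `[a ord0 i, b ord0 i]%classic (v ord0 i)]).
  by apply: (@rV_compact _ _ (fun i => `[a ord0 i, b ord0 i]%classic)) => i; exact: segment_compact.
by apply/seteqP; split => x h i; move: (h i); rewrite /= in_itv.
Qed.

(** The bumps take values in [0, 1] and tend to the indicator of the box, so dominated convergence
    applies with [|g|] as the dominating function. *)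
Lemma integral_open_box_eq0 Omega (g : 'rV[R]_n -> R) a b :
  open Omega -> mu.-integrable Omega (EFin \o g) -> open_box a b `<=` Omega ->
  (forall k, \int[mu]_(x in Omega) (g x * box_bump a b k x)%:E = 0)%E ->
  (\int[mu]_(x in open_box a b) (g x)%:E = 0)%E.
Proof.
move=> oO ig abO g0; have mO := rV_open_measurable oO.
have mg : measurable_fun Omega g by have /integrableP[/measurable_EFinP] := ig.
have := @dominated_convergence _ _ _ mu Omega mO
  (fun k x => (g x * box_bump a b k x)%:E) (fun x => (g x * \1_(open_box a b) x)%:E)
  (fun x => `|g x|%:E).
case.
- move=> k; apply/measurable_EFinP; apply: measurable_funM => //.
  by apply: rV_continuous_measurable; exact/smooth_continuous/box_bump_smooth.
- apply/measurable_EFinP; apply: measurable_funM => //.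
  by apply: measurable_indic; exact: open_box_measurable.
- apply: aeW => x _; apply: cvg_EFin; first exact: nearW.
  by apply: cvgM; [exact: cvg_cst|exact: box_bump_cvg].
- by have := integrable_abse ig.
- apply: aeW => x k _; rewrite /= lee_fin normrM.
  have /andP[h0 h1] := box_bump_bounds a b k x.
  by rewrite (ger0_norm h0) ler_piMr.
move=> _ _ /cvg_lim; rewrite (_ : [sequence _]_n = cst 0%E); last exact/funext.
rewrite lim_cst// => /(_ (@ereal_hausdorff R)) ->.
transitivity (\int[mu]_(x in Omega `&` open_box a b) (g x)%:E)%E; first by rewrite setIidr.
rewrite integral_mkcondr; apply: eq_integral => x _.
by rewrite /patch indicE; case: ifPn; rewrite ?mulr1 ?mulr0.
Qed.

(** The signed measure with density [g] on the box vanishes on open boxes, hence on all Borel sets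
    by the pi-lambda theorem, and a function whose integrals over all measurable subsets vanish is
    zero almost everywhere. *)
Lemma ae_eq0_on_open_box Omega (g : 'rV[R]_n -> R) a b :
  open Omega -> mu.-integrable Omega (EFin \o g) -> closed_box a b `<=` Omega ->
  (forall a b k, closed_box a b `<=` Omega ->
    \int[mu]_(x in Omega) (g x * box_bump a b k x)%:E = 0)%E ->
  {ae mu, forall x, open_box a b x -> g x = 0}.
Proof.
move=> oO ig abO g0; have mO := rV_open_measurable oO.
have ocb a' b' : open_box a' b' `<=` closed_box a' b'.
  by move=> x h i; have /andP[h1 h2] := h i; rewrite !ltW.
have box0 a' b' : closed_box a' b' `<=` Omega ->
    (\int[mu]_(x in open_box a' b') (g x)%:E = 0)%E.
  move=> abO'; apply: integral_open_box_eq0 oO ig _ _; first exact: subset_trans abO'.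
  by move=> k; exact: g0.
set Q := open_box a b; have mQ : measurable Q := open_box_measurable a b.
have QO : Q `<=` Omega by apply: subset_trans abO; exact: ocb.
have igQ : mu.-integrable Q (EFin \o g) by exact: integrableS ig.
have igQT : mu.-integrable setT ((EFin \o g) \_ Q) by rewrite -integrable_mkcond.
pose nu : {charge set 'rV[R]_n -> \bar R} := induced_charge igQT.
have nuE A : nu A = (\int[mu]_(x in Q `&` A) (g x)%:E)%E.
  by rewrite integral_mkcondl.
have nu0 : forall A, measurable A -> nu A = 0%E.
  move=> A; rewrite measurable_open_boxes; move: A.
  apply: (@dynkin_induction _ _ (@open_boxes R n)).
  - exact: measurable_open_boxes.
  - exact: setI_closed_open_boxes.
  - by rewrite nuE setIT; exact: box0.
  - move=> _ [a' [b' ->]]; rewrite nuE open_boxI; apply: box0.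
    apply: subset_trans abO => x h i; have := h i; rewrite !mxE ge_max le_min.
    by move=> /andP[/andP[-> _] /andP[-> _]].
  - move=> S mS S0; have := @chargeD _ _ _ nu setT S measurableT mS.
    by rewrite setTD setTI S0 sube0 => ->; rewrite nuE setIT; exact: box0.
  - move=> F mF tF F0.
    have := @charge_semi_sigma_additive _ _ _ nu F mF tF (bigcupT_measurable _ mF).
    rewrite (_ : (fun _ => _) = cst 0%E); last first.
      by apply/funext => m; rewrite big1.
    by move=> /cvg_lim <-//; rewrite lim_cst.
have : ae_eq mu Q (EFin \o g) (cst 0%E).
  apply: integral_ae_eq => // E EQ mE.
  by rewrite integral0 -(nu0 E mE) nuE setIidr.
by apply: filterS => x h Qx; have := h Qx; move=> [].
Qed.

Lemma ae_eq0_box_bumps Omega (g : 'rV[R]_n -> R) :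
  open Omega -> mu.-integrable Omega (EFin \o g) ->
  (forall a b k, closed_box a b `<=` Omega ->
    \int[mu]_(x in Omega) (g x * box_bump a b k x)%:E = 0)%E ->
  {ae mu, forall x, Omega x -> g x = 0}.
Proof.
move=> oO ig g0.
(* The cover is countable but indexed by pairs; it is enumerated through [unpickle] because
   countable conjunctions of almost everywhere statements are available along the natural
   numbers. *)
have : {ae mu, forall x m p, unpickle m = Some p -> open_cover_ball Omega p x -> g x = 0}.
  apply: ae_foralln => m; case: (unpickle m) => [p|]; last exact: aeW.
  have [E|[q [e [e0 E qO]]]] := open_cover_ball_cases Omega p.
    by apply: aeW => x _ [<-]; rewrite E.
  have : {ae mu, forall x, open_box (q - const_mx e) (q + const_mx e) x -> g x = 0}.
    apply: (ae_eq0_on_open_box oO ig _ g0); apply: subset_trans qO => x.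
    rewrite rV_ballE ?mulr_gt0// => h i; have := h i; rewrite /= !mxE.
    by move=> /andP[h1 h2]; rewrite ltr_norml; apply/andP; split; lra.
  apply: filterS => x h _ [<-]; rewrite E ball_open_box//; exact: h.
apply: filterS => x h Ox; move: (Ox); rewrite {1}(open_cover_ballE oO) => -[p _ px].
by apply: (h (pickle p) p) => //; rewrite pickleK.
Qed.

End du_Bois_Reymond.

(** * Square integrable functions *)

Section square_integrable.
Context d (T : measurableType d) {R : realType} (mu : {measure set T -> \bar R}).
Variable D : set T.
Hypothesis mD : measurable D.
Implicit Types f g : T -> R.

Definition sq_integrable f : Prop :=
  measurable_fun D f /\ mu.-integrable D (fun x => (f x ^+ 2)%:E).

Lemma sq_integrable_measurable f : sq_integrable f -> measurable_fun D f.
Proof. by case. Qed.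

Lemma le_integrableE f (g : T -> R) : measurable_fun D f ->
  (forall x, D x -> `|f x| <= g x) -> mu.-integrable D (fun x => (g x)%:E) ->
  mu.-integrable D (fun x => (f x)%:E).
Proof.
move=> mf fg; apply: le_integrable => //; first exact/measurable_EFinP.
by move=> x Dx; rewrite lee_fin (le_trans (fg x Dx)) ?ler_norm.
Qed.

Lemma sq_integrable_integrableM f g : sq_integrable f -> sq_integrable g ->
  mu.-integrable D (fun x => (f x * g x)%:E).
Proof.
move=> [mf if2] [mg ig2].
apply: (le_integrableE (g := fun x => f x ^+ 2 + g x ^+ 2)).
- exact: measurable_funM.
- move=> x _; rewrite normrM -(real_normK (num_real (f x))) -(real_normK (num_real (g x))).
  have := sqr_ge0 (`|f x| - `|g x|); have := mulr_ge0 (normr_ge0 (f x)) (normr_ge0 (g x)); nra.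
- by under eq_fun do rewrite EFinD; exact: integrableD.
Qed.

Lemma sq_integrableZ (a : R) f : sq_integrable f -> sq_integrable (fun x => a * f x).
Proof.
move=> [mf if2]; split; first by apply: measurable_funM => //; exact: measurable_cst.
by under eq_fun do rewrite exprMn EFinM; exact: integrableZl.
Qed.

Lemma sq_integrableD f g : sq_integrable f -> sq_integrable g ->
  sq_integrable (fun x => f x + g x).
Proof.
move=> sf sg; have ifg := sq_integrable_integrableM sf sg.
move: sf sg => [mf if2] [mg ig2]; split; first exact: measurable_funD.
under eq_fun do rewrite sqrrD !EFinD.
apply: integrableD => //; apply: integrableD => //.
rewrite (_ : (fun _ => _) = (fun x => 2%:E * (f x * g x)%:E)%E); first exact: integrableZl.
by apply/funext => x; rewrite -EFinM mulr_natl.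
Qed.

Lemma sq_integrableN f : sq_integrable f -> sq_integrable (fun x => - f x).
Proof. by move=> /(sq_integrableZ (-1)); under eq_fun do rewrite mulN1r. Qed.

Lemma sq_integrableB f g : sq_integrable f -> sq_integrable g ->
  sq_integrable (fun x => f x - g x).
Proof. by move=> sf sg; apply: sq_integrableD => //; exact: sq_integrableN. Qed.

Lemma bounded_sq_integrable f (K : R) : (mu D < +oo)%E -> measurable_fun D f ->
  (forall x, D x -> `|f x| <= K) -> sq_integrable f.
Proof.
move=> muD mf fK; split=> //; apply: (le_integrableE (g := cst (K ^+ 2))).
- exact: measurable_funX.
- move=> x Dx /=; rewrite normrX lerXn2r ?nnegrE//; last exact: fK.
  exact: le_trans (fK x Dx).
- apply: (measurable_bounded_integrable (f := cst (K ^+ 2))) => //.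
  exists (K ^+ 2); split; first exact: num_real.
  by move=> M KM x _ /=; rewrite (le_trans _ (ltW KM))// ger0_norm// sqr_ge0.
Qed.

(* [2^n] times the square of the increment is still summable; its sum dominates the tails
   pointwise, which replaces Minkowski's inequality in the Riesz-Fischer argument. *)
Lemma sqr_increments_le (u : nat -> R) n m :
  (u (n + m)%N - u n) ^+ 2 <=
  2 * 2^-1 ^+ n * \sum_(n <= k < n + m) 2 ^+ k * (u k.+1 - u k) ^+ 2.
Proof.
elim: m n => [|m IHm] n.
  by rewrite addn0 subrr expr0n /= big_geq// mulr0.
rewrite addnS big_ltn ?ltnS ?leq_addr//.
have := IHm n.+1; rewrite addSn; set S := \sum_(_ <= _ < _) _; set p := 2^-1 ^+ n.
rewrite (exprS 2^-1 n) -/p.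
have p0 : 0 <= p by rewrite exprn_ge0.
have -> : 2 * p * (2 ^+ n * (u n.+1 - u n) ^+ 2 + S) = 2 * (u n.+1 - u n) ^+ 2 + 2 * p * S.
  by rewrite mulrDr mulrA -(mulrA 2 p) -exprMn mulVf// expr1n mulr1.
(* This is [(a + b) ^+ 2 <= 2 * a ^+ 2 + 2 * b ^+ 2] for the first increment [a] and the remaining
   one [b]; the factor 2 on [b] is paid by the halving of the coefficient from [n] to [n.+1]. *)
have := sqr_ge0 (u (n + m).+1 - u n.+1 - (u n.+1 - u n)); nra.
Qed.

(** The weighted squares [q n] have integrals at most [2^-1 ^+ n], so their sum [S] has integral at
    most 2 and is finite almost everywhere. Where it is finite, [S] controls all tails at once: it
    yields both the pointwise limit and the rate of convergence in mean square. *)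
Lemma Riesz_Fischer (f : nat -> T -> R) :
  (forall n, sq_integrable (f n)) ->
  (forall n, \int[mu]_(x in D) ((f n.+1 x - f n x) ^+ 2)%:E <= (4^-1 ^+ n)%:E)%E ->
  exists2 g, sq_integrable g &
    forall n, (\int[mu]_(x in D) ((g x - f n x) ^+ 2)%:E <= (4 * 2^-1 ^+ n)%:E)%E.
Proof.
move=> sf df.
pose q n x : R := 2 ^+ n * (f n.+1 x - f n x) ^+ 2.
have q0 n x : 0 <= q n x by rewrite mulr_ge0 ?sqr_ge0 ?exprn_ge0.
have mq n : measurable_fun D (q n).
  apply: measurable_funM; first exact: measurable_cst.
  by apply: measurable_funX; apply: measurable_funB; apply: sq_integrable_measurable.
pose S x := (\sum_(0 <= n <oo) (q n x)%:E)%E.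
have S0 x : (0 <= S x)%E by apply: nneseries_ge0 => n _ _; rewrite lee_fin.
have mS : measurable_fun D S.
  by apply: ge0_emeasurable_sum => n *; [rewrite lee_fin|exact/measurable_EFinP].
have iS : (\int[mu]_(x in D) S x <= 2%:E)%E.
  rewrite integral_nneseries//; [|by move=> n; apply/measurable_EFinP|by move=> n x _; rewrite lee_fin].
  have -> : 2%:E = (\sum_(0 <= k <oo) ((2 : R) / (2 ^ (k + 1)%N)%:R)%:E)%E.
    have /cvg_lim := @cvg_geometric_eseries_half R 2 0.
    by rewrite expr0 divr1 => <-.
  apply: lee_nneseries => [n _ _|n _]; first by apply: integral_ge0 => x _; rewrite lee_fin.
  under eq_integral do rewrite EFinM.
  rewrite ge0_integralZl//; last 2 first.
  - by apply/measurable_EFinP; apply: measurable_funX; apply: measurable_funB; apply: sq_integrable_measurable.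
  - by move=> x _; rewrite lee_fin sqr_ge0.
  apply: (@le_trans _ _ ((2 ^+ n)%:E * (4^-1 ^+ n)%:E)%E).
    by rewrite lee_wpmul2l// lee_fin exprn_ge0.
  rewrite -EFinM lee_fin -exprMn (_ : 2 * 4^-1 = 2^-1 :> R); last by lra.
  by rewrite addn1 natrX exprS invfM mulrA divff// mul1r exprVn.
have aeS : {ae mu, forall x, D x -> S x \is a fin_num}.
  apply: integrable_ae => //; apply/integrableP; split=> //.
  under eq_integral do rewrite gee0_abs//.
  exact: le_lt_trans iS (ltry _).
pose C := D `&` [set x | S x < +oo]%E.
have mC : measurable C by exact: emeasurable_fun_infty_o.
have tail x n m : C x -> (f (n + m)%N x - f n x) ^+ 2 <= 2 * 2^-1 ^+ n * fine (S x).
  move=> [Dx Sx]; apply: le_trans (sqr_increments_le (fun k => f k x) n m) _.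
  rewrite ler_wpM2l ?mulr_ge0 ?exprn_ge0// -lee_fin fineK ?ge0_fin_numE//.
  rewrite -sumEFin; apply: le_trans (@nneseries_lim_ge _ (fun k => (q k x)%:E) predT 0 (n + m) _); last first.
    by move=> k _ _; rewrite lee_fin.
  rewrite [leRHS](@big_cat_nat _ _ _ n)//= ?leq_addr// leeDr//.
  by apply: sume_ge0 => k _; rewrite lee_fin.
have fcvg x : C x -> cvgn (fun n => f n x).
  move=> Cx; apply: cauchy_cvg; apply: cauchy_exP => e e0.
  have c0 : 0 < 2 * fine (S x) + 1 by rewrite ltr_wpDl// mulr_ge0// fine_ge0.
  have [N _ /(_ N (leqnn N)) /= hN] :=
    near_infty_natSinv_expn_lt (PosNum (divr_gt0 (exprn_gt0 2 e0) c0)).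
  exists (f N x); exists N => // m /= Nm.
  rewrite /ball /= distrC.
  suff : `|f m x - f N x| ^+ 2 < e ^+ 2 by rewrite ltr_pXn2r ?nnegrE ?(ltW e0).
  rewrite real_normK ?num_real//.
  rewrite -(subnKC Nm); apply: le_lt_trans (tail x N _ Cx) _.
  move: hN; rewrite ltr_pdivlMr// div1r -exprVn; apply: le_lt_trans.
  have : 0 <= 2^-1 ^+ N :> R by rewrite exprn_ge0.
  set p := _ ^+ N; nra.
(* Off [C] the value 0 is a default; [C] has full measure in [D]. *)
pose g x := if x \in C then limn (fun n => f n x) else 0.
have fg x n : C x -> (g x - f n x) ^+ 2 <= 2 * 2^-1 ^+ n * fine (S x).
  move=> Cx; rewrite /g mem_set//.
  have cv : (f m x - f n x) ^+ 2 @[m --> \oo] --> (limn (fun n => f n x) - f n x) ^+ 2.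
    by rewrite expr2; apply: cvgM; apply: cvgB; [exact: fcvg|exact: cvg_cst|exact: fcvg|exact: cvg_cst].
  rewrite -(cvg_lim _ cv)//; apply: limr_le; first by apply/cvg_ex; eexists; exact: cv.
  by exists n => // m /= nm; rewrite -(subnKC nm); exact: tail.
have mg : measurable_fun D g.
  (* Multiplication by the indicator of [C] makes the sequence converge everywhere on [D], so
     measurability passes to the limit. *)
  apply: (@measurable_fun_cvg _ _ _ _ (fun n x => f n x * \1_C x)) => [n|x Dx].
    apply: measurable_funM; first exact: sq_integrable_measurable.
    exact: measurable_indic.
  rewrite (_ : (fun _ => _) = (fun n => if x \in C then f n x else 0)); last first.
    by apply/funext => n; rewrite indicE; case: ifP; rewrite ?mulr1 ?mulr0.
  by rewrite /g; case: ifPn => [/set_mem Cx|_]; [exact: fcvg|exact: cvg_cst].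
have dgf n : (\int[mu]_(x in D) ((g x - f n x) ^+ 2)%:E <= (4 * 2^-1 ^+ n)%:E)%E.
  apply: (@le_trans _ _ (\int[mu]_(x in D) ((2 * 2^-1 ^+ n)%:E * S x))%E).
    apply: ae_ge0_le_integral => //.
    - by move=> x _; rewrite lee_fin sqr_ge0.
    - by apply/measurable_EFinP; apply: measurable_funX; apply: measurable_funB => //; apply: sq_integrable_measurable.
    - by move=> x _; rewrite mule_ge0// lee_fin mulr_ge0 ?exprn_ge0.
    - by apply: emeasurable_funM => //; exact: measurable_cst.
    - apply: filterS aeS => x Sx Dx; have Cx : C x by split=> //=; rewrite -ge0_fin_numE// Sx.
      by rewrite -(fineK (Sx Dx)) -EFinM lee_fin; exact: fg.
  rewrite ge0_integralZl// ?lee_fin ?mulr_ge0 ?exprn_ge0//.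
  apply: (@le_trans _ _ ((2 * 2^-1 ^+ n)%:E * 2%:E)%E).
    by rewrite lee_wpmul2l// lee_fin mulr_ge0 ?exprn_ge0.
  by rewrite -EFinM lee_fin le_eqVlt; apply/orP; left; apply/eqP; ring.
exists g => //.
have : sq_integrable (fun x => (g x - f 0%N x) + f 0%N x).
  apply: sq_integrableD => //; split.
    by apply: measurable_funB => //; apply: sq_integrable_measurable.
  apply/integrableP; split.
    by apply/measurable_EFinP; apply: measurable_funX; apply: measurable_funB => //; apply: sq_integrable_measurable.
  under eq_integral do rewrite gee0_abs ?lee_fin ?sqr_ge0//.
  exact: le_lt_trans (dgf 0%N) (ltry _).
by under eq_fun do rewrite subrK.
Qed.

End square_integrable.

(** * Inner product spaces *)

Section complex_lemmas.
Context {R : realType}.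
Local Notation Re := complex.Re.
Local Notation Im := complex.Im.

Lemma Re_real_mul (k : R) (z : R[i]) : Re (k%:C * z) = k * Re z.
Proof. by case: z => a b /=; rewrite mul0r subr0. Qed.

Lemma ReD (z w : R[i]) : Re (z + w) = Re z + Re w.
Proof. by case: z; case: w. Qed.

Lemma ReN (z : R[i]) : Re (- z) = - Re z.
Proof. by case: z. Qed.

Lemma ReJ (z : R[i]) : Re (conjc z) = Re z.
Proof. by case: z. Qed.

Lemma complex_eqP (z w : R[i]) : Re z = Re w -> Im z = Im w -> z = w.
Proof. by case: z; case: w => a b c d /= -> ->. Qed.

Lemma Im_Re (z : R[i]) : Im z = Re (- 'i * z).
Proof. by case: z => a b /=; rewrite mulN1r opprK oppr0 mul0r add0r. Qed.

End complex_lemmas.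

Section inner_product_on.
Context {R : realType} {E : lmodType R[i]}.
Local Notation Re := complex.Re.
Local Notation Im := complex.Im.

(** Everything is relative to a subset [X]: [dotL2] and [dotgrad] are total functions which behave
    as inner products only on subspaces such as [L2] and [H10]. *)
Record inner_product_on (X : set E) (dot : E -> E -> R[i]) : Prop := InnerProductOn {
  ip_mem0 : X 0;
  ip_memP : forall a x y, X x -> X y -> X (a *: x + y);
  ip_linear : forall a x y z, X x -> X y -> X z ->
    dot (a *: x + y) z = a * dot x z + dot y z;
  ip_conj : forall x y, X x -> X y -> dot y x = conjc (dot x y);
  ip_ge0 : forall x, X x -> 0 <= Re (dot x x);
  ip_eq0 : forall x, X x -> Re (dot x x) = 0 -> x = 0 }.

Section theory.
Variables (X : set E) (dot : E -> E -> R[i]).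
Hypothesis ip : inner_product_on X dot.
Implicit Types (x y z : E) (k : R) (a : R[i]).

(** The real part is a real inner product with the same norm; all estimates are made with it, and
    complex identities are recovered by applying it to multiples by a power of ['i]. *)
Definition rdot x y : R := Re (dot x y).
Definition nrm x : R := Num.sqrt (rdot x x).

Lemma ip_memZ a x : X x -> X (a *: x).
Proof. by move=> Xx; rewrite -[_ *: _]addr0; apply: (ip_memP ip) => //; exact: (ip_mem0 ip). Qed.

Lemma ip_memD x y : X x -> X y -> X (x + y).
Proof. by move=> Xx Xy; rewrite -[x]scale1r; exact: (ip_memP ip). Qed.

Lemma ip_memN x : X x -> X (- x).
Proof. by move=> Xx; rewrite -scaleN1r; exact: ip_memZ. Qed.

Lemma ip_memB x y : X x -> X y -> X (x - y).
Proof. by move=> Xx Xy; apply: ip_memD => //; exact: ip_memN. Qed.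

Lemma ip_mem_sum (I : Type) (r : seq I) (F : I -> E) :
  (forall i, X (F i)) -> X (\sum_(i <- r) F i).
Proof.
by move=> XF; elim/big_ind: _ => //; [exact: (ip_mem0 ip)|exact: ip_memD].
Qed.

Lemma rdotC x y : X x -> X y -> rdot x y = rdot y x.
Proof. by move=> Xx Xy; rewrite /rdot (ip_conj ip Xx Xy) ReJ. Qed.

Lemma dot0l x : X x -> dot 0 x = 0.
Proof.
have X0 := ip_mem0 ip.
move=> Xx; have := ip_linear ip 1 X0 X0 Xx; rewrite scaler0 addr0 mul1r => /eqP.
by rewrite -subr_eq0 opprD addrA subrr sub0r oppr_eq0 => /eqP.
Qed.

Lemma dotZl a x y : X x -> X y -> dot (a *: x) y = a * dot x y.
Proof.
move=> Xx Xy; rewrite -[a *: x]addr0 (ip_linear ip) ?dot0l ?addr0//.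
exact: (ip_mem0 ip).
Qed.

Lemma dotDl x y z : X x -> X y -> X z -> dot (x + y) z = dot x z + dot y z.
Proof. by move=> Xx Xy Xz; rewrite -{1}[x]scale1r (ip_linear ip)// mul1r. Qed.

Lemma rdotDl x y z : X x -> X y -> X z -> rdot (x + y) z = rdot x z + rdot y z.
Proof. by move=> Xx Xy Xz; rewrite /rdot dotDl// ReD. Qed.

Lemma rdotZl k x y : X x -> X y -> rdot (k%:C *: x) y = k * rdot x y.
Proof. by move=> Xx Xy; rewrite /rdot dotZl// Re_real_mul. Qed.

Lemma rdotNl x y : X x -> X y -> rdot (- x) y = - rdot x y.
Proof.
move=> Xx Xy; rewrite -scaleN1r -[-1](_ : (-1)%:C = _); last by rewrite rmorphN1.
by rewrite rdotZl// mulN1r.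
Qed.

Lemma rdotBl x y z : X x -> X y -> X z -> rdot (x - y) z = rdot x z - rdot y z.
Proof. by move=> Xx Xy Xz; rewrite rdotDl ?rdotNl//; exact: ip_memN. Qed.

Lemma rdotDr x y z : X x -> X y -> X z -> rdot z (x + y) = rdot z x + rdot z y.
Proof.
by move=> Xx Xy Xz; rewrite rdotC ?rdotDl 1?(rdotC Xx) 1?(rdotC Xy)//; exact: ip_memD.
Qed.

Lemma rdotZr k x y : X x -> X y -> rdot y (k%:C *: x) = k * rdot y x.
Proof. by move=> Xx Xy; rewrite rdotC ?rdotZl 1?(rdotC Xx)//; exact: ip_memZ. Qed.

Lemma rdotBr x y z : X x -> X y -> X z -> rdot z (x - y) = rdot z x - rdot z y.
Proof.
by move=> Xx Xy Xz; rewrite rdotC ?rdotBl 1?(rdotC Xx) 1?(rdotC Xy)//; exact: ip_memB.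
Qed.

Lemma rdot_ge0 x : X x -> 0 <= rdot x x.
Proof. exact: (ip_ge0 ip). Qed.

Lemma nrm_ge0 x : 0 <= nrm x.
Proof. exact: sqrtr_ge0. Qed.

Lemma nrm_sqr x : X x -> nrm x ^+ 2 = rdot x x.
Proof. by move=> Xx; rewrite sqr_sqrtr// rdot_ge0. Qed.

Lemma nrm_eq0 x : X x -> nrm x = 0 -> x = 0.
Proof. by move=> Xx n0; apply: (ip_eq0 ip) => //; rewrite -/(rdot x x) -nrm_sqr// n0 expr0n. Qed.

Lemma nrm0 : nrm 0 = 0.
Proof. by rewrite /nrm /rdot dot0l ?sqrtr0//; exact: (ip_mem0 ip). Qed.

Lemma rdot_le x y : X x -> X y -> `|rdot x y| <= nrm x * nrm y.
Proof.
move=> Xx Xy.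
suff : rdot x y ^+ 2 <= (nrm x * nrm y) ^+ 2.
  by rewrite -(real_normK (num_real (rdot x y))) ler_pXn2r ?nnegrE ?mulr_ge0 ?nrm_ge0.
rewrite exprMn !nrm_sqr//; set A := rdot x x; set B := rdot x y; set C := rdot y y.
have A0 : 0 <= A := rdot_ge0 Xx; have C0 : 0 <= C := rdot_ge0 Xy.
have P s t : 0 <= s ^+ 2 * A + 2 * s * t * B + t ^+ 2 * C.
  have Xsx := ip_memZ s%:C Xx; have Xty := ip_memZ t%:C Xy.
  have := rdot_ge0 (ip_memD Xsx Xty).
  rewrite rdotDl ?rdotDr ?rdotZl ?rdotZr//; last exact: ip_memD.
  rewrite (rdotC Xy Xx) -/A -/B -/C => h; apply: le_trans h _; rewrite le_eqVlt.
  by apply/orP; left; apply/eqP; ring.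
have [C00|Cn0] := eqVneq C 0; last first.
  have Cp : 0 < C by rewrite lt0r Cn0.
  have := P C (- B) => h.
  have : 0 <= C * (A * C - B ^+ 2) by apply: le_trans h _; rewrite le_eqVlt; apply/orP; left; apply/eqP; ring.
  by rewrite pmulr_rge0// subr_ge0.
rewrite C00 mulr0.
(* When [C = 0], these coefficients give [0 <= - B ^+ 2 * (A + 2)], which forces [B = 0]. In the
   other case, [C] and [- B] give [C * (A * C - B ^+ 2)]. *)
have := P B (- (A + 1)); rewrite C00 => h.
have B2 := sqr_ge0 B.
by have := mulr_ge0 B2 A0; lra.
Qed.

Lemma nrmD x y : X x -> X y -> nrm (x + y) <= nrm x + nrm y.
Proof.
move=> Xx Xy.
suff : nrm (x + y) ^+ 2 <= (nrm x + nrm y) ^+ 2.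
  by rewrite ler_pXn2r ?nnegrE ?addr_ge0 ?nrm_ge0.
rewrite nrm_sqr; last exact: ip_memD.
rewrite rdotDl ?rdotDr//; last exact: ip_memD.
rewrite (rdotC Xy Xx) -!nrm_sqr//.
have := le_trans (ler_norm _) (rdot_le Xx Xy); nra.
Qed.

Lemma nrmZ a x : X x -> nrm (a *: x) = Num.sqrt (Re a ^+ 2 + Im a ^+ 2) * nrm x.
Proof.
move=> Xx; rewrite /nrm -sqrtrM; last by rewrite addr_ge0 ?sqr_ge0.
congr Num.sqrt; rewrite /rdot dotZl//; last exact: ip_memZ.
rewrite (ip_conj ip (ip_memZ a Xx) Xx) dotZl//.
(* Conjugate symmetry says that the imaginary part of [dot x x] equals its own opposite. *)
have := ip_conj ip Xx Xx; case: (dot x x) => p q [] /eqP.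
rewrite -addr_eq0 -mulr2n mulrn_eq0 /= => /eqP ->.
by case: a => s t /=; ring.
Qed.

Lemma nrmZr k x : X x -> nrm (k%:C *: x) = `|k| * nrm x.
Proof. by move=> Xx; rewrite nrmZ//= expr0n addr0 sqrtr_sqr. Qed.

Lemma nrmN x : X x -> nrm (- x) = nrm x.
Proof. by move=> Xx; rewrite -scaleN1r nrmZ//= oppr0 expr0n addr0 sqrrN expr1n sqrtr1 mul1r. Qed.

Lemma nrmBC x y : X x -> X y -> nrm (x - y) = nrm (y - x).
Proof. by move=> Xx Xy; rewrite -nrmN ?opprB//; exact: ip_memB. Qed.

Lemma nrm_distD z x y : X x -> X y -> X z -> nrm (x - y) <= nrm (x - z) + nrm (z - y).
Proof.
move=> Xx Xy Xz; have := nrmD (ip_memB Xx Xz) (ip_memB Xz Xy).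
by rewrite addrA subrK.
Qed.

Lemma nrm_lerB x y : X x -> X y -> nrm x <= nrm y + nrm (x - y).
Proof.
by move=> Xx Xy; have := nrmD Xy (ip_memB Xx Xy); rewrite addrC subrK.
Qed.

Lemma nrm_sum (I : Type) (r : seq I) (F : I -> E) : (forall i, X (F i)) ->
  nrm (\sum_(i <- r) F i) <= \sum_(i <- r) nrm (F i).
Proof.
move=> XF; elim: r => [|i r IHr]; first by rewrite !big_nil nrm0.
rewrite !big_cons (le_trans (nrmD (XF i) (ip_mem_sum _ XF)))//.
by rewrite lerD2l.
Qed.

End theory.
End inner_product_on.

(** * Sequences and completeness *)

Section completeness.
Context {R : realType} {E : lmodType R[i]}.
Variables (X : set E) (dot : E -> E -> R[i]).
Hypothesis ip : inner_product_on X dot.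
Local Notation rdot := (rdot dot).
Local Notation nrm := (nrm dot).
Local Notation memB := (ip_memB ip).
Local Notation memD := (ip_memD ip).
Implicit Types (u : nat -> E) (x y l : E).

Definition ncvg u l := forall e : R, 0 < e ->
  exists N : nat, forall n, (N <= n)%N -> nrm (u n - l) < e.

Definition ncauchy u := forall e : R, 0 < e ->
  exists N : nat, forall m n, (N <= m)%N -> (N <= n)%N -> nrm (u m - u n) < e.

Definition complete_on := forall u, (forall n, X (u n)) -> ncauchy u ->
  exists2 l, X l & ncvg u l.

Lemma half_pow_lt (e : R) : 0 < e -> exists k : nat, forall n, (k <= n)%N -> 2^-1 ^+ n < e.
Proof.
move=> e0; have [k _ hk] := near_infty_natSinv_expn_lt (PosNum e0).
by exists k => n kn; have := hk n kn; rewrite /= div1r exprVn.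
Qed.

Lemma natSinv_lt (e : R) : 0 < e -> exists k : nat, forall n, (k <= n)%N -> n.+1%:R^-1 < e.
Proof.
move=> e0; have [k _ hk] := near_infty_natSinv_lt (PosNum e0).
by exists k => n kn; exact: hk.
Qed.

(** A Cauchy sequence converges as soon as one subsequence does, and a subsequence with increments
    below [2^-1 ^+ k] can be extracted. This is the form in which completeness of [L2] is
    verified. *)
Lemma complete_on_rapid :
  (forall u, (forall n, X (u n)) -> (forall n, nrm (u n.+1 - u n) <= 2^-1 ^+ n) ->
     exists2 l, X l & ncvg u l) -> complete_on.
Proof.
move=> H u Xu cu.
have /choice[N hN] : forall k : nat, exists N : nat, forall m n,
    (N <= m)%N -> (N <= n)%N -> nrm (u m - u n) < 2^-1 ^+ k.
  by move=> k; apply: cu; rewrite exprn_gt0.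
(* The running maximum puts both [idx k] and [idx k.+1] beyond [N k], so consecutive terms of the
   subsequence are compared at the same precision. *)
pose idx k := (\max_(j < k.+1) N j)%N.
have idxN k : (N k <= idx k)%N by exact: (@leq_bigmax _ (fun j : 'I_k.+1 => N j) ord_max).
have idxS k : (N k <= idx k.+1)%N.
  exact: (@leq_bigmax _ (fun j : 'I_k.+2 => N j) (widen_ord (leqnSn _) ord_max)).
have [||l Xl ul] := H (u \o idx).
- by move=> n; exact: Xu.
- by move=> n; apply/ltW/hN.
exists l => // e e0; have e20 : 0 < e / 2 by rewrite divr_gt0.
have [k hk] := half_pow_lt e20; have [m hm] := ul _ e20.
exists (N (maxn k m)) => n nN.
apply: (le_lt_trans (nrm_distD ip (Xu n) Xl (Xu (idx (maxn k m))))).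
rewrite [ltRHS](splitr e) ltrD//.
  by apply: lt_trans (hN _ _ _ nN (idxN _)) _; apply: hk; rewrite leq_maxl.
by apply: hm; rewrite leq_maxr.
Qed.

Lemma ncvg_unique u l l' : (forall n, X (u n)) -> X l -> X l' ->
  ncvg u l -> ncvg u l' -> l = l'.
Proof.
move=> Xu Xl Xl' ul ul'; apply/eqP; rewrite -subr_eq0; apply/eqP.
apply: (nrm_eq0 ip); first exact: memB.
apply/eqP; rewrite eq_le (nrm_ge0) andbT; apply/ler_addgt0Pl => e e0; rewrite addr0.
have e20 : 0 < e / 2 by rewrite divr_gt0.
have [N hN] := ul _ e20; have [M hM] := ul' _ e20.
have {}hN := hN (maxn N M) (leq_maxl _ _); have {}hM := hM (maxn N M) (leq_maxr _ _).
have := nrm_distD ip Xl Xl' (Xu (maxn N M)); rewrite (nrmBC ip Xl (Xu _)); lra.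
Qed.

Lemma ncvg_bound_le u l (K : R) : (forall n, X (u n)) -> X l -> ncvg u l ->
  (forall n, nrm (u n) <= K) -> nrm l <= K.
Proof.
move=> Xu Xl ul uK; apply/ler_addgt0Pl => e /ul[N /(_ N (leqnn N)) hN].
have := nrm_lerB ip Xl (Xu N); rewrite (nrmBC ip Xl (Xu N)); have := uK N; lra.
Qed.

Lemma ncvg_rdot u l y c : (forall n, X (u n)) -> X l -> X y -> ncvg u l ->
  (forall e : R, 0 < e -> exists N : nat, forall n, (N <= n)%N -> `|rdot (u n) y - c| < e) ->
  rdot l y = c.
Proof.
move=> Xu Xl Xy ul uc; apply/eqP; rewrite -subr_eq0 -normr_le0.
apply/ler_addgt0Pl => e e0; rewrite addr0.
have d0 : 0 < e / 2 / (nrm y + 1) by rewrite divr_gt0 ?divr_gt0// ltr_wpDl// nrm_ge0.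
have e20 : 0 < e / 2 by rewrite divr_gt0.
have [N hN] := ul _ d0; have [M hM] := uc _ e20.
have {}hN := hN (maxn N M) (leq_maxl _ _); have {}hM := hM (maxn N M) (leq_maxr _ _).
set n := maxn N M in hN hM.
rewrite -(subrKA (rdot (u n) y)) (le_trans (ler_normD _ _))// distrC -(rdotBl ip)//.
rewrite [leRHS](splitr e) lerD//; last exact: ltW.
apply: le_trans (rdot_le ip (memB (Xu n) Xl) Xy) _.
move: hN; rewrite ltr_pdivlMr ?ltr_wpDl ?nrm_ge0// => /ltW; apply: le_trans.
by rewrite ler_wpM2l ?nrm_ge0// lerDl.
Qed.

Lemma ncvgZ (a : R[i]) u l : (forall k, X (u k)) -> X l -> ncvg u l ->
  ncvg (fun k => a *: u k) (a *: l).
Proof.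
move=> Xu Xl ul e e0; set s := Num.sqrt (complex.Re a ^+ 2 + complex.Im a ^+ 2).
have s1 : 0 < s + 1 by rewrite ltr_wpDl// sqrtr_ge0.
have d0 : 0 < e / (s + 1) by rewrite divr_gt0.
have [N hN] := ul _ d0; exists N => k /hN; rewrite ltr_pdivlMr// => h.
rewrite -scalerBr (nrmZ ip) -/s; last exact: memB.
by apply: le_lt_trans h; rewrite mulrC ler_wpM2l ?nrm_ge0// lerDl.
Qed.

Lemma ncvgD u l v m : (forall k, X (u k)) -> X l -> (forall k, X (v k)) -> X m ->
  ncvg u l -> ncvg v m -> ncvg (fun k => u k + v k) (l + m).
Proof.
move=> Xu Xl Xv Xm ul vm e e0; have e20 : 0 < e / 2 by rewrite divr_gt0.
have [N hN] := ul _ e20; have [M hM] := vm _ e20; exists (maxn N M) => k.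
rewrite geq_max => /andP[/hN h1 /hM h2].
rewrite opprD addrACA (le_lt_trans (nrmD ip (memB (Xu k) Xl) (memB (Xv k) Xm)))//.
by rewrite [ltRHS](splitr e) ltrD.
Qed.

Lemma ncvg_rdotN u l g m y z : (forall k, X (u k)) -> X l -> (forall k, X (g k)) -> X m ->
  X y -> X z -> ncvg u l -> ncvg g m -> (forall k, rdot (u k) y = - rdot (g k) z) ->
  rdot l y = - rdot m z.
Proof.
move=> Xu Xl Xg Xm Xy Xz ul gm ug; apply: (ncvg_rdot Xu Xl Xy ul) => e e0.
have n1 : 0 < nrm z + 1 by rewrite ltr_wpDl// nrm_ge0.
have d0 : 0 < e / (nrm z + 1) by rewrite divr_gt0.
have [N hN] := gm _ d0; exists N => k /hN; rewrite ltr_pdivlMr// => h.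
rewrite ug opprK addrC -(rdotBl ip)// (rdotC ip)//; last exact: memB.
rewrite (le_lt_trans (rdot_le ip Xz (memB Xm (Xg k))))// mulrC (nrmBC ip)//.
by apply: le_lt_trans h; rewrite ler_wpM2l ?nrm_ge0// lerDl.
Qed.

(** This is the closedness of weak differentiation: the identity defining a weak derivative survives
    when the functions and their derivatives converge. The imaginary part is the real part of the
    product with [- 'i]. *)
Lemma ncvg_dotN u l g m y z : (forall k, X (u k)) -> X l -> (forall k, X (g k)) -> X m ->
  X y -> X z -> ncvg u l -> ncvg g m -> (forall k, dot (u k) y = - dot (g k) z) ->
  dot l y = - dot m z.
Proof.
move=> Xu Xl Xg Xm Xy Xz ul gm ug; have memZ := ip_memZ ip (- 'i).
have rE x w : rdot x w = complex.Re (dot x w) by [].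
have h1 : rdot l y = - rdot m z.
  by apply: (ncvg_rdotN Xu Xl Xg Xm Xy Xz ul gm) => k; rewrite !rE ug ReN.
have h2 : rdot (- 'i *: l) y = - rdot (- 'i *: m) z.
  apply: (ncvg_rdotN (fun k => memZ _ (Xu k)) (memZ _ Xl) (fun k => memZ _ (Xg k)) (memZ _ Xm)
    Xy Xz (ncvgZ (- 'i) Xu Xl ul) (ncvgZ (- 'i) Xg Xm gm)) => k.
  by rewrite !rE !(dotZl ip)// ug mulrN ReN.
apply: complex_eqP; first by rewrite ReN.
by rewrite !Im_Re mulrN ReN -!(dotZl ip).
Qed.

End completeness.

(** * The Riesz theorem by minimisation *)

Section Riesz.
Context {R : realType} {E : lmodType R[i]}.
Variables (V : set E) (dot : E -> E -> R[i]).
Hypothesis ip : inner_product_on V dot.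
Local Notation rdot := (rdot dot).
Local Notation nrm := (nrm dot).
Variables (ell : E -> R) (C : R).
Hypothesis ellD : forall x y, V x -> V y -> ell (x + y) = ell x + ell y.
Hypothesis ellZ : forall (k : R) x, V x -> ell (k%:C *: x) = k * ell x.
Hypothesis ell_le : forall x, V x -> `|ell x| <= C * nrm x.

(* The minimising sequences of |v|^2 - 2 ell(v). *)
Lemma Riesz_minimizing : exists2 v : nat -> E, (forall n, V (v n)) /\ ncauchy dot v &
  forall x, V x -> forall e : R, 0 < e ->
    exists N : nat, forall n, (N <= n)%N -> `|rdot (v n) x - ell x| < e.
Proof.
pose J x := rdot x x - 2 * ell x.
have V0 := ip_mem0 ip.
have Jlb x : V x -> - C ^+ 2 <= J x.
  move=> Vx; rewrite /J -(nrm_sqr ip)//.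
  have := le_trans (ler_norm _) (ell_le Vx); have := sqr_ge0 (nrm x - C); nra.
pose m := inf [set J x | x in V].
have hinf : has_inf [set J x | x in V].
  split; first by exists (J 0), 0.
  by exists (- C ^+ 2) => _ [x Vx <-]; exact: Jlb.
have mJ x : V x -> m <= J x by move=> Vx; apply: (ge_inf hinf.2); exists x.
have /choice[v hv] : forall n : nat, exists x, V x /\ J x < m + n.+1%:R^-1.
  move=> n; have n0 : 0 < n.+1%:R^-1 :> R by rewrite invr_gt0.
  by have [_ [x Vx <-] h] := inf_adherent n0 hinf; exists x.
have Vv n : V (v n) by have [] := hv n.
have vm n : J (v n) < m + n.+1%:R^-1 by have [] := hv n.
have JD x y (t : R) : V x -> V y ->
    J (x + t%:C *: y) = J x + 2 * t * (rdot x y - ell y) + t ^+ 2 * rdot y y.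
  move=> Vx Vy; have Vty := ip_memZ ip t%:C Vy; have Vs := ip_memD ip Vx Vty.
  rewrite /J ellD// ellZ// !(rdotDl ip)// !(rdotDr ip)// !(rdotZl ip)// !(rdotZr ip)//.
  by rewrite (rdotC ip Vy Vx); ring.
exists v; first split=> // e e0.
  (* Parallelogram identity: at the midpoint, [J] is the mean of its two values minus a quarter of
     the squared distance. It cannot fall below [m], so values within [e ^+ 2 / 4] of [m] force a
     distance below [e]. *)
  have e20 : 0 < e ^+ 2 / 4 by rewrite divr_gt0 ?exprn_gt0.
  have [N hN] := natSinv_lt e20; exists N => p q Np Nq.
  have Vd := ip_memB ip (Vv q) (Vv p).
  have Vpq : V (v p + (2^-1)%:C *: (v q - v p)) by apply: (ip_memD ip) => //; exact: (ip_memZ ip).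
  suff : nrm (v p - v q) ^+ 2 < e ^+ 2 by rewrite ltr_pXn2r ?nnegrE ?nrm_ge0 ?(ltW e0).
  rewrite (nrmBC ip)// (nrm_sqr ip)//.
  have := mJ _ Vpq; rewrite JD//.
  have := JD (v p) (v q - v p) 1 (Vv p) Vd; rewrite scale1r addrC subrK.
  have := vm p; have := vm q; have := hN p Np; have := hN q Nq.
    move: (q.+1%:R^-1) (p.+1%:R^-1) => wq wp.
  set D := rdot (v q - v p) _; set a := _ - ell _.
  rewrite expr1n mulr1 mul1r (_ : 2^-1 ^+ 2 = 4^-1 :> R); last by lra.
  move: (e ^+ 2) (J _) (J _) D a => *; lra.
move=> x Vx e e0; set B := rdot x x.
have B0 : 0 <= B := rdot_ge0 ip Vx.
have B1 : 0 < B + 1 by rewrite ltr_wpDl.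
have d0 : 0 < e ^+ 2 / (B + 1) by rewrite divr_gt0 ?exprn_gt0.
have [N hN] := natSinv_lt d0; exists N => n Nn.
suff : `|rdot (v n) x - ell x| ^+ 2 < e ^+ 2 by rewrite ltr_pXn2r ?nnegrE ?(ltW e0).
rewrite real_normK ?num_real//; set a := rdot _ _ - _.
have := hN n Nn; rewrite ltr_pdivlMr// => hn.
(* A step of length [- a / (B + 1)] along [x] lowers [J] by at least [a ^+ 2 / (B + 1)], while [v n]
   is within [n.+1%:R^-1] of the infimum. The denominator is [B + 1] so that [x = 0] needs no
   separate treatment. *)
have Vt := ip_memD ip (Vv n) (ip_memZ ip (- a / (B + 1))%:C Vx).
have := mJ _ Vt; rewrite JD// -/a -/B; have := vm n.
set w := n.+1%:R^-1 in hn *; move=> h1 h2.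
have : a ^+ 2 / (B + 1) <= w.
  have E1 : 2 * (- a / (B + 1)) * a + (- a / (B + 1)) ^+ 2 * B = - (a ^+ 2 / (B + 1)) - a ^+ 2 / (B + 1) ^+ 2.
    by field; rewrite gt_eqF.
  have : 0 <= a ^+ 2 / (B + 1) ^+ 2 by rewrite divr_ge0 ?sqr_ge0.
  lra.
by rewrite ler_pdivrMr// => h3; exact: le_lt_trans hn.
Qed.

(** Completeness enters only at this point. The minimising sequence is kept apart because
    [dense_domain] uses it inside the domain of an operator, which may fail to be complete. *)
Lemma Riesz_representation : complete_on V dot ->
  exists2 v, V v & forall x, V x -> rdot v x = ell x.
Proof.
move=> cV; have [u [Vu cu] ux] := Riesz_minimizing.
have [v Vv uv] := cV u Vu cu; exists v => // x Vx.
by apply: (ncvg_rdot ip Vu Vv Vx uv) => e; exact: ux.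
Qed.

End Riesz.

(** * The spaces L2 and H10 *)

Section L2_space.
Context {R : realType} {n : nat}.
Variable Omega : set 'rV[R]_n.
Hypothesis oOmega : open Omega.
Local Notation mu := (@lebesgue_rV R n).
Local Notation aefun := (aefun Omega).
Local Notation Re := (@complex.Re R).
Local Notation Im := (@complex.Im R).
Local Notation L2 := (@L2 R n Omega).
Local Notation dotL2 := (@dotL2 R n Omega).
Local Notation sqi := (sq_integrable mu Omega).

Let mOmega : measurable Omega := rV_open_measurable oOmega.

Definition ae_on (P : 'rV[R]_n -> Prop) : Prop := {ae mu, forall x, Omega x -> P x}.

Lemma ae_onS (P Q : 'rV[R]_n -> Prop) : (forall x, P x -> Q x) -> ae_on P -> ae_on Q.
Proof. by move=> PQ; rewrite /ae_on; apply: filterS => x h Ox; exact/PQ/h. Qed.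

Lemma ae_onS2 (P Q S : 'rV[R]_n -> Prop) : (forall x, P x -> Q x -> S x) ->
  ae_on P -> ae_on Q -> ae_on S.
Proof. by move=> PQ; rewrite /ae_on; apply: filterS2 => x h k Ox; exact: PQ (h Ox) (k Ox). Qed.

Definition cmeas (f : 'rV[R]_n -> R[i]) : Prop :=
  measurable_fun Omega (Re \o f) /\ measurable_fun Omega (Im \o f).

Definition csq (f : 'rV[R]_n -> R[i]) : Prop := sqi (Re \o f) /\ sqi (Im \o f).

Definition cintegrable (f : 'rV[R]_n -> R[i]) : Prop :=
  mu.-integrable Omega (EFin \o (Re \o f)) /\ mu.-integrable Omega (EFin \o (Im \o f)).

Lemma csq_cmeas f : csq f -> cmeas f.
Proof. by move=> [[? _] [? _]]. Qed.

Lemma cmeas_repr (u : aefun) : cmeas (repr u).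
Proof. by have /asboolP[] := valP (repr u). Qed.

Lemma repr_aeclass (f : 'rV[R]_n -> R[i]) : cmeas f ->
  ae_on (fun x => repr (aeclass Omega f) x = f x).
Proof.
move=> mf; have /aefun_eqP : \pi_aefun (repr (aeclass Omega f)) = \pi_aefun (insubd (0 : cmfun Omega) f).
  by rewrite reprK.
have fK : insubd (0 : cmfun Omega) f = f :> (_ -> _).
  by apply: (@insubdK _ _ (cmfun Omega)); apply/asboolP.
by rewrite /ae_on; apply: filterS => x h Ox; rewrite h// fK.
Qed.

Lemma reprD (u w : aefun) : ae_on (fun x => repr (u + w) x = repr u x + repr w x).
Proof.
have /aefun_eqP : \pi_aefun (repr (u + w)) = \pi_aefun (repr u + repr w).
  by rewrite reprK [RHS]Quotient.pi_add !reprK.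
by rewrite /ae_on; apply: filterS => x h Ox; rewrite h.
Qed.

Lemma reprZ (a : R[i]) (u : aefun) : ae_on (fun x => repr (a *: u) x = a * repr u x).
Proof.
have /aefun_eqP : \pi_aefun (repr (a *: u)) = \pi_aefun (a *: repr u).
  by rewrite reprK.
by rewrite /ae_on; apply: filterS => x h Ox; rewrite h.
Qed.

Lemma aefun_ext (u w : aefun) : ae_on (fun x => repr u x = repr w x) -> u = w.
Proof.
by move=> uw; rewrite -[u]reprK -[w]reprK; apply/aefun_eqP.
Qed.

Lemma ae_on_integral (f g : 'rV[R]_n -> R) :
  measurable_fun Omega f -> measurable_fun Omega g -> ae_on (fun x => f x = g x) ->
  (\int[mu]_(x in Omega) (f x)%:E = \int[mu]_(x in Omega) (g x)%:E)%E.
Proof.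
move=> mf mg fg; apply: ae_eq_integral => //; [exact/measurable_EFinP|exact/measurable_EFinP|].
by apply: ae_onS fg => x h /=; rewrite h.
Qed.

Lemma ae_on_integrable (f g : 'rV[R]_n -> R) :
  measurable_fun Omega f -> measurable_fun Omega g -> ae_on (fun x => f x = g x) ->
  mu.-integrable Omega (EFin \o f) -> mu.-integrable Omega (EFin \o g).
Proof.
move=> mf mg fg /integrableP[_ fi]; apply/integrableP; split; first exact/measurable_EFinP.
apply: le_lt_trans fi; rewrite (@ae_on_integral (fun x => `|g x|) (fun x => `|f x|))//.
- exact: measurableT_comp.
- exact: measurableT_comp.
- by apply: ae_onS fg => x h /=; rewrite h.
Qed.

Lemma cintegral_ae (f g : 'rV[R]_n -> R[i]) : cmeas f -> cmeas g ->
  ae_on (fun x => f x = g x) -> cintegral Omega f = cintegral Omega g.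
Proof.
move=> [mf1 mf2] [mg1 mg2] fg; rewrite /cintegral /Rintegral.
congr (fine _ +i* fine _); [apply: (@ae_on_integral (Re \o f) (Re \o g))|
  apply: (@ae_on_integral (Im \o f) (Im \o g))] => //;
  by apply: ae_onS fg => x h /=; rewrite h.
Qed.

Lemma csq_ae (f g : 'rV[R]_n -> R[i]) : cmeas g -> ae_on (fun x => f x = g x) -> csq f -> csq g.
Proof.
move=> [mg1 mg2] fg [[mf1 if1] [mf2 if2]]; split; split=> //.
- apply: (@ae_on_integrable (fun x => Re (f x) ^+ 2)) => //; try exact: measurable_funX.
  by apply: ae_onS fg => x h /=; rewrite h.
- apply: (@ae_on_integrable (fun x => Im (f x) ^+ 2)) => //; try exact: measurable_funX.
  by apply: ae_onS fg => x h /=; rewrite h.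
Qed.

Lemma L2P (u : aefun) : L2 u <-> csq (repr u).
Proof.
have [m1 m2] := cmeas_repr u.
rewrite /L2 /=; split=> [L|[[_ i1] [_ i2]]].
  have : mu.-integrable Omega (fun x => (Re (repr u x) ^+ 2 + Im (repr u x) ^+ 2)%:E).
    apply/integrableP; split.
      by apply/measurable_EFinP; apply: measurable_funD; exact: measurable_funX.
    by under eq_integral do rewrite gee0_abs ?lee_fin ?addr_ge0 ?sqr_ge0//.
  move=> i12; split; split=> //; apply: le_integrableE i12 => //; try exact: measurable_funX.
    by move=> x _; rewrite ger0_norm ?sqr_ge0// lerDl sqr_ge0.
  by move=> x _; rewrite ger0_norm ?sqr_ge0// lerDr sqr_ge0.
under eq_integral do rewrite EFinD.
by rewrite integralD// lte_add_pinfty//; exact: integrable_lty.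
Qed.

Lemma L2_aeclass f : csq f -> L2 (aeclass Omega f).
Proof.
move=> sf; apply/L2P; apply: (csq_ae _ _ sf); first exact: cmeas_repr.
by apply: ae_onS (repr_aeclass (csq_cmeas sf)) => x h; rewrite h.
Qed.

Lemma csqMJ f g : csq f -> csq g -> cintegrable (fun x => f x * conjc (g x)).
Proof.
move=> [f1 f2] [g1 g2]; split.
  rewrite (_ : _ \o _ = (fun x => (Re (f x) * Re (g x))%:E + (Im (f x) * Im (g x))%:E)%E).
    by apply: integrableD => //; exact: sq_integrable_integrableM.
  by apply/funext => x /=; rewrite -EFinD; case: (f x) => ? ?; case: (g x) => ? ? /=; rewrite mulrN opprK.
rewrite (_ : _ \o _ = (fun x => (Im (f x) * Re (g x))%:E - (Re (f x) * Im (g x))%:E)%E).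
  by apply: integrableB => //; exact: sq_integrable_integrableM.
apply/funext => x /=; rewrite -EFinB; case: (f x) => ? ?; case: (g x) => ? ? /=.
by rewrite mulrN addrC.
Qed.

Lemma csqJ f : csq f -> csq (fun x => conjc (f x)).
Proof.
move=> [f1 f2]; split.
  by rewrite (_ : _ \o _ = Re \o f)//; apply/funext => x /=; case: (f x).
rewrite (_ : _ \o _ = (fun x => - Im (f x))); first exact: sq_integrableN.
by apply/funext => x /=; case: (f x).
Qed.

Lemma csqM f g : csq f -> csq g -> cintegrable (fun x => f x * g x).
Proof.
move=> sf sg; have := csqMJ sf (csqJ sg); congr cintegrable.
by apply/funext => x; rewrite conjcK.
Qed.

Lemma csqZD (a : R[i]) f g : csq f -> csq g -> csq (fun x => a * f x + g x).
Proof.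
move=> [f1 f2] [g1 g2]; case: a => a1 a2; split.
  rewrite (_ : _ \o _ = (fun x => (a1 * Re (f x) - a2 * Im (f x)) + Re (g x))).
    by apply: sq_integrableD => //; apply: sq_integrableB => //; exact: sq_integrableZ.
  by apply/funext => x /=; case: (f x) => ? ?; case: (g x).
rewrite (_ : _ \o _ = (fun x => (a1 * Im (f x) + a2 * Re (f x)) + Im (g x))).
  by apply: sq_integrableD => //; apply: sq_integrableD => //; exact: sq_integrableZ.
by apply/funext => x /=; case: (f x) => ? ?; case: (g x).
Qed.

Lemma cintegralZD (a : R[i]) f g : cintegrable f -> cintegrable g ->
  cintegral Omega (fun x => a * f x + g x) = a * cintegral Omega f + cintegral Omega g.
Proof.
move=> [f1 f2] [g1 g2]; case: a => a1 a2; rewrite /cintegral.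
have Z (k : R) h : mu.-integrable Omega (EFin \o h) -> mu.-integrable Omega (EFin \o (fun x => k * h x)).
  by move=> ih; rewrite (_ : _ \o _ = (fun x => k%:E * (h x)%:E)%E)//; exact: integrableZl.
have D h k : mu.-integrable Omega (EFin \o h) -> mu.-integrable Omega (EFin \o k) ->
    mu.-integrable Omega (EFin \o (fun x => h x + k x)).
  by move=> ih ik; rewrite (_ : _ \o _ = (EFin \o h) \+ (EFin \o k))%E//; exact: integrableD.
have B h k : mu.-integrable Omega (EFin \o h) -> mu.-integrable Omega (EFin \o k) ->
    mu.-integrable Omega (EFin \o (fun x => h x - k x)).
  by move=> ih ik; rewrite (_ : _ \o _ = (EFin \o h) \- (EFin \o k))%E//; exact: integrableB.
apply: complex_eqP => /=.
  rewrite (_ : (fun x => Re _) = (fun x => (a1 * Re (f x) - a2 * Im (f x)) + Re (g x))); last first.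
    by apply/funext => x /=; case: (f x) => ? ?; case: (g x).
  by rewrite RintegralD ?RintegralB ?RintegralZl//; [apply: Z|apply: Z|apply: B; exact: Z].
rewrite (_ : (fun x => Im _) = (fun x => (a1 * Im (f x) + a2 * Re (f x)) + Im (g x))); last first.
  by apply/funext => x /=; case: (f x) => ? ?; case: (g x).
by rewrite RintegralD ?RintegralD ?RintegralZl//; [apply: Z|apply: Z|apply: D; exact: Z].
Qed.

End L2_space.

Section L2_hilbert.
Context {R : realType} {n : nat}.
Variable Omega : set 'rV[R]_n.
Hypothesis oOmega : open Omega.
Local Notation mu := (@lebesgue_rV R n).
Local Notation aefun := (aefun Omega).
Local Notation Re := (@complex.Re R).
Local Notation Im := (@complex.Im R).
Local Notation L2 := (@L2 R n Omega).
Local Notation dotL2 := (@dotL2 R n Omega).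
Local Notation cls := (aeclass Omega).

Let mOmega : measurable Omega := rV_open_measurable oOmega.

Lemma reprB (u w : aefun) : ae_on Omega (fun x => repr (u - w) x = repr u x - repr w x).
Proof.
apply: (ae_onS2 _ (reprD u (- w)) (reprZ (-1) w)) => x ->.
by rewrite scaleN1r mulN1r => ->.
Qed.

Lemma csq0 : csq Omega (fun=> 0).
Proof.
by split; split; [exact: (measurable_cst (0 : R))| |exact: (measurable_cst (0 : R))|];
  rewrite /= expr0n; exact: integrable0.
Qed.

Lemma L2_0 : L2 0.
Proof.
have -> : (0 : aefun) = cls (fun=> 0).
  apply: aefun_ext; apply: (ae_onS2 _ (reprZ 0 (0 : aefun)) (repr_aeclass (csq_cmeas csq0))) => x.
  by rewrite scale0r mul0r => -> ->.
by apply: L2_aeclass => //; exact: csq0.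
Qed.

Lemma L2_memP a u w : L2 u -> L2 w -> L2 (a *: u + w).
Proof.
move=> /(L2P oOmega) Lu /(L2P oOmega) Lw; apply/(L2P oOmega).
apply: (csq_ae oOmega _ _ (csqZD oOmega a Lu Lw)); first exact: cmeas_repr.
by apply: (ae_onS2 _ (reprD (a *: u) w) (reprZ a u)) => x -> ->.
Qed.

Lemma dotL2_linear a u u' w : L2 u -> L2 u' -> L2 w ->
  dotL2 (a *: u + u') w = a * dotL2 u w + dotL2 u' w.
Proof.
move=> Lu Lu' Lw; have Lz := L2_memP a Lu Lu'.
move: Lu Lu' Lw Lz => /(L2P oOmega) Lu /(L2P oOmega) Lu' /(L2P oOmega) Lw /(L2P oOmega) Lz.
rewrite /dotL2 -(cintegralZD oOmega a (csqMJ oOmega Lu Lw) (csqMJ oOmega Lu' Lw)).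
apply: cintegral_ae => //.
- by have [/integrableP[/measurable_EFinP ? _] /integrableP[/measurable_EFinP ? _]] := csqMJ oOmega Lz Lw.
- have [/integrableP[/measurable_EFinP m1 _] /integrableP[/measurable_EFinP m2 _]] := csqMJ oOmega (csqZD oOmega a Lu Lu') Lw.
  split; [move: m1|move: m2]; congr measurable_fun; apply/funext => x /=; congr (_ _);
    by rewrite mulrDl mulrA.
- by apply: (ae_onS2 _ (reprD (a *: u) u') (reprZ a u)) => x -> ->; rewrite mulrDl mulrA.
Qed.

Lemma cintegralJ f : cintegrable Omega f ->
  cintegral Omega (fun x => conjc (f x)) = conjc (cintegral Omega f).
Proof.
move=> [_ i2]; rewrite /cintegral; apply: complex_eqP => /=.
  by congr Rintegral; apply/funext => x; case: (f x).
rewrite (_ : (fun x => Im _) = (fun x => (-1) * Im (f x))); last first.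
  by apply/funext => x; case: (f x) => ? ? /=; rewrite mulN1r.
by rewrite RintegralZl// mulN1r.
Qed.

Lemma dotL2_conj u w : L2 u -> L2 w -> dotL2 w u = conjc (dotL2 u w).
Proof.
move=> /(L2P oOmega) Lu /(L2P oOmega) Lw; rewrite /dotL2 -cintegralJ; last exact: csqMJ.
congr cintegral; apply/funext => x; rewrite rmorphM /= conjcK mulrC //.
Qed.

Lemma Re_dotL2 u : L2 u -> ((Re (dotL2 u u))%:E =
  \int[mu]_(x in Omega) (Re (repr u x) ^+ 2 + Im (repr u x) ^+ 2)%:E)%E.
Proof.
move=> /(L2P oOmega) Lu; have [i1 _] := csqMJ oOmega Lu Lu.
rewrite /dotL2 /= /Rintegral fineK; last exact: integrable_fin_num i1.
apply: eq_integral => x _; congr EFin; case: (repr u x) => p q /=.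
by rewrite mulrN opprK !expr2.
Qed.

Lemma dotL2_ge0 u : L2 u -> 0 <= Re (dotL2 u u).
Proof.
move=> Lu; rewrite -lee_fin Re_dotL2//; apply: integral_ge0 => x _.
by rewrite lee_fin addr_ge0 ?sqr_ge0.
Qed.

Lemma dotL2_eq0 u : L2 u -> Re (dotL2 u u) = 0 -> u = 0.
Proof.
move=> Lu; rewrite -[_ = 0]/(Re (dotL2 u u) = 0) => u0.
have := Re_dotL2 Lu; rewrite u0 => /esym.
have [m1 m2] := cmeas_repr u.
rewrite (_ : (\int[mu]_(x in Omega) _)%E = (\int[mu]_(x in Omega) `|(Re (repr u x) ^+ 2 + Im (repr u x) ^+ 2)%:E|)%E); last first.
  by apply: eq_integral => x _; rewrite gee0_abs// lee_fin addr_ge0 ?sqr_ge0.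
move/(ae_eq_integral_abs _ mOmega) => h.
have : ae_on Omega (fun x => repr u x = 0 :> R[i]).
  apply: (@ae_onS _ _ _ (fun x => (Re (repr u x) ^+ 2 + Im (repr u x) ^+ 2)%:E = 0%E)); last first.
    by apply: h; apply/measurable_EFinP; apply: measurable_funD; exact: measurable_funX.
  move=> x [] /eqP; rewrite paddr_eq0 ?sqr_ge0// !sqrf_eq0 => /andP[/eqP p0 /eqP q0].
  by apply: complex_eqP; rewrite ?p0 ?q0.
move=> h0; apply: aefun_ext; apply: (ae_onS2 _ h0 (reprZ 0 (0 : aefun))) => x ->.
by rewrite scale0r mul0r.
Qed.

Lemma dotL2_inner_product : inner_product_on L2 dotL2.
Proof.
split.
- exact: L2_0.
- exact: L2_memP.
- exact: dotL2_linear.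
- exact: dotL2_conj.
- exact: dotL2_ge0.
- exact: dotL2_eq0.
Qed.

Lemma dotL2_aeclass (f g : 'rV[R]_n -> R[i]) : csq Omega f -> csq Omega g ->
  dotL2 (cls f) (cls g) = cintegral Omega (fun x => f x * conjc (g x)).
Proof.
move=> sf sg.
have /(L2P oOmega) Lf := L2_aeclass oOmega sf; have /(L2P oOmega) Lg := L2_aeclass oOmega sg.
apply: cintegral_ae => //.
- by have [/integrableP[/measurable_EFinP ? _] /integrableP[/measurable_EFinP ? _]] := csqMJ oOmega Lf Lg.
- by have [/integrableP[/measurable_EFinP ? _] /integrableP[/measurable_EFinP ? _]] := csqMJ oOmega sf sg.
- by apply: (ae_onS2 _ (repr_aeclass (csq_cmeas sf)) (repr_aeclass (csq_cmeas sg))) => x -> ->.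
Qed.

Lemma dotL2_aeclass_r u (g : 'rV[R]_n -> R[i]) : L2 u -> csq Omega g ->
  dotL2 u (cls g) = cintegral Omega (fun x => repr u x * conjc (g x)).
Proof.
move=> /(L2P oOmega) Lu sg.
have /(L2P oOmega) Lg := L2_aeclass oOmega sg.
apply: cintegral_ae => //.
- by have [/integrableP[/measurable_EFinP ? _] /integrableP[/measurable_EFinP ? _]] := csqMJ oOmega Lu Lg.
- by have [/integrableP[/measurable_EFinP ? _] /integrableP[/measurable_EFinP ? _]] := csqMJ oOmega Lu sg.
- by apply: (ae_onS _ (repr_aeclass (csq_cmeas sg))) => x ->.
Qed.

(** Riesz-Fischer is applied to the real and imaginary parts of the representatives; each
    contributes an error of [4 * 2^-1 ^+ k] to the squared distance. *)
Lemma L2_complete : complete_on L2 dotL2.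
Proof.
apply: (complete_on_rapid dotL2_inner_product) => u Lu du.
have su k : csq Omega (repr (u k)) by exact/(L2P oOmega).
have d4 k : ((Re (dotL2 (u k.+1 - u k) (u k.+1 - u k)))%:E <= (4^-1 ^+ k)%:E)%E.
  have LB := ip_memB dotL2_inner_product (Lu k.+1) (Lu k).
  rewrite lee_fin -/(rdot dotL2 _ _) -(nrm_sqr dotL2_inner_product)//.
  rewrite (_ : 4^-1 ^+ k = (2^-1 ^+ k) ^+ 2 :> R) ?lerXn2r ?nnegrE ?nrm_ge0 ?exprn_ge0//.
  by rewrite -exprM mulnC exprM; congr (_ ^+ _); lra.
have aeB k := reprB (u k.+1) (u k).
have intB (p : R[i] -> R) : (forall z, p z ^+ 2 <= Re z ^+ 2 + Im z ^+ 2) ->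
    (forall z w, p (z - w) = p z - p w) ->
    (forall k, measurable_fun Omega (p \o repr (u k))) -> forall k,
    (\int[mu]_(x in Omega) ((p (repr (u k.+1) x) - p (repr (u k) x)) ^+ 2)%:E <= (4^-1 ^+ k)%:E)%E.
  move=> pz pB mp k; apply: le_trans (d4 k).
  have LB := ip_memB dotL2_inner_product (Lu k.+1) (Lu k).
  have [m1 m2] := cmeas_repr (u k.+1 - u k).
  rewrite Re_dotL2//; apply: ae_ge0_le_integral => //.
  - by move=> x _; rewrite lee_fin sqr_ge0.
  - by apply/measurable_EFinP; apply: measurable_funX; apply: measurable_funB; exact: mp.
  - by move=> x _; rewrite lee_fin addr_ge0 ?sqr_ge0.
  - by apply/measurable_EFinP; apply: measurable_funD; exact: measurable_funX.
  - by move: (aeB k); rewrite /ae_on; apply: filterS => x h Ox; rewrite lee_fin -pB h.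
have Re_le (z : R[i]) : Re z ^+ 2 <= Re z ^+ 2 + Im z ^+ 2 by rewrite lerDl sqr_ge0.
have Im_le (z : R[i]) : Im z ^+ 2 <= Re z ^+ 2 + Im z ^+ 2 by rewrite lerDr sqr_ge0.
have ReB (z w : R[i]) : Re (z - w) = Re z - Re w by case: z; case: w.
have ImB (z w : R[i]) : Im (z - w) = Im z - Im w by case: z; case: w.
have [f sf df] := Riesz_Fischer mOmega (fun k => (su k).1)
  (intB Re Re_le ReB (fun k => (su k).1.1)).
have [g sg dg] := Riesz_Fischer mOmega (fun k => (su k).2)
  (intB Im Im_le ImB (fun k => (su k).2.1)).
pose h x : R[i] := f x +i* g x.
have sh : csq Omega h by [].
exists (cls h); first exact: L2_aeclass.
have lim k : nrm dotL2 (u k - cls h) ^+ 2 <= 8 * 2^-1 ^+ k.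
  have Lh := L2_aeclass oOmega sh.
  have LB := ip_memB dotL2_inner_product (Lu k) Lh.
  have [m1 m2] := cmeas_repr (u k - cls h).
  have [[mu1 _] [mu2 _]] := su k; have [mf _] := sf; have [mg _] := sg.
  rewrite (nrm_sqr dotL2_inner_product)// -lee_fin Re_dotL2//.
  apply: (@le_trans _ _ (\int[mu]_(x in Omega)
      ((f x - Re (repr (u k) x)) ^+ 2 + (g x - Im (repr (u k) x)) ^+ 2)%:E)%E).
    apply: ae_ge0_le_integral => //.
    - by move=> x _; rewrite lee_fin addr_ge0 ?sqr_ge0.
    - by apply/measurable_EFinP; apply: measurable_funD; exact: measurable_funX.
    - by move=> x _; rewrite lee_fin addr_ge0 ?sqr_ge0.
    - by apply/measurable_EFinP; apply: measurable_funD; apply: measurable_funX; exact: measurable_funB.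
    - have : ae_on Omega (fun x => repr (u k - cls h) x = repr (u k) x - h x).
        by apply: (ae_onS2 _ (reprB (u k) (cls h)) (repr_aeclass (csq_cmeas sh))) => x -> ->.
      rewrite /ae_on; apply: filterS => x E Ox.
      by rewrite lee_fin E// ReB ImB /= -sqrrN opprB -[X in _ + X]sqrrN opprB.
  under eq_integral do rewrite EFinD.
  rewrite ge0_integralD//; last 4 first.
  - by move=> x _; rewrite lee_fin sqr_ge0.
  - by apply/measurable_EFinP; apply: measurable_funX; exact: measurable_funB.
  - by move=> x _; rewrite lee_fin sqr_ge0.
  - by apply/measurable_EFinP; apply: measurable_funX; exact: measurable_funB.
  rewrite (_ : 8 = 4 + 4); last by lra.
  by rewrite mulrDl EFinD; exact: leeD (df k) (dg k).
move=> e e0; have e8 : 0 < e ^+ 2 / 8 by rewrite divr_gt0 ?exprn_gt0.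
have [N hN] := half_pow_lt e8; exists N => k Nk.
suff : nrm dotL2 (u k - cls h) ^+ 2 < e ^+ 2 by rewrite ltr_pXn2r ?nnegrE ?nrm_ge0 ?(ltW e0).
by apply: le_lt_trans (lim k) _; have := hN k Nk; lra.
Qed.

End L2_hilbert.

(** * Multiplication by a bounded real function *)

Section multiplication_operator.
Context {R : realType} {n : nat}.
Variable Omega : set 'rV[R]_n.
Hypothesis oOmega : open Omega.
Local Notation mu := (@lebesgue_rV R n).
Local Notation aefun := (aefun Omega).
Local Notation Re := (@complex.Re R).
Local Notation Im := (@complex.Im R).
Local Notation L2 := (@L2 R n Omega).
Local Notation dotL2 := (@dotL2 R n Omega).
Local Notation cls := (aeclass Omega).
Local Notation ipL2 := (dotL2_inner_product oOmega).
Variable a : 'rV[R]_n -> R.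
Hypothesis aoo : Linfty Omega a.
Local Notation mulf := (@mulf R n Omega a).

Let mOmega : measurable Omega := rV_open_measurable oOmega.

Lemma Linfty_sq_integrable (f : 'rV[R]_n -> R) : sq_integrable mu Omega f ->
  sq_integrable mu Omega (fun x => a x * f x).
Proof.
have [ma [M aM]] := aoo; move=> [mf /integrableP[m2 i2]].
have maf : measurable_fun Omega (fun x => a x * f x) by exact: measurable_funM.
split=> //; apply/integrableP; split; first by apply/measurable_EFinP; exact: measurable_funX.
apply: (@le_lt_trans _ _ (\int[mu]_(x in Omega) ((M ^+ 2)%:E * (f x ^+ 2)%:E))%E).
  apply: ae_ge0_le_integral => //.
  - by apply: measurableT_comp => //; apply/measurable_EFinP; exact: measurable_funX.
  - by move=> x _; rewrite -EFinM lee_fin mulr_ge0 ?sqr_ge0.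
  - by apply/measurable_EFinP; apply: measurable_funM; [exact: measurable_cst|exact: measurable_funX].
  - apply: filterS aM => x h Ox; rewrite gee0_abs ?lee_fin ?sqr_ge0// exprMn.
    by rewrite ler_wpM2r ?sqr_ge0// -(real_normK (num_real (a x))) lerXn2r ?nnegrE// ?h// (le_trans _ (h Ox)).
rewrite ge0_integralZl//; last 2 first.
- by move=> x _; rewrite lee_fin sqr_ge0.
- by rewrite lee_fin sqr_ge0.
apply: lte_mul_pinfty => //; first by rewrite lee_fin sqr_ge0.
apply: le_lt_trans i2; rewrite le_eqVlt; apply/orP; left; apply/eqP.
by apply: eq_integral => x _; rewrite gee0_abs// lee_fin sqr_ge0.
Qed.

Lemma csq_Linfty (f : 'rV[R]_n -> R[i]) : csq Omega f -> csq Omega (fun x => (a x)%:C * f x).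
Proof.
move=> [f1 f2]; split.
  have := Linfty_sq_integrable f1; congr sq_integrable; apply/funext => x /=.
  by rewrite Re_real_mul.
have := Linfty_sq_integrable f2; congr sq_integrable; apply/funext => x /=.
by case: (f x) => ? ? /=; rewrite mul0r addr0.
Qed.

Lemma repr_mulf u : L2 u -> ae_on Omega (fun x => repr (mulf u) x = (a x)%:C * repr u x).
Proof. by move=> /(L2P oOmega) /csq_Linfty /csq_cmeas /repr_aeclass. Qed.

Lemma L2_mulf u : L2 u -> L2 (mulf u).
Proof. by move=> /(L2P oOmega) /csq_Linfty; exact: L2_aeclass. Qed.

Lemma mulf_linear s u w : L2 u -> L2 w -> mulf (s *: u + w) = s *: mulf u + mulf w.
Proof.
move=> Lu Lw; apply: aefun_ext.
have h1 := ae_onS2 (fun x p q => conj p q) (repr_mulf (L2_memP oOmega s Lu Lw)) (reprD (s *: u) w).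
have h2 := ae_onS2 (fun x p q => conj p q) (reprZ s u) (reprD (s *: mulf u) (mulf w)).
have h3 := ae_onS2 (fun x p q => conj p q) (reprZ s (mulf u)) (repr_mulf Lu).
have h4 := ae_onS2 (fun x p q => conj p q) h1 h2.
have h5 := ae_onS2 (fun x p q => conj p q) h3 (repr_mulf Lw).
apply: (ae_onS2 _ h4 h5) => x [[-> ->] [-> ->]] [[-> ->] ->].
by rewrite mulrDr mulrCA.
Qed.

Lemma dotL2_mulf u w : L2 u -> L2 w -> dotL2 (mulf u) w = dotL2 u (mulf w).
Proof.
move=> Lu Lw; have Lau := L2_mulf Lu; have Law := L2_mulf Lw.
apply: cintegral_ae => //.
- have [/integrableP[/measurable_EFinP ? _] /integrableP[/measurable_EFinP ? _]] //:=
    csqMJ oOmega ((L2P oOmega _).1 Lau) ((L2P oOmega _).1 Lw).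
- have [/integrableP[/measurable_EFinP ? _] /integrableP[/measurable_EFinP ? _]] //:=
    csqMJ oOmega ((L2P oOmega _).1 Lu) ((L2P oOmega _).1 Law).
- apply: (ae_onS2 _ (repr_mulf Lu) (repr_mulf Lw)) => x -> ->.
  rewrite rmorphM /= mulrCA mulrA; congr (_ * _ * _).
  by apply: complex_eqP; rewrite /= ?oppr0.
Qed.

Lemma Re_dotL2_mulf u : L2 u -> ((Re (dotL2 (mulf u) u))%:E =
  \int[mu]_(x in Omega) (a x * (Re (repr u x) ^+ 2 + Im (repr u x) ^+ 2))%:E)%E.
Proof.
move=> Lu; have Lau := L2_mulf Lu.
have [ma _] := aoo; have [m1 m2] := cmeas_repr u.
have [i1 _] := csqMJ oOmega ((L2P oOmega _).1 Lau) ((L2P oOmega _).1 Lu).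
rewrite /dotL2 /= /Rintegral fineK; last exact: integrable_fin_num i1.
have /integrableP[/measurable_EFinP mi _] := i1.
apply: (ae_on_integral oOmega) => //.
  by apply: measurable_funM => //; apply: measurable_funD; exact: measurable_funX.
apply: (ae_onS _ (repr_mulf Lu)) => x ->; case: (repr u x) => p q /=; ring.
Qed.

Lemma mulf_ge0 u : {ae mu, forall x, Omega x -> 0 <= a x} -> L2 u ->
  0 <= rdot dotL2 (mulf u) u.
Proof.
move=> a0 Lu; rewrite -lee_fin Re_dotL2_mulf//.
have [ma _] := aoo; have [m1 m2] := cmeas_repr u.
(* The integrand is known to be nonnegative only almost everywhere; it is replaced by its absolute
   value, with the same integral. *)
rewrite (_ : (\int[mu]_(x in Omega) (a x * _)%:E)%E =
  (\int[mu]_(x in Omega) `|a x * (Re (repr u x) ^+ 2 + Im (repr u x) ^+ 2)|%:E)%E).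
  by apply: integral_ge0 => x _; rewrite lee_fin.
apply: (ae_on_integral oOmega).
- by apply: measurable_funM => //; apply: measurable_funD; exact: measurable_funX.
- apply: measurableT_comp => //.
  by apply: measurable_funM => //; apply: measurable_funD; exact: measurable_funX.
- move: a0; rewrite /ae_on; apply: filterS => x h Ox.
  by rewrite ger0_norm// mulr_ge0 ?addr_ge0 ?sqr_ge0// h.
Qed.

Lemma nrm_mulf : exists2 M : R, 0 <= M & forall u, L2 u -> nrm dotL2 (mulf u) <= M * nrm dotL2 u.
Proof.
have [ma [M aM]] := aoo; exists `|M| => // u Lu; have Lau := L2_mulf Lu.
have [m1 m2] := cmeas_repr u; have [m3 m4] := cmeas_repr (mulf u).
suff : nrm dotL2 (mulf u) ^+ 2 <= (`|M| * nrm dotL2 u) ^+ 2.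
  by rewrite ler_pXn2r ?nnegrE ?mulr_ge0 ?nrm_ge0.
rewrite exprMn real_normK ?num_real// !(nrm_sqr ipL2)// -lee_fin EFinM !Re_dotL2//.
rewrite -ge0_integralZl//; last 3 first.
- by apply/measurable_EFinP; apply: measurable_funD; exact: measurable_funX.
- by move=> x _; rewrite lee_fin addr_ge0 ?sqr_ge0.
- by rewrite lee_fin sqr_ge0.
apply: ae_ge0_le_integral => //.
- by move=> x _; rewrite lee_fin addr_ge0 ?sqr_ge0.
- by apply/measurable_EFinP; apply: measurable_funD; exact: measurable_funX.
- by move=> x _; rewrite -EFinM lee_fin mulr_ge0 ?addr_ge0 ?sqr_ge0.
- apply/measurable_EFinP; apply: measurable_funM; first exact: measurable_cst.
  by apply: measurable_funD; exact: measurable_funX.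
- move: (repr_mulf Lu); rewrite /ae_on; apply: filterS2 aM => x h E Ox.
  rewrite -EFinM lee_fin E// Re_real_mul; case: (repr u x) => p q /=.
  rewrite mul0r addr0 !exprMn -mulrDr ler_wpM2r ?addr_ge0 ?sqr_ge0//.
  by rewrite -(real_normK (num_real (a x))) lerXn2r ?nnegrE// ?h// (le_trans _ (h Ox)).
Qed.

End multiplication_operator.

(** * Real test functions *)

Section real_test_functions.
Context {R : realType} {n : nat}.
Variable Omega : set 'rV[R]_n.
Hypothesis oOmega : open Omega.
Local Notation mu := (@lebesgue_rV R n).
Local Notation "'e_ i" := (delta_mx ord0 i : 'rV[R]_n) (at level 8, i at level 2).
Implicit Types f g : 'rV[R]_n -> R.

Let mOmega : measurable Omega := rV_open_measurable oOmega.

(** Any compact set containing the points where [f] does not vanish is allowed, instead of the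
    closure of that set: sums, products and derivatives then inherit a witness without computing
    closures. *)
Definition rtest f : Prop := smooth f /\
  exists K, [/\ compact K, K `<=` Omega & forall x, ~ K x -> f x = 0].

Lemma rtest_off f x : rtest f -> ~ Omega x -> f x = 0.
Proof. by move=> [_ [K [_ KO f0]]] Ox; apply: f0 => /KO. Qed.

Lemma rtest_vanishes_off f : rtest f -> exists M : R, vanishes_off M f.
Proof.
move=> [_ [K [cK _ f0]]]; have [M [_ hM]] := compact_bounded cK.
exists (`|M| + 1) => x i xi; apply: f0 => Kx.
have := hM (`|M| + 1); rewrite (le_lt_trans (ler_norm M)) ?ltrDl// => /(_ isT x Kx) /=.
apply/negP; rewrite -ltNge; apply: lt_le_trans xi _; rewrite [leRHS]mx_normrE.
exact: (@le_bigmax _ _ _ 0 (fun i => `|x i.1 i.2|) (ord0, i)).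
Qed.

Lemma rtest_integrable f : rtest f -> mu.-integrable Omega (EFin \o f).
Proof.
move=> tf; have [M fM] := rtest_vanishes_off tf.
apply: (@integrableS _ _ _ _ setT) => //.
by apply: integrable_vanishes_off fM; case: tf => /smooth_continuous.
Qed.

Lemma rtestM f g : smooth f -> rtest g -> rtest (fun x => f x * g x).
Proof.
move=> sf [sg [K [cK KO g0]]]; split; first by move=> k; apply: is_CkM; [exact: sf|exact: sg].
by exists K; split=> // x /g0 ->; rewrite mulr0.
Qed.

Lemma rtest_sq_integrable f : rtest f -> sq_integrable mu Omega f.
Proof.
move=> tf; split; first by apply: rV_continuous_measurable; case: tf => /smooth_continuous.
by have := rtest_integrable (rtestM tf.1 tf).
Qed.

Lemma rtestD f g : rtest f -> rtest g -> rtest (fun x => f x + g x).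
Proof.
move=> [sf [K [cK KO f0]]] [sg [L [cL LO g0]]]; split.
  by move=> k; apply: is_CkD; [exact: sf|exact: sg].
exists (K `|` L); split; [exact: compactU|by move=> x [/KO|/LO]|].
by move=> x /not_orP[/f0 -> /g0 ->]; rewrite addr0.
Qed.

Lemma rtestZ (k : R) f : rtest f -> rtest (fun x => k * f x).
Proof. by apply: rtestM => m; exact: is_Ck_cst. Qed.

Lemma rtestN f : rtest f -> rtest (fun x => - f x).
Proof. by move=> /(rtestZ (-1)); congr rtest; apply/funext => x; rewrite mulN1r. Qed.

Lemma rtest_partial i f : rtest f -> rtest ('D_('e_ i) f).
Proof.
move=> [sf [K [cK KO f0]]]; split; first exact: smooth_partial.
exists K; split=> // x Kx.
have oK : open (~` K) by apply: closed_openC; apply: compact_closed => //; exact: norm_hausdorff.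
rewrite (@near_eq_derive _ _ _ f (cst 0)) ?derive_cst//.
have : nbhs x (~` K) by exact: open_nbhs_nbhs.
by apply: filterS => y /f0.
Qed.

Lemma rtest_integral_partial i f : rtest f -> \int[mu]_(x in Omega) ('D_('e_ i) f x) = 0.
Proof.
move=> tf; have tdf := rtest_partial i tf.
have [M fM] := rtest_vanishes_off tf; have [N dN] := rtest_vanishes_off tdf.
rewrite /Rintegral (_ : (\int[mu]_(x in Omega) _)%E = (\int[mu]_x ('D_('e_ i) f x)%:E)%E); last first.
  rewrite integral_mkcond; apply: eq_integral => x _; rewrite /patch.
  by case: ifPn => // /negP; rewrite inE => /(rtest_off tdf) ->.
have -> // : (\int[mu]_x ('D_('e_ i) f x)%:E = 0)%E.
apply: (@integral_partial_compact_support _ _ i (Num.max M N) f).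
- by case: tdf => /smooth_continuous.
- by move=> x; apply: smooth_is_derive; case: tf.
- by move=> x j; rewrite gt_max => /andP[h _]; exact: fM h.
- by move=> x j; rewrite gt_max => /andP[_ h]; exact: dN h.
Qed.

Lemma rtest_by_parts i f g : smooth f -> rtest g ->
  \int[mu]_(x in Omega) (f x * 'D_('e_ i) g x + 'D_('e_ i) f x * g x) = 0.
Proof.
move=> sf tg; rewrite -(rtest_integral_partial i (rtestM sf tg)); congr Rintegral; apply/funext => x.
rewrite [RHS](@deriveM _ _ f g) /GRing.scale /=; first by rewrite (mulrC ('D_('e_ i) f x)).
  by case: (smooth_is_derive i x sf).
by case: (smooth_is_derive i x tg.1).
Qed.

Lemma is_derive_coord i j x :
  is_derive x ('e_ j) (fun x : 'rV[R]_n => x ord0 i) (i == j)%:R.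
Proof.
have E : is_derive (0 : R) 1 (fun t : R => (i == j)%:R * t + x ord0 i) (i == j)%:R.
  have := is_deriveD (is_deriveZ ((i == j)%:R : R) (is_derive_id (0 : R) 1)) (is_derive_cst (x ord0 i) (0 : R) (1 : R)).
  by rewrite /GRing.scale /= mulr1 addr0.
apply: is_derive_comp_shift E => h.
by rewrite /= !mxE eqxx /= /GRing.scale /= mulr1 addr0 mulrC.
Qed.

Lemma smooth_coord i : smooth (fun x : 'rV[R]_n => x ord0 i).
Proof.
case=> [|k]; first by apply/is_Ck0P; exact: coord_continuous.
apply/is_CkSP; split=> [|j]; first exact: coord_continuous.
split=> [x|]; first by case: (is_derive_coord i j x).
have := @is_Ck_cst R n k ((i == j)%:R); congr (is_Ck k _).
by apply/funext => x; have /@derive_val := is_derive_coord i j x.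
Qed.

(** The derivative of [x_i * f ^ 2] along coordinate [i] is [G], equal to
    [f ^ 2 + 2 * x_i * f * D f], and its integral is zero. Completing the square bounds [G] below by
    [f ^ 2 / 2 - 2 * M ^ 2 * (D f) ^ 2], whence the constant [4 * M ^+ 2]. *)
Lemma rtest_Poincare i (M : R) f : (forall x, Omega x -> `|x ord0 i| <= M) -> rtest f ->
  \int[mu]_(x in Omega) (f x ^+ 2) <=
  4 * M ^+ 2 * \int[mu]_(x in Omega) ('D_('e_ i) f x ^+ 2).
Proof.
move=> OM tf; have tdf := rtest_partial i tf.
have [_ i1] := rtest_sq_integrable tf; have [_ i2] := rtest_sq_integrable tdf.
have txf := rtestM (smooth_coord i) tf.
have h := rtest_by_parts i tf.1 txf.
pose G x := f x * 'D_('e_ i) (fun x : 'rV[R]_n => x ord0 i * f x) x + 'D_('e_ i) f x * (x ord0 i * f x).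
have GE x : G x = f x ^+ 2 + 2 * x ord0 i * f x * 'D_('e_ i) f x.
  have dx : 'D_('e_ i) (fun x : 'rV[R]_n => x ord0 i) x = 1.
    by have /@derive_val := is_derive_coord i i x; rewrite eqxx.
  rewrite /G [X in f x * X](@deriveM _ _ (fun x : 'rV[R]_n => x ord0 i) f).
  - rewrite dx /GRing.scale /=; ring.
  - by case: (smooth_is_derive i x (smooth_coord i)).
  - by case: (smooth_is_derive i x tf.1).
have iG : mu.-integrable Omega (fun x => (G x)%:E).
  have iA := rtest_integrable (rtestM tf.1 (rtest_partial i txf)).
  have iB := rtest_integrable (rtestM tdf.1 txf).
  have := integrableD mOmega iA iB; congr (_.-integrable _ _).
have iZ (k : R) u : mu.-integrable Omega (fun x => (u x)%:E) -> mu.-integrable Omega (fun x => (k * u x)%:E).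
  by move=> iu; rewrite (_ : (fun _ => _) = (fun x => k%:E * (u x)%:E)%E)//; exact: integrableZl.
have : \int[mu]_(x in Omega) (2^-1 * f x ^+ 2 - 2 * M ^+ 2 * 'D_('e_ i) f x ^+ 2) <= \int[mu]_(x in Omega) G x.
  apply: le_Rintegral => //.
    rewrite (_ : _ \o _ = (fun x => (2^-1 * f x ^+ 2)%:E - (2 * M ^+ 2 * 'D_('e_ i) f x ^+ 2)%:E)%E).
      by apply: integrableB => //; exact: iZ.
    by apply/funext => x; rewrite /= EFinB.
  move=> x Ox; rewrite GE.
  have xM : x ord0 i ^+ 2 <= M ^+ 2.
    by rewrite -(real_normK (num_real (x ord0 i))) lerXn2r ?nnegrE// ?OM// (le_trans _ (OM x Ox)).
  have := ler_wpM2r (sqr_ge0 ('D_('e_ i) f x)) xM.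
  have := sqr_ge0 (f x + 2 * x ord0 i * 'D_('e_ i) f x).
  move: ('D_('e_ i) f x) (f x) (x ord0 i) => D F X; nra.
rewrite [leRHS]h RintegralB ?RintegralZl//; [lra|exact: iZ|exact: iZ].
Qed.

End real_test_functions.

(** * Complex test functions and weak derivatives *)

Section test_functions.
Context {R : realType} {n : nat}.
Variable Omega : set 'rV[R]_n.
Hypothesis oOmega : open Omega.
Local Notation mu := (@lebesgue_rV R n).
Local Notation aefun := (aefun Omega).
Local Notation Re := (@complex.Re R).
Local Notation Im := (@complex.Im R).
Local Notation L2 := (@L2 R n Omega).
Local Notation dotL2 := (@dotL2 R n Omega).
Local Notation cls := (aeclass Omega).
Local Notation ipL2 := (dotL2_inner_product oOmega).
Local Notation "'e_ i" := (delta_mx ord0 i : 'rV[R]_n) (at level 8, i at level 2).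
Implicit Types phi psi : 'rV[R]_n -> R[i].

Let mOmega : measurable Omega := rV_open_measurable oOmega.

Lemma test_functionP phi :
  test_function Omega phi <-> rtest Omega (Re \o phi) /\ rtest Omega (Im \o phi).
Proof.
split=> [[sr si cs sO]|[[sr [K [cK KO r0]]] [si [L [cL LO i0]]]]].
  have off x : ~ closure [set x | phi x != 0] x -> phi x = 0.
    by apply: contra_notP => /eqP px; exact: subset_closure.
  split; split.
  - exact: sr.
  - by exists (closure [set x | phi x != 0]); split; [exact: cs|exact: sO|move=> x /off /= ->].
  - exact: si.
  - by exists (closure [set x | phi x != 0]); split; [exact: cs|exact: sO|move=> x /off /= ->].
have cKL : compact (K `|` L) by exact: compactU.
have sub : closure [set x | phi x != 0] `<=` K `|` L.
  have clKL : closed (K `|` L) by apply: compact_closed => //; exact: norm_hausdorff.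
  rewrite closureE; apply: smallest_sub => // x /eqP; apply: contra_notP => /not_orP[Kx Lx].
  by apply: complex_eqP; [exact: r0|exact: i0].
split; [exact: sr|exact: si| |by move=> x /sub[/KO|/LO]].
by apply: (subclosed_compact _ cKL) => //; exact: closed_closure.
Qed.

Lemma test_functionZD a phi psi : test_function Omega phi -> test_function Omega psi ->
  test_function Omega (fun x => a * phi x + psi x).
Proof.
move=> /test_functionP[r1 i1] /test_functionP[r2 i2]; apply/test_functionP.
case: a => a1 a2; split.
  have := rtestD (rtestD (rtestZ a1 r1) (rtestN (rtestZ a2 i1))) r2.
  by congr rtest; apply/funext => x /=; case: (phi x) => ? ?; case: (psi x).
have := rtestD (rtestD (rtestZ a1 i1) (rtestZ a2 r1)) i2.
by congr rtest; apply/funext => x /=; case: (phi x) => ? ?; case: (psi x).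
Qed.

Lemma test_functionJ phi : test_function Omega phi -> test_function Omega (fun x => conjc (phi x)).
Proof.
move=> /test_functionP[r1 i1]; apply/test_functionP; split.
  by move: r1; congr rtest; apply/funext => x /=; case: (phi x).
by have := rtestN i1; congr rtest; apply/funext => x /=; case: (phi x).
Qed.

Lemma test_function0 : test_function Omega (fun=> 0).
Proof.
by apply/test_functionP; split; split; first [exact: (@is_Ck_cst R n ^~ 0)|
  exists set0; split=> //; exact: compact0].
Qed.

Lemma test_function_partial i phi : test_function Omega phi -> test_function Omega (cpartial i phi).
Proof.
by move=> /test_functionP[r1 i1]; apply/test_functionP; split; exact: rtest_partial.
Qed.

Lemma test_function_csq phi : test_function Omega phi -> csq Omega phi.
Proof. by move=> /test_functionP[r1 i1]; split; exact: rtest_sq_integrable. Qed.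

Lemma L2_test phi : test_function Omega phi -> L2 (cls phi).
Proof. by move/test_function_csq; exact: L2_aeclass. Qed.

Lemma L2_test_partial i phi : test_function Omega phi -> L2 (cls (cpartial i phi)).
Proof. by move/(test_function_partial i); exact: L2_test. Qed.

Lemma cpartialJ i phi : test_function Omega phi ->
  cpartial i (fun x => conjc (phi x)) = (fun x => conjc (cpartial i phi x)).
Proof.
move=> /test_functionP[r1 i1]; apply/funext => x; apply: complex_eqP => /=.
  by congr derive; apply/funext => y; case: (phi y).
have /@derive_val <- := is_deriveN (smooth_is_derive i x i1.1).
suff -> : (fun y => Im (conjc (phi y))) = (fun y => - Im (phi y)) by [].
by apply/funext => y; case: (phi y).
Qed.

Lemma aeclassZD a phi psi : csq Omega phi -> csq Omega psi ->
  cls (fun x => a * phi x + psi x) = a *: cls phi + cls psi.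
Proof.
move=> s1 s2; apply: aefun_ext.
have h1 := ae_onS2 (fun x p q => conj p q) (repr_aeclass (csq_cmeas (csqZD oOmega a s1 s2)))
  (reprD (a *: cls phi) (cls psi)).
have h2 := ae_onS2 (fun x p q => conj p q) (reprZ a (cls phi)) (repr_aeclass (csq_cmeas s1)).
have h3 := ae_onS2 (fun x p q => conj p q) h2 (repr_aeclass (csq_cmeas s2)).
by apply: (ae_onS2 _ h1 h3) => x [-> ->] [[-> ->] ->].
Qed.

Lemma cintegral_by_parts i phi psi : test_function Omega phi -> test_function Omega psi ->
  cintegral Omega (fun x => phi x * cpartial i psi x) =
  - cintegral Omega (fun x => cpartial i phi x * psi x).
Proof.
move=> tp tq; have [[r1 i1] [r2 i2]] := ((test_functionP _).1 tp, (test_functionP _).1 tq).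
have I1 := csqM oOmega (test_function_csq tp) (test_function_csq (test_function_partial i tq)).
have I2 := csqM oOmega (test_function_csq (test_function_partial i tp)) (test_function_csq tq).
apply/eqP; rewrite -addr_eq0; apply/eqP.
have := cintegralZD oOmega 1 I1 I2; rewrite mul1r => <-.
have B f g (tf : rtest Omega f) (tg : rtest Omega g) := rtest_by_parts i tf.1 tg.
have Bi f g (tf : rtest Omega f) (tg : rtest Omega g) : mu.-integrable Omega
    (EFin \o (fun x => f x * 'D_('e_ i) g x + 'D_('e_ i) f x * g x)).
  rewrite (_ : _ \o _ = (fun x => (f x * 'D_('e_ i) g x)%:E + ('D_('e_ i) f x * g x)%:E)%E)//.
  by apply: integrableD => //; [apply: (rtest_integrable oOmega (rtestM tf.1 (rtest_partial i tg)))|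
    apply: (rtest_integrable oOmega (rtestM (rtest_partial i tf).1 tg))].
apply: complex_eqP => /=.
  rewrite (_ : (fun _ => _) = (fun x => (Re (phi x) * 'D_('e_ i) (Re \o psi) x + 'D_('e_ i) (Re \o phi) x * Re (psi x)) -
     (Im (phi x) * 'D_('e_ i) (Im \o psi) x + 'D_('e_ i) (Im \o phi) x * Im (psi x)))).
    by rewrite RintegralB//; [rewrite !B// subrr|exact: Bi|exact: Bi].
  apply/funext => x; rewrite mul1r /cpartial; case: (phi x) (psi x) => p1 p2 [q1 q2] /=; ring.
rewrite (_ : (fun _ => _) = (fun x => (Re (phi x) * 'D_('e_ i) (Im \o psi) x + 'D_('e_ i) (Re \o phi) x * Im (psi x)) +
   (Im (phi x) * 'D_('e_ i) (Re \o psi) x + 'D_('e_ i) (Im \o phi) x * Re (psi x)))).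
  by rewrite RintegralD//; [rewrite !B// addr0|exact: Bi|exact: Bi].
apply/funext => x; rewrite mul1r /cpartial; case: (phi x) (psi x) => p1 p2 [q1 q2] /=; ring.
Qed.

Lemma dotL2_test_partial u i phi : L2 u -> test_function Omega phi ->
  dotL2 u (cls (cpartial i phi)) =
  cintegral Omega (fun x => repr u x * cpartial i (fun y => conjc (phi y)) x).
Proof.
move=> Lu tp; rewrite (cpartialJ i tp).
exact: (dotL2_aeclass_r oOmega Lu (test_function_csq (test_function_partial i tp))).
Qed.

Lemma dotL2_test u phi : L2 u -> test_function Omega phi ->
  dotL2 u (cls phi) = cintegral Omega (fun x => repr u x * conjc (phi x)).
Proof. by move=> Lu tp; exact: (dotL2_aeclass_r oOmega Lu (test_function_csq tp)). Qed.

Lemma test_functionJK phi : (fun x => conjc (conjc (phi x))) = phi.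
Proof. by apply/funext => x; rewrite conjcK. Qed.

Lemma weak_partialP i u g : L2 u -> L2 g -> weak_partial i u g <->
  forall phi, test_function Omega phi ->
    dotL2 u (cls (cpartial i phi)) = - dotL2 g (cls phi).
Proof.
move=> Lu Lg; split=> H phi tp.
  rewrite (dotL2_test_partial i Lu tp) (dotL2_test Lg tp).
  exact: H (test_functionJ tp).
have tj := test_functionJ tp.
have := H _ tj; rewrite (dotL2_test_partial i Lu tj) (dotL2_test Lg tj) test_functionJK => ->.
by congr (- cintegral _ _); apply/funext => x; rewrite conjcK.
Qed.

Lemma weak_divP (p : 'I_n -> aefun) f : (forall i, L2 (p i)) -> L2 f -> weak_div p f <->
  forall phi, test_function Omega phi ->
    \sum_(i < n) dotL2 (p i) (cls (cpartial i phi)) = - dotL2 f (cls phi).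
Proof.
move=> Lp Lf; split=> H phi tp.
  rewrite (dotL2_test Lf tp) -(H _ (test_functionJ tp)).
  by apply: eq_bigr => i _; exact: dotL2_test_partial.
have tj := test_functionJ tp.
have := H _ tj; rewrite (dotL2_test Lf tj).
rewrite (_ : (fun x => _ * conjc _) = (fun x => repr f x * phi x)); last first.
  by apply/funext => x; rewrite conjcK.
move=> <-; apply: eq_bigr => i _.
by rewrite (dotL2_test_partial i (Lp i) tj) test_functionJK.
Qed.

Lemma weak_partial_test i phi : test_function Omega phi ->
  weak_partial i (cls phi) (cls (cpartial i phi)).
Proof.
move=> tp; have tdp := test_function_partial i tp.
apply/weak_partialP; [exact: L2_test|exact: L2_test|] => psi tq.
have tdq := test_function_partial i tq.
rewrite !(dotL2_aeclass oOmega); try exact: test_function_csq.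
by have := cintegral_by_parts i tp (test_functionJ tq); rewrite cpartialJ.
Qed.

(** Density is expressed through a trivial orthogonal complement. Since [Omega] is bounded, the
    constant 1 is square integrable and [g] is integrable, as the fundamental lemma requires;
    pairing with real bumps separates its real and imaginary parts. *)
Lemma test_functions_dense g : bounded_set Omega -> L2 g ->
  (forall phi, test_function Omega phi -> dotL2 g (cls phi) = 0) -> g = 0.
Proof.
move=> bO Lg g0; have /(L2P oOmega) [s1 s2] := Lg.
have one : sq_integrable mu Omega (fun=> 1).
  apply: (@bounded_sq_integrable _ _ _ mu Omega mOmega _ 1) => //; last by move=> x _; rewrite normr1.
  exact: bounded_lebesgue_rV.
have i1 : mu.-integrable Omega (EFin \o (Re \o repr g)).
  by have := sq_integrable_integrableM mOmega s1 one; congr (_.-integrable _ _); apply/funext => x; rewrite mulr1.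
have i2 : mu.-integrable Omega (EFin \o (Im \o repr g)).
  by have := sq_integrable_integrableM mOmega s2 one; congr (_.-integrable _ _); apply/funext => x; rewrite mulr1.
have bump a b k : closed_box a b `<=` Omega -> rtest Omega (box_bump a b k).
  move=> abO; split; first exact: box_bump_smooth.
  exists (closed_box a b); split=> //; first exact: closed_box_compact.
  move=> x abx; apply: box_bump_off; apply: contra_not abx => h i.
  by have /andP[h1 h2] := h i; rewrite !ltW.
have key a b k : closed_box a b `<=` Omega ->
    (\int[mu]_(x in Omega) (Re (repr g x) * box_bump a b k x)%:E = 0)%E /\
    (\int[mu]_(x in Omega) (Im (repr g x) * box_bump a b k x)%:E = 0)%E.
  move=> abO; have rb := bump a b k abO.
  have tb : test_function Omega (fun x => (box_bump a b k x)%:C).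
    by apply/test_functionP; split=> //; have := rtestZ 0 rb; congr rtest; apply/funext => x; rewrite mul0r.
  have sb := rtest_sq_integrable oOmega rb.
  have j1 := sq_integrable_integrableM mOmega s1 sb.
  have j2 := sq_integrable_integrableM mOmega s2 sb.
  have := g0 _ tb; rewrite (dotL2_aeclass_r oOmega)//; last exact: test_function_csq.
  rewrite (_ : (fun x => _ * conjc _) = (fun x => (Re (repr g x) * box_bump a b k x) +i* (Im (repr g x) * box_bump a b k x))); last first.
    by apply/funext => x; case: (repr g x) => p q; apply: complex_eqP => /=; ring.
  move=> [h1 h2]; split.
    by rewrite -[LHS]fineK; [congr EFin|exact: integrable_fin_num j1].
  by rewrite -[LHS]fineK; [congr EFin|exact: integrable_fin_num j2].
have z1 : ae_on Omega (fun x => Re (repr g x) = 0).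
  by apply: (ae_eq0_box_bumps oOmega i1) => a b k /(key a b k)[].
have z2 : ae_on Omega (fun x => Im (repr g x) = 0).
  by apply: (ae_eq0_box_bumps oOmega i2) => a b k /(key a b k)[].
have z : ae_on Omega (fun x => repr g x = 0 :> R[i]).
  by apply: (ae_onS2 _ z1 z2) => x h1 h2; apply: complex_eqP.
apply: aefun_ext; apply: (ae_onS2 _ z (reprZ 0 (0 : aefun))) => x ->.
by rewrite scale0r mul0r.
Qed.

Lemma test_function_Poincare i : bounded_set Omega -> exists2 C : R, 0 <= C &
  forall phi, test_function Omega phi ->
    nrm dotL2 (cls phi) <= C * nrm dotL2 (cls (cpartial i phi)).
Proof.
move=> [M0 [_ OM0]]; pose M := `|M0| + 1.
have OM x : Omega x -> `|x ord0 i| <= M.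
  move=> Ox; have := OM0 M; rewrite (le_lt_trans (ler_norm M0)) ?ltrDl// => /(_ isT x Ox).
  apply: le_trans; rewrite [leRHS]mx_normrE.
  exact: (@le_bigmax _ _ _ 0 (fun i => `|x i.1 i.2|) (ord0, i)).
have M_ge0 : 0 <= M by rewrite addr_ge0.
(* The square of [2 * M] is the constant of [rtest_Poincare], which is applied to the real and
   imaginary parts and summed. *)
exists (2 * M) => [|phi tp]; first by rewrite mulr_ge0.
have tdp := test_function_partial i tp; have [r1 i1] := (test_functionP _).1 tp.
have nE psi : test_function Omega psi -> nrm dotL2 (cls psi) ^+ 2 =
    \int[mu]_(x in Omega) (Re (psi x) ^+ 2) + \int[mu]_(x in Omega) (Im (psi x) ^+ 2).
  move=> tq; have sq := test_function_csq tq; have [[_ q1] [_ q2]] := sq.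
  rewrite (nrm_sqr ipL2); last exact: L2_test.
  rewrite /rdot (dotL2_aeclass oOmega)//= -RintegralD//; congr Rintegral; apply/funext => x.
  by case: (psi x) => p q /=; ring.
suff : nrm dotL2 (cls phi) ^+ 2 <= (2 * M * nrm dotL2 (cls (cpartial i phi))) ^+ 2.
  by rewrite ler_pXn2r ?nnegrE ?mulr_ge0 ?nrm_ge0.
have := nE _ tp; have := nE _ tdp.
move: (nrm dotL2 (cls phi)) (nrm dotL2 (cls (cpartial i phi))) => x y hy hx.
rewrite exprMn hx hy (_ : (2 * M) ^+ 2 = 4 * M ^+ 2); last by ring.
by rewrite mulrDr lerD//; exact: rtest_Poincare.
Qed.

End test_functions.

(** * H1 and weak gradients *)

Section Sobolev.
Context {R : realType} {n : nat}.
Variable Omega : set 'rV[R]_n.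
Hypothesis oOmega : open Omega.
Hypothesis bOmega : bounded_set Omega.
Local Notation aefun := (aefun Omega).
Local Notation Re := (@complex.Re R).
Local Notation Im := (@complex.Im R).
Local Notation L2 := (@L2 R n Omega).
Local Notation H1 := (@H1 R n Omega).
Local Notation H10 := (@H10 R n Omega).
Local Notation dotL2 := (@dotL2 R n Omega).
Local Notation dotgrad := (@dotgrad R n Omega).
Local Notation grad := (@grad R n Omega).
Local Notation cls := (aeclass Omega).
Local Notation ipL2 := (dotL2_inner_product oOmega).
Local Notation tst := (test_function Omega).

Lemma weak_partial_uniq i u g g' : L2 u -> L2 g -> L2 g' ->
  weak_partial i u g -> weak_partial i u g' -> g = g'.
Proof.
move=> Lu Lg Lg' /(weak_partialP oOmega i Lu Lg) H /(weak_partialP oOmega i Lu Lg') H'.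
apply/eqP; rewrite -subr_eq0; apply/eqP.
apply: (test_functions_dense oOmega bOmega); first exact: (ip_memB ipL2).
move=> phi tp; have Lp := L2_test oOmega tp.
rewrite addrC -scaleN1r (ip_linear ipL2)// mulN1r -[dotL2 g _]opprK -H// H'// opprK addrC subrr//.
Qed.

(** As [grad] is a choice, this is the way to compute a gradient: linearity, the gradient of a test
    function and the gradient of a limit all pass through it. *)
Lemma grad_uniq i u g : L2 u -> L2 g -> weak_partial i u g -> grad u i = g.
Proof.
move=> Lu Lg wg; have [Lh wh] : L2 (grad u i) /\ weak_partial i u (grad u i).
  exact: (@xgetPex _ 0 [set g | L2 g /\ weak_partial i u g] (ex_intro _ g (conj Lg wg))).
exact: weak_partial_uniq wh wg.
Qed.

Lemma H1_L2 u : H1 u -> L2 u. Proof. by case. Qed.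

Lemma L2_grad i u : H1 u -> L2 (grad u i).
Proof. by move=> [Lu /(_ i)[g Lg wg]]; rewrite (grad_uniq Lu Lg wg). Qed.

Lemma weak_partial_grad i u : H1 u -> weak_partial i u (grad u i).
Proof. by move=> [Lu /(_ i)[g Lg wg]]; rewrite (grad_uniq Lu Lg wg). Qed.

Lemma weak_partial_linear i a u w g h : L2 u -> L2 w -> L2 g -> L2 h ->
  weak_partial i u g -> weak_partial i w h -> weak_partial i (a *: u + w) (a *: g + h).
Proof.
move=> Lu Lw Lg Lh /(weak_partialP oOmega i Lu Lg) H /(weak_partialP oOmega i Lw Lh) H'.
apply/(weak_partialP oOmega i); [exact: L2_memP|exact: L2_memP|] => phi tp.
have Lp := L2_test oOmega tp; have Ldp := L2_test_partial oOmega i tp.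
by rewrite !(ip_linear ipL2)// H// H'// mulrN opprD.
Qed.

Lemma H1_memP a u w : H1 u -> H1 w -> H1 (a *: u + w).
Proof.
move=> Hu Hw; split; first by apply: L2_memP => //; exact: H1_L2.
move=> i; exists (a *: grad u i + grad w i); first by apply: L2_memP => //; exact: L2_grad.
by apply: weak_partial_linear; [exact: H1_L2|exact: H1_L2|exact: L2_grad|exact: L2_grad|
    exact: weak_partial_grad|exact: weak_partial_grad].
Qed.

Lemma grad_linear a u w i : H1 u -> H1 w -> grad (a *: u + w) i = a *: grad u i + grad w i.
Proof.
move=> Hu Hw; apply: grad_uniq.
- exact: H1_L2 (H1_memP a Hu Hw).
- by apply: L2_memP => //; exact: L2_grad.
- by apply: weak_partial_linear; [exact: H1_L2|exact: H1_L2|exact: L2_grad|exact: L2_grad|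
    exact: weak_partial_grad|exact: weak_partial_grad].
Qed.

Lemma H1_test phi : tst phi -> H1 (cls phi).
Proof.
move=> tp; split=> [|i]; first exact: L2_test.
exists (cls (cpartial i phi)); [exact: L2_test_partial|exact: weak_partial_test].
Qed.

Lemma grad_test phi i : tst phi -> grad (cls phi) i = cls (cpartial i phi).
Proof.
by move=> tp; apply: grad_uniq; [exact: L2_test|exact: L2_test_partial|exact: weak_partial_test].
Qed.

Lemma aeclass0 : cls (fun=> 0) = 0.
Proof.
apply: aefun_ext; apply: (ae_onS2 _ (reprZ 0 (0 : aefun)) (repr_aeclass (csq_cmeas (csq0 Omega)))) => x.
by rewrite scale0r mul0r => -> ->.
Qed.

Lemma H1_0 : H1 0.
Proof.
by have := H1_test (test_function0 Omega); rewrite aeclass0.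
Qed.

Lemma H1_memB u w : H1 u -> H1 w -> H1 (u - w).
Proof.
by move=> Hu Hw; rewrite addrC -scaleN1r; exact: H1_memP.
Qed.

Lemma gradB u w i : H1 u -> H1 w -> grad (u - w) i = grad u i - grad w i.
Proof. by move=> Hu Hw; rewrite addrC -scaleN1r grad_linear// scaleN1r addrC. Qed.

Lemma grad0 i : grad 0 i = 0.
Proof. by rewrite -(subrr 0) gradB ?subrr//; exact: H1_0. Qed.

Lemma dotgrad_linear a u u' w : H1 u -> H1 u' -> H1 w ->
  dotgrad (a *: u + u') w = a * dotgrad u w + dotgrad u' w.
Proof.
move=> Hu Hu' Hw; rewrite /dotgrad mulr_sumr -big_split/=; apply: eq_bigr => i _.
by rewrite grad_linear// (ip_linear ipL2)//; exact: L2_grad.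
Qed.

Lemma dotgrad_conj u w : H1 u -> H1 w -> dotgrad w u = conjc (dotgrad u w).
Proof.
move=> Hu Hw; rewrite /dotgrad rmorph_sum/=; apply: eq_bigr => i _.
by rewrite (ip_conj ipL2)//; exact: L2_grad.
Qed.

Lemma Re_sum (I : Type) (r : seq I) (F : I -> R[i]) :
  Re (\sum_(i <- r) F i) = \sum_(i <- r) Re (F i).
Proof. by elim/big_rec2: _ => // i x y _ <-; rewrite ReD. Qed.

Lemma Re_dotgrad u : H1 u -> Re (dotgrad u u) = \sum_(i < n) nrm dotL2 (grad u i) ^+ 2.
Proof.
move=> Hu; rewrite /dotgrad Re_sum; apply: eq_bigr => i _.
by rewrite (nrm_sqr ipL2)//; exact: L2_grad.
Qed.

Lemma dotgrad_ge0 u : H1 u -> 0 <= Re (dotgrad u u).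
Proof. by move=> Hu; rewrite Re_dotgrad// sumr_ge0// => i _; rewrite sqr_ge0. Qed.

Lemma nrm_grad_le u i : H1 u -> nrm dotL2 (grad u i) <= nrm dotgrad u.
Proof.
move=> Hu; suff : nrm dotL2 (grad u i) ^+ 2 <= nrm dotgrad u ^+ 2.
  by rewrite ler_pXn2r ?nnegrE ?nrm_ge0.
rewrite [leRHS]sqr_sqrtr; last exact: dotgrad_ge0.
by rewrite /rdot Re_dotgrad// (bigD1 i)//= lerDl sumr_ge0// => j _; rewrite sqr_ge0.
Qed.

Lemma nrm_dotgrad_le u (e : R) : H1 u -> 0 <= e ->
  (forall i, nrm dotL2 (grad u i) <= e) -> nrm dotgrad u <= n%:R * e.
Proof.
move=> Hu e0 ue; suff : nrm dotgrad u ^+ 2 <= (n%:R * e) ^+ 2.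
  by rewrite ler_pXn2r ?nnegrE ?nrm_ge0// mulr_ge0.
rewrite [leLHS]sqr_sqrtr; last exact: dotgrad_ge0.
rewrite /rdot Re_dotgrad// (@le_trans _ _ (\sum_(i < n) e ^+ 2))//.
  by apply: ler_sum => i _; rewrite ler_pXn2r ?nnegrE ?nrm_ge0.
rewrite sumr_const card_ord -[leLHS]mulr_natl exprMn ler_wpM2r ?sqr_ge0//.
by rewrite -natrX ler_nat -mulnn; case: (n) => // m; exact: leq_pmulr.
Qed.

Lemma normH1_le u (e : R) : H1 u -> normH1 u < e ->
  nrm dotL2 u < e /\ nrm dotgrad u < e.
Proof.
move=> Hu ue; have Lu := H1_L2 Hu.
have s1 := ip_ge0 ipL2 Lu; have s2 := dotgrad_ge0 Hu.
by split; apply: le_lt_trans ue; rewrite /normH1 ReD ler_sqrt ?addr_ge0// ?lerDl// lerDr.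
Qed.

Lemma normH1_leD u : H1 u -> normH1 u <= nrm dotL2 u + nrm dotgrad u.
Proof.
move=> Hu; have Lu := H1_L2 Hu.
have s1 := ip_ge0 ipL2 Lu; have s2 := dotgrad_ge0 Hu.
suff : normH1 u ^+ 2 <= (nrm dotL2 u + nrm dotgrad u) ^+ 2.
  by rewrite ler_pXn2r ?nnegrE ?sqrtr_ge0 ?addr_ge0 ?nrm_ge0.
rewrite /normH1 ReD sqr_sqrtr ?addr_ge0// sqrrD (sqr_sqrtr s1) (sqr_sqrtr s2).
by rewrite /rdot lerD2r lerDl mulrn_wge0// mulr_ge0 ?nrm_ge0.
Qed.

Lemma H10_H1 u : H10 u -> H1 u. Proof. by case. Qed.

Lemma H10_approx u (e : R) : H10 u -> 0 < e ->
  exists2 phi, tst phi & nrm dotL2 (u - cls phi) < e /\ nrm dotgrad (u - cls phi) < e.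
Proof.
move=> [Hu h] e0; have [phi tp up] := h e e0; exists phi => //.
by apply: normH1_le => //; apply: H1_memB => //; exact: H1_test.
Qed.

Lemma H10_intro u : H1 u -> (forall e : R, 0 < e ->
  exists2 phi, tst phi & nrm dotL2 (u - cls phi) < e /\ nrm dotgrad (u - cls phi) < e) ->
  H10 u.
Proof.
move=> Hu h; split=> // e e0; have e20 : 0 < e / 2 by rewrite divr_gt0.
have [phi tp [h1 h2]] := h _ e20; exists phi => //.
have Hd : H1 (u - cls phi) by apply: H1_memB => //; exact: H1_test.
apply: le_lt_trans (normH1_leD Hd) _; lra.
Qed.

Lemma H10_test phi : tst phi -> H10 (cls phi).
Proof.
move=> tp; have Hp := H1_test tp; apply: H10_intro => // e e0; exists phi => //; rewrite subrr.
rewrite (nrm0 ipL2) /nrm /rdot /dotgrad big1 ?sqrtr0// => i _.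
by rewrite grad0 (dot0l ipL2)//; exact: L2_0.
Qed.

Lemma H10_0 : H10 0.
Proof.
by have := H10_test (test_function0 Omega); rewrite aeclass0.
Qed.

End Sobolev.

(** The inequality behind the passage from a test function phi to [u] in the Poincare inequality:
    [a] and [b] are the norms of [u] and phi, [c] that of [u - phi]; [p], [g] and [r] are those of
    the partial derivatives of [u], phi and their difference; [G] and [t] are the gradient norms of
    [u] and [u - phi], and [d] is the precision. *)
Lemma Poincare_arith {R : realType} (C a b c g p r t G d : R) : 0 <= C ->
  a <= b + c -> c <= d -> b <= C * g -> g <= p + r -> p <= G -> r <= t -> t <= d ->
  a <= C * G + (C + 1) * d.
Proof.
move=> C0 h1 h2 h3 h4 h5 h6 h7.
have := ler_wpM2l C0 (_ : g <= G + d); rewrite mulrDr => h.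
have : C * g <= C * G + C * d by apply: h; lra.
by rewrite mulrDl; lra.
Qed.

(** * H10 with the gradient inner product *)

Section H10_space.
Context {R : realType} {n : nat}.
Variable Omega : set 'rV[R]_n.
Hypothesis oOmega : open Omega.
Hypothesis bOmega : bounded_set Omega.
Local Notation aefun := (aefun Omega).
Local Notation Re := (@complex.Re R).
Local Notation Im := (@complex.Im R).
Local Notation L2 := (@L2 R n Omega).
Local Notation H1 := (@H1 R n Omega).
Local Notation H10 := (@H10 R n Omega).
Local Notation dotL2 := (@dotL2 R n Omega).
Local Notation dotgrad := (@dotgrad R n Omega).
Local Notation grad := (@grad R n Omega).
Local Notation cls := (aeclass Omega).
Local Notation ipL2 := (dotL2_inner_product oOmega).
Local Notation tst := (test_function Omega).

Lemma H10_L2 u : H10 u -> L2 u. Proof. by move=> /H10_H1 /H1_L2. Qed.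

Lemma H10_L2_grad u i : H10 u -> L2 (grad u i).
Proof. by move=> /H10_H1; exact: L2_grad. Qed.

(** The inner product whose norm is [normH1] by conversion, so that the membership condition of
    [H10] can be read in terms of [nrm]. *)
Definition dotH1 (u w : aefun) : R[i] := dotL2 u w + dotgrad u w.

Lemma dotH1_inner_product : inner_product_on H1 dotH1.
Proof.
split.
- exact: H1_0.
- exact: H1_memP.
- move=> a x y z Hx Hy Hz; rewrite /dotH1 dotgrad_linear//.
  by rewrite (ip_linear ipL2 a (H1_L2 Hx) (H1_L2 Hy) (H1_L2 Hz)) mulrDr addrACA.
- move=> x y Hx Hy; rewrite /dotH1 rmorphD /= (dotgrad_conj oOmega bOmega Hx Hy).
  by rewrite (ip_conj ipL2 (H1_L2 Hx) (H1_L2 Hy)).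
- move=> x Hx; rewrite ReD addr_ge0//; first exact: ip_ge0 ipL2 _ (H1_L2 Hx).
  exact: dotgrad_ge0.
- move=> x Hx /eqP; rewrite ReD paddr_eq0; first last.
  + exact: dotgrad_ge0.
  + exact: ip_ge0 ipL2 _ (H1_L2 Hx).
  by move=> /andP[/eqP x0 _]; exact: (ip_eq0 ipL2 (H1_L2 Hx) x0).
Qed.
Local Notation ipH1 := dotH1_inner_product.

Lemma H10_approxH1 u (e : R) : H10 u -> 0 < e ->
  exists2 phi, tst phi & nrm dotH1 (u - cls phi) < e.
Proof. by move=> [Hu h] /h. Qed.

Lemma H10_introH1 u : H1 u -> (forall e : R, 0 < e ->
  exists2 phi, tst phi & nrm dotH1 (u - cls phi) < e) -> H10 u.
Proof. by []. Qed.

Lemma H10_memP a u w : H10 u -> H10 w -> H10 (a *: u + w).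
Proof.
move=> Hu Hw; have [Hu1 Hw1] := (H10_H1 Hu, H10_H1 Hw).
pose s := Num.sqrt (Re a ^+ 2 + Im a ^+ 2).
have s0 : 0 <= s by exact: sqrtr_ge0.
apply: H10_introH1 => [|e e0]; first exact: H1_memP.
have d0 : 0 < e / (s + 1) by rewrite divr_gt0// ltr_wpDl.
have [phi tp p1] := H10_approxH1 Hu d0; have [psi tq q1] := H10_approxH1 Hw d0.
exists (fun x => a * phi x + psi x); first exact: test_functionZD.
rewrite (aeclassZD oOmega a (test_function_csq oOmega tp) (test_function_csq oOmega tq)).
have Hp := H1_test oOmega tp; have Hq := H1_test oOmega tq.
have -> : a *: u + w - (a *: cls phi + cls psi) = a *: (u - cls phi) + (w - cls psi).
  by rewrite scalerBr opprD addrACA.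
have HB1 := ip_memB ipH1 Hu1 Hp; have HB2 := ip_memB ipH1 Hw1 Hq.
apply: le_lt_trans (nrmD ipH1 (ip_memZ ipH1 a HB1) HB2) _.
rewrite (nrmZ ipH1)// -/s (_ : e = s * (e / (s + 1)) + e / (s + 1)).
  exact: ler_ltD (ler_wpM2l s0 (ltW p1)) q1.
by rewrite -[X in _ + X]mul1r -mulrDl mulrC divfK// gt_eqF// ltr_wpDl.
Qed.

Lemma H10_closed u l : (forall k, H10 (u k)) -> H1 l -> ncvg dotH1 u l -> H10 l.
Proof.
move=> Hu Hl ul; apply: H10_introH1 => // e e0; have e20 : 0 < e / 2 by rewrite divr_gt0.
have [N /(_ N (leqnn N)) hN] := ul _ e20.
have [phi tp p1] := H10_approxH1 (Hu N) e20; exists phi => //.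
have Hp := H1_test oOmega tp; have HuN := H10_H1 (Hu N).
apply: le_lt_trans (nrm_distD ipH1 Hl Hp HuN) _.
by rewrite [ltRHS](splitr e) (nrmBC ipH1 Hl HuN); exact: ltrD hN p1.
Qed.

(** The functions and each of their partial derivatives converge in [L2]; [ncvg_dotN] shows that the
    limits of the derivatives are the weak derivatives of the limit. *)
Lemma dotH1_complete : complete_on H1 dotH1.
Proof.
move=> u Hu cu.
have cL : ncauchy dotL2 u.
  move=> e e0; have [N hN] := cu e e0; exists N => p q Np Nq.
  by have [] := normH1_le oOmega bOmega (ip_memB ipH1 (Hu p) (Hu q)) (hN p q Np Nq).
have cg i : ncauchy dotL2 (fun k => grad (u k) i).
  move=> e e0; have [N hN] := cu e e0; exists N => p q Np Nq.
  have HB := ip_memB ipH1 (Hu p) (Hu q).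
  have [_] := normH1_le oOmega bOmega HB (hN p q Np Nq).
  by rewrite -gradB//; apply: le_lt_trans; exact: nrm_grad_le.
have Lu k := H1_L2 (Hu k); have Lgu i k := L2_grad oOmega bOmega i (Hu k).
have [l Ll ul] := L2_complete oOmega Lu cL.
have /choice[g hg] : forall i, exists g, L2 g /\ ncvg dotL2 (fun k => grad (u k) i) g.
  by move=> i; have [g Lg ug] := L2_complete oOmega (Lgu i) (cg i); exists g.
have Lg i : L2 (g i) by have [] := hg i.
have ug i : ncvg dotL2 (fun k => grad (u k) i) (g i) by have [] := hg i.
have wg i : weak_partial i l (g i).
  apply/(weak_partialP oOmega i Ll (Lg i)) => phi tp.
  have Lp := L2_test oOmega tp; have Ldp := L2_test_partial oOmega i tp.
  apply: (ncvg_dotN ipL2 Lu Ll (Lgu i) (Lg i) Ldp Lp ul (ug i)) => k.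
  exact: (weak_partialP oOmega i (Lu k) (Lgu i k)).1 (weak_partial_grad oOmega bOmega i (Hu k)) phi tp.
have Hl : H1 l by split=> // i; exists (g i).
exists l => // e e0; have n1 : 0 < n%:R + 1 :> R by rewrite ltr_wpDl.
have d0 : 0 < e / (n%:R + 1) by rewrite divr_gt0.
have [M hM] := ul _ d0.
have /choice[N hN] : forall i, exists N : nat, forall k, (N <= k)%N ->
    nrm dotL2 (grad (u k) i - g i) < e / (n%:R + 1).
  by move=> i; exact: ug.
exists (maxn M (\max_i N i))%N => k; rewrite geq_max => /andP[kM kN].
have HB := ip_memB ipH1 (Hu k) Hl.
apply: le_lt_trans (normH1_leD oOmega bOmega HB) _.
have gle : nrm dotgrad (u k - l) <= n%:R * (e / (n%:R + 1)).
  apply: nrm_dotgrad_le => //; first exact: ltW.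
  move=> i; rewrite gradB// (grad_uniq oOmega bOmega Ll (Lg i) (wg i)).
  exact/ltW/hN/(leq_trans _ kN)/leq_bigmax.
rewrite -[e](divfK (lt0r_neq0 n1)) mulrDr mulr1 addrC mulrC.
exact: ler_ltD gle (hM k kM).
Qed.

(** The inequality for test functions passes to their closure. The index [i] is the direction of
    integration and witnesses that the dimension is positive. *)
Lemma Poincare (i : 'I_n) : exists2 C : R, 0 <= C &
  forall u, H10 u -> nrm dotL2 u <= C * nrm dotgrad u.
Proof.
have [C C0 hC] := test_function_Poincare oOmega i bOmega; exists C => // u Hu.
apply/ler_addgt0Pl => e e0.
have C1 : 0 < C + 1 by rewrite ltr_wpDl.
have d0 : 0 < e / (C + 1) by rewrite divr_gt0.
have [phi tp [p1 p2]] := H10_approx oOmega bOmega Hu d0.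
have Hu1 := H10_H1 Hu; have Hp := H1_test oOmega tp.
have HB := H1_memB oOmega bOmega Hu1 Hp.
have Lgp := L2_grad oOmega bOmega i Hp; have Lgu := L2_grad oOmega bOmega i Hu1.
have h1 := nrm_lerB ipL2 (H1_L2 Hu1) (H1_L2 Hp).
have h2 := nrm_lerB ipL2 Lgp Lgu.
have h3 := nrm_grad_le oOmega bOmega i HB.
rewrite gradB// (nrmBC ipL2 Lgu Lgp) in h3.
have h4 := hC phi tp; rewrite -(grad_test oOmega bOmega i tp) in h4.
have h5 := nrm_grad_le oOmega bOmega i Hu1.
rewrite -[e](divfK (lt0r_neq0 C1)) mulrC [leRHS]addrC.
exact: (Poincare_arith C0 h1 (ltW p1) h4 h2 h5 h3 (ltW p2)).
Qed.

Lemma dotgrad_inner_product (i : 'I_n) : inner_product_on H10 dotgrad.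
Proof.
split.
- exact: H10_0.
- exact: H10_memP.
- by move=> a x y z /H10_H1 Hx /H10_H1 Hy /H10_H1 Hz; exact: dotgrad_linear.
- by move=> x y /H10_H1 Hx /H10_H1 Hy; exact: dotgrad_conj.
- by move=> x /H10_H1; exact: dotgrad_ge0.
- move=> u Hu u0; have [C C0 hC] := Poincare i.
  apply: (nrm_eq0 ipL2 (H10_L2 Hu)); apply/eqP; rewrite eq_le nrm_ge0 andbT.
  by apply: le_trans (hC u Hu) _; rewrite /nrm /rdot u0 sqrtr0 mulr0.
Qed.

(** On [H10] the gradient norm and the H1 norm are equivalent by the Poincare inequality, and [H10]
    is closed in the complete space [H1]. *)
Lemma dotgrad_complete (i0 : 'I_n) : complete_on H10 dotgrad.
Proof.
move=> u Hu cu; have [C C0 hC] := Poincare i0.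
have ipG := dotgrad_inner_product i0.
have Hu1 k := H10_H1 (Hu k).
have cH : ncauchy dotH1 u.
  move=> e e0; have C1 : 0 < C + 1 by rewrite ltr_wpDl.
  have d0 : 0 < e / (C + 1) by rewrite divr_gt0.
  have [N hN] := cu _ d0; exists N => p q Np Nq.
  have HB := ip_memB ipG (Hu p) (Hu q).
  apply: le_lt_trans (normH1_leD oOmega bOmega (H10_H1 HB)) _.
  apply: (@le_lt_trans _ _ ((C + 1) * nrm dotgrad (u p - u q))).
    by rewrite mulrDl mul1r lerD2r hC.
  by rewrite mulrC -ltr_pdivlMr// hN.
have [l Hl ul] := dotH1_complete Hu1 cH.
exists l; first exact: H10_closed ul.
move=> e e0; have [N hN] := ul e e0; exists N => k Nk.
by have [] := normH1_le oOmega bOmega (ip_memB ipH1 (Hu1 k) Hl) (hN k Nk).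
Qed.

End H10_space.

Lemma add_eq_subD {V : zmodType} (a b c d x : V) : b + d = 0 -> x = c - d -> a + c = a - b + x.
Proof. by move=> bd ->; rewrite addrACA -opprD bd subr0. Qed.

(** * Weak divergence and Green's formula *)

Section Green.
Context {R : realType} {n : nat}.
Variable Omega : set 'rV[R]_n.
Hypothesis oOmega : open Omega.
Hypothesis bOmega : bounded_set Omega.
Local Notation aefun := (aefun Omega).
Local Notation Re := (@complex.Re R).
Local Notation Im := (@complex.Im R).
Local Notation L2 := (@L2 R n Omega).
Local Notation H1 := (@H1 R n Omega).
Local Notation H10 := (@H10 R n Omega).
Local Notation dotL2 := (@dotL2 R n Omega).
Local Notation dotgrad := (@dotgrad R n Omega).
Local Notation grad := (@grad R n Omega).
Local Notation cls := (aeclass Omega).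
Local Notation ipL2 := (dotL2_inner_product oOmega).
Local Notation tst := (test_function Omega).

Lemma rdotE (E : lmodType R[i]) (dot : E -> E -> R[i]) x y : rdot dot x y = Re (dot x y).
Proof. by []. Qed.

Lemma dotgradE u w : dotgrad u w = \sum_(i < n) dotL2 (grad u i) (grad w i).
Proof. by []. Qed.

#[local] Opaque rdot nrm Defs.dotL2 Defs.dotgrad Defs.grad.
Implicit Types (p q : 'I_n -> aefun) (f g u w : aefun).

Definition rdotv p q : R := \sum_(i < n) rdot dotL2 (p i) (q i).

Lemma rdotv_grad u w : rdotv (grad u) (grad w) = rdot dotgrad u w.
Proof. by rewrite rdotE dotgradE Re_sum. Qed.

Lemma rdotv_le p w : (forall i, L2 (p i)) -> H1 w ->
  `|rdotv p (grad w)| <= (\sum_(i < n) nrm dotL2 (p i)) * nrm dotgrad w.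
Proof.
move=> Lp Hw; rewrite mulr_suml; apply: le_trans (ler_norm_sum _ _ _) _.
apply: ler_sum => i _; have Lg := L2_grad oOmega bOmega i Hw.
apply: le_trans (rdot_le ipL2 (Lp i) Lg) _.
by apply: ler_wpM2l; [exact: nrm_ge0|exact: nrm_grad_le].
Qed.

(** For a test function this is the definition of the weak divergence. For [w] in [H10], the defect
    of the formula is the same at [w] and at [w - cls phi], where it is at most the norms of [p] and
    [f] times the approximation error. *)
Lemma Green p f w : (forall i, L2 (p i)) -> L2 f -> weak_div p f -> H10 w ->
  rdotv p (grad w) = - rdot dotL2 f w.
Proof.
move=> Lp Lf /(weak_divP oOmega Lp Lf) pf Hw; have Hw1 := H10_H1 Hw.
apply/eqP; rewrite -subr_eq0 opprK -normr_le0; apply/ler_addgt0Pl => e e0; rewrite addr0.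
set s := \sum_(i < n) nrm dotL2 (p i).
have s0 : 0 <= s by apply: sumr_ge0 => i _; exact: nrm_ge0.
pose q := s + nrm dotL2 f + 1.
have q0 : 0 < q by rewrite ltr_wpDl// addr_ge0// nrm_ge0.
have d0 : 0 < e / q by rewrite divr_gt0.
have [phi tp [p1 p2]] := H10_approx oOmega bOmega Hw d0.
have Hp := H1_test oOmega tp; have HB := H1_memB oOmega bOmega Hw1 Hp.
have E : rdotv p (grad (cls phi)) + rdot dotL2 f (cls phi) = 0.
  rewrite rdotE -[Re _]opprK -ReN -pf// Re_sum /rdotv -sumrB big1// => i _.
  by rewrite grad_test// rdotE subrr.
have -> : rdotv p (grad w) + rdot dotL2 f w =
    rdotv p (grad (w - cls phi)) + rdot dotL2 f (w - cls phi).
  have -> : rdotv p (grad (w - cls phi)) = rdotv p (grad w) - rdotv p (grad (cls phi)).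
    rewrite /rdotv -sumrB; apply: eq_bigr => i _; rewrite gradB//.
    by rewrite (rdotBr ipL2 (L2_grad oOmega bOmega i Hw1) (L2_grad oOmega bOmega i Hp) (Lp i)).
  have e2 := rdotBr ipL2 (H1_L2 Hw1) (H1_L2 Hp) Lf.
  exact: add_eq_subD E e2.
apply: le_trans (ler_normD _ _) _.
apply: (@le_trans _ _ (s * (e / q) + nrm dotL2 f * (e / q))).
  apply: lerD.
    exact: le_trans (rdotv_le Lp HB) (ler_wpM2l s0 (ltW p2)).
  exact: le_trans (rdot_le ipL2 Lf (H1_L2 HB)) (ler_wpM2l (nrm_ge0 dotL2 _) (ltW p1)).
rewrite -mulrDl -[leRHS](divfK (lt0r_neq0 q0)) mulrC ler_wpM2l ?(ltW d0)//.
by rewrite /q lerDl.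
Qed.

Lemma rdot_imul x y : L2 x -> L2 y -> rdot dotL2 x ('i *: y) = Im (dotL2 x y).
Proof.
move=> Lx Ly; rewrite (rdotC ipL2 Lx (ip_memZ ipL2 'i Ly)) rdotE (dotZl ipL2)//.
by rewrite (ip_conj ipL2 Lx Ly); case: (dotL2 x y) => a b /=; rewrite mul0r mul1r sub0r opprK.
Qed.

(* Real parts suffice because [H10] is stable under multiplication by ['i]. *)
Lemma weak_div_real p f : (forall i, L2 (p i)) -> L2 f ->
  (forall w, H10 w -> rdotv p (grad w) = - rdot dotL2 f w) -> weak_div p f.
Proof.
move=> Lp Lf H; apply/(weak_divP oOmega Lp Lf) => phi tp.
have Hp := H10_test oOmega bOmega tp; have Lc := L2_test oOmega tp.
have Hip : H10 ('i *: cls phi).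
  by rewrite -[_ *: _]addr0; exact: (H10_memP oOmega bOmega 'i Hp (H10_0 oOmega bOmega)).
apply: complex_eqP.
  have := H _ Hp; rewrite rdotE ReN => <-; rewrite Re_sum.
  by apply: eq_bigr => i _; rewrite grad_test.
have ImN (z : R[i]) : Im (- z) = - Im z by case: z.
have ImD (z w : R[i]) : Im (z + w) = Im z + Im w by case: z; case: w.
rewrite ImN -(rdot_imul Lf Lc) -(H _ Hip) (big_morph Im ImD (erefl : Im 0 = 0)).
apply: eq_bigr => i _; have Ld := L2_test_partial oOmega i tp.
have gi : grad ('i *: cls phi) i = 'i *: cls (cpartial i phi).
  have := grad_linear oOmega bOmega 'i i (H10_H1 Hp) (H1_0 oOmega).
  by rewrite addr0 (grad0 oOmega bOmega) addr0 (grad_test oOmega bOmega i tp).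
by rewrite gi (rdot_imul (Lp i) Ld).
Qed.

Lemma weak_div_uniq p f g : (forall i, L2 (p i)) -> L2 f -> L2 g ->
  weak_div p f -> weak_div p g -> f = g.
Proof.
move=> Lp Lf Lg /(weak_divP oOmega Lp Lf) H /(weak_divP oOmega Lp Lg) H'.
apply/eqP; rewrite -subr_eq0; apply/eqP.
apply: (test_functions_dense oOmega bOmega); first exact: (ip_memB ipL2).
move=> phi tp; have Lph := L2_test oOmega tp.
by rewrite addrC -scaleN1r (ip_linear ipL2)// mulN1r -(H' _ tp) (H _ tp) addNr.
Qed.

Lemma divergence_uniq p f : (forall i, L2 (p i)) -> L2 f -> weak_div p f -> divergence p = f.
Proof.
move=> Lp Lf wf; have [Lh wh] : L2 (divergence p) /\ weak_div p (divergence p).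
  exact: (@xgetPex _ 0 [set g | L2 g /\ weak_div p g] (ex_intro _ f (conj Lf wf))).
exact: weak_div_uniq wh wf.
Qed.

Lemma divergenceP p : div_in_L2 p -> L2 (divergence p) /\ weak_div p (divergence p).
Proof.
move=> [f Lf wf].
exact: (@xgetPex _ 0 [set g | L2 g /\ weak_div p g] (ex_intro _ f (conj Lf wf))).
Qed.

Lemma weak_div_linear a p q f g : (forall i, L2 (p i)) -> (forall i, L2 (q i)) -> L2 f -> L2 g ->
  weak_div p f -> weak_div q g -> weak_div (fun i => a *: p i + q i) (a *: f + g).
Proof.
move=> Lp Lq Lf Lg /(weak_divP oOmega Lp Lf) H /(weak_divP oOmega Lq Lg) H'.
have Lpq i : L2 (a *: p i + q i) := L2_memP oOmega a (Lp i) (Lq i).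
apply/(weak_divP oOmega Lpq (L2_memP oOmega a Lf Lg)) => phi tp.
have Lph := L2_test oOmega tp.
rewrite (ip_linear ipL2)// opprD -mulrN -H// -H'// mulr_sumr -big_split/=.
by apply: eq_bigr => i _; exact: (ip_linear ipL2 a (Lp i) (Lq i) (L2_test_partial oOmega i tp)).
Qed.

End Green.

(** * Generation of contraction semigroups *)

Section one_sided_limits.
Context {R : realType}.

(** The filters occurring in the definitions of continuity, generator and derivative are replaced
    here once and for all by epsilon-delta statements; [G] will be an expression built from norms,
    hence nonnegative. *)
Lemma within_cvg0 (B : set R) (G : R -> R) (t : R) : (forall s, 0 <= G s) ->
  G s @[s --> within B (nbhs t)] --> 0 <->
  forall e : R, 0 < e -> exists2 d : R, 0 < d & forall s, B s -> `|s - t| < d -> G s < e.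
Proof.
move=> G0; split.
  move=> /cvgrPdist_lt h e /h; rewrite near_withinE => /nbhs_ballP[d /= d0 hd].
  exists d => // s Bs sd; have := hd s; rewrite /ball /= distrC => /(_ sd Bs).
  by rewrite sub0r normrN ger0_norm.
move=> h; apply/cvgrPdist_lt => e /h[d d0 hd]; rewrite near_withinE.
apply/nbhs_ballP; exists d => //= s; rewrite /ball /= distrC => sd Bs.
by rewrite sub0r normrN ger0_norm// hd.
Qed.

Lemma at_right_cvg0 (G : R -> R) : (forall s, 0 <= G s) ->
  G s @[s --> 0^'+] --> 0 <->
  forall e : R, 0 < e -> exists2 d : R, 0 < d & forall s, 0 < s < d -> G s < e.
Proof.
move=> G0; split.
  move=> /(within_cvg0 _ _ G0) h e /h[d d0 hd]; exists d => // s /andP[s0 sd].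
  by apply: hd => //; rewrite subr0 gtr0_norm.
move=> h; apply/(within_cvg0 _ _ G0) => e /h[d d0 hd]; exists d => // s /= s0.
by rewrite subr0 gtr0_norm// => sd; apply: hd; rewrite s0.
Qed.

Lemma within_dnbhs_cvg0 (B : set R) (G : R -> R) (t : R) : (forall s, 0 <= G s) ->
  G s @[s --> within B t^'] --> 0 <->
  forall e : R, 0 < e -> exists2 d : R, 0 < d &
    forall s, B s -> s != t -> `|s - t| < d -> G s < e.
Proof.
move=> G0; split.
  move=> /cvgrPdist_lt h e /h; rewrite !near_withinE => /nbhs_ballP[d /= d0 hd].
  exists d => // s Bs st sd; have := hd s; rewrite /ball /= distrC => /(_ sd st Bs).
  by rewrite sub0r normrN ger0_norm.
move=> h; apply/cvgrPdist_lt => e /h[d d0 hd]; rewrite !near_withinE.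
apply/nbhs_ballP; exists d => //= s; rewrite /ball /= distrC => sd st Bs.
by rewrite sub0r normrN ger0_norm// hd.
Qed.

End one_sided_limits.

Lemma subrACA {V : zmodType} (a b c d : V) : (a - b) - (c - d) = (a - c) - (b - d).
Proof. by rewrite !opprD !opprK addrACA. Qed.

Section generation.
Context {R : realType} {E : lmodType R[i]}.
Variables (X : set E) (dot : E -> E -> R[i]).
Hypothesis ip : inner_product_on X dot.
Hypothesis cX : complete_on X dot.
Local Notation rdot := (rdot dot).
Local Notation nrm := (nrm dot).

(** Density of [D] is not recorded as a field: it is a consequence, in a Hilbert space, of
    dissipativity together with the range condition. *)
Record dissipative_on (D : set E) (A : E -> E) : Prop := DissipativeOn {
  dis_sub : forall x, D x -> X x;
  dis_mem0 : D 0;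
  dis_memP : forall a x y, D x -> D y -> D (a *: x + y);
  dis_range : forall x, D x -> X (A x);
  dis_linear : forall a x y, D x -> D y -> A (a *: x + y) = a *: A x + A y;
  dis_le0 : forall x, D x -> rdot (A x) x <= 0 }.

Variables (D : set E) (A : E -> E).
Hypothesis dis : dissipative_on D A.
Implicit Types (x y z : E) (h k : R).

Lemma dis_memZ a x : D x -> D (a *: x).
Proof. by move=> Dx; rewrite -[_ *: _]addr0; exact: (dis_memP dis a Dx (dis_mem0 dis)). Qed.

Lemma dis_memB x y : D x -> D y -> D (x - y).
Proof. by move=> Dx Dy; rewrite addrC -scaleN1r; exact: (dis_memP dis). Qed.

Lemma disD x y : D x -> D y -> A (x + y) = A x + A y.
Proof. by move=> Dx Dy; rewrite -{1}[x]scale1r (dis_linear dis)// scale1r. Qed.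

Lemma dis0 : A 0 = 0.
Proof.
have D0 := dis_mem0 dis; have := disD D0 D0; rewrite addr0 => /eqP.
by rewrite -subr_eq0 opprD addrA subrr sub0r oppr_eq0 => /eqP.
Qed.

Lemma disZ a x : D x -> A (a *: x) = a *: A x.
Proof.
move=> Dx; have := dis_linear dis a Dx (dis_mem0 dis).
by rewrite dis0 !addr0.
Qed.

Lemma disB x y : D x -> D y -> A (x - y) = A x - A y.
Proof. by move=> Dx Dy; rewrite addrC -scaleN1r (dis_linear dis)// scaleN1r addrC. Qed.

(** By dissipativity the squared norm of [x] is at most the real inner product of [x - h A x] with
    [x]; Cauchy-Schwarz then allows one factor [nrm x] to be cancelled. *)
Lemma nrm_sub_dis_ge h x : 0 <= h -> D x -> nrm x <= nrm (x - h%:C *: A x).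
Proof.
move=> h0 Dx; have Xx := dis_sub dis Dx; have XA := dis_range dis Dx.
have XhA := ip_memZ ip h%:C XA; have Xd := ip_memB ip Xx XhA.
have [-> |n0] := eqVneq (nrm x) 0; first exact: nrm_ge0.
have np : 0 < nrm x by rewrite lt0r n0 nrm_ge0.
rewrite -(ler_pM2r np) -expr2 (nrm_sqr ip)//.
apply: le_trans (le_trans (ler_norm _) (rdot_le ip Xd Xx)).
rewrite (rdotBl ip)// (rdotZl ip)// lerDl oppr_ge0 mulr_ge0_le0//.
exact: (dis_le0 dis).
Qed.

Definition solvable (l : R) := forall y, X y -> exists2 x, D x & l%:C *: x - A x = y.

Lemma geometric_ncauchy (u : nat -> E) (c : R) : (forall n, X (u n)) ->
  (forall n, nrm (u n.+1 - u n) <= c * 2^-1 ^+ n) -> ncauchy dot u.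
Proof.
move=> Xu uc.
have c0 : 0 <= c by have := uc 0%N; rewrite expr0 mulr1; apply: le_trans; exact: nrm_ge0.
have tail n m : nrm (u (n + m)%N - u n) <= 2 * c * 2^-1 ^+ n - 2 * c * 2^-1 ^+ (n + m).
  elim: m => [|m IHm]; first by rewrite addn0 !subrr (nrm0 ip).
  rewrite addnS; apply: le_trans (nrm_distD ip (Xu _) (Xu n) (Xu (n + m)%N)) _.
  apply: le_trans (lerD (uc (n + m)%N) IHm) _.
  rewrite exprS le_eqVlt; apply/orP; left; apply/eqP; by field.
move=> e e0; have d0 : 0 < e / (4 * c + 1) by rewrite divr_gt0// ltr_wpDl// mulr_ge0.
have [N hN] := half_pow_lt d0; exists N => p q Np Nq.
have c1 : 0 < 4 * c + 1 by rewrite ltr_wpDl// mulr_ge0.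
have tailN p' : (N <= p')%N -> nrm (u p' - u N) <= 2 * c * 2^-1 ^+ N.
  move=> Np'; rewrite -(subnKC Np'); apply: le_trans (tail N _) _.
  by rewrite gerBl mulr_ge0 ?exprn_ge0 ?mulr_ge0.
apply: le_lt_trans (nrm_distD ip (Xu p) (Xu q) (Xu N)) _.
rewrite (nrmBC ip (Xu N) (Xu q)).
apply: le_lt_trans (lerD (tailN p Np) (tailN q Nq)) _.
have := hN N (leqnn N); rewrite ltr_pdivlMr//.
have : 0 <= 2^-1 ^+ N :> R by rewrite exprn_ge0.
move: (2^-1 ^+ N) => w; nra.
Qed.

(** The equation for [l] is rewritten as the fixed point problem [x = S (y + (l0 - l) x)], where [S]
    solves the equation for [l0]. By [est] it contracts by a factor 1/2. The limit of the iterates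
    lies in [D] because it is itself a value of [S]. *)
Lemma solvable_near (l0 l K : R) : 0 <= K ->
  (forall x, D x -> nrm x <= K * nrm (l0%:C *: x - A x)) ->
  solvable l0 -> `|l - l0| * K <= 2^-1 -> solvable l.
Proof.
move=> K0 est s0 lK y Xy.
have /choice[S hS] : forall z, exists x, X z -> D x /\ l0%:C *: x - A x = z.
  move=> z; have [Xz|nXz] := pselect (X z); last by exists 0.
  by have [x Dx xz] := s0 z Xz; exists x.
pose F z := S (y + (l0 - l)%:C *: z).
have Xa z : X z -> X (y + (l0 - l)%:C *: z).
  by move=> Xz; apply: (ip_memD ip) => //; exact: (ip_memZ ip).
have DF z : X z -> D (F z) by move=> Xz; have [] := hS _ (Xa z Xz).
have FE z : X z -> l0%:C *: F z - A (F z) = y + (l0 - l)%:C *: z.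
  by move=> Xz; have [] := hS _ (Xa z Xz).
have Flip z w : X z -> X w -> nrm (F z - F w) <= 2^-1 * nrm (z - w).
  move=> Xz Xw; have DB := dis_memB (DF z Xz) (DF w Xw).
  apply: le_trans (est _ DB) _.
  have -> : l0%:C *: (F z - F w) - A (F z - F w) = (l0 - l)%:C *: (z - w).
    rewrite disB; [|exact: DF|exact: DF].
    by rewrite scalerBr subrACA !FE// scalerBr opprD addrACA subrr add0r.
  rewrite (nrmZr ip); last exact: (ip_memB ip).
  by rewrite mulrA ler_wpM2r ?nrm_ge0// mulrC distrC.
pose u n := iter n F 0.
have Xu n : X (u n) by elim: n => [|n IHn] /=; [exact: (ip_mem0 ip)|exact: (dis_sub dis (DF _ IHn))].
have uc n : nrm (u n.+1 - u n) <= nrm (u 1%N) * 2^-1 ^+ n.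
  elim: n => [|n IHn]; first by rewrite expr0 mulr1 subr0.
  apply: le_trans (Flip _ _ (Xu n.+1) (Xu n)) _.
  by rewrite exprS mulrCA ler_wpM2l.
have [x Xx ux] := cX Xu (geometric_ncauchy Xu uc).
have Fx : F x = x.
  have XF := dis_sub dis (DF _ Xx).
  apply: (ncvg_unique ip (fun n => Xu n.+1) XF Xx).
    move=> e e0; have e2 : 0 < e * 2 by rewrite mulr_gt0.
    have [N hN] := ux _ e2; exists N => n Nn.
    apply: le_lt_trans (Flip _ _ (Xu n) Xx) _; have := hN n Nn; lra.
  move=> e e0; have [N hN] := ux _ e0; exists N => n Nn.
  by apply: hN; exact: leqW.
have := FE x Xx; have := DF x Xx; rewrite Fx => Dx E1; exists x => //.
apply: (addIr ((l0 - l)%:C *: x)).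
by rewrite -E1 addrAC -scalerDl -rmorphD /= [l + _]addrC subrK.
Qed.

Hypothesis onto : forall y, X y -> exists2 x, D x & A x = y.
Variable C : R.
Hypothesis C_ge0 : 0 <= C.
Hypothesis bounded_below : forall x, D x -> nrm x <= C * nrm (A x).

(* Solvability spreads from [l0] to [l0 <= l <= 3 / 2 * l0], since [nrm (l0 x - A x) >= l0 * nrm x]. *)
Lemma solvable_gt0 l : 0 < l -> solvable l.
Proof.
(* The continuation starts from [l0 = 0], where [onto] and [bounded_below] give solvability with
   constant [C]; then [l1 * C] is at most 1/2. *)
pose l1 := (2 * (C + 1))^-1; have C1 : 0 < 2 * (C + 1) by rewrite mulr_gt0// ltr_wpDl.
have s1 k : 0 < k <= l1 -> solvable k.
  move=> /andP[k0 kl]; apply: (@solvable_near 0 k (C)) => //.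
  - move=> x Dx; rewrite scale0r sub0r (nrmN ip)//; first exact: bounded_below.
    exact: (dis_range dis).
  - move=> y Xy; have [x Dx xy] := onto (ip_memN ip Xy); exists x => //.
    by rewrite scale0r sub0r xy opprK.
  - rewrite subr0 gtr0_norm//.
    have : k * (2 * (C + 1)) <= 1 by rewrite -ler_pdivlMr// div1r.
    by nra.
have step k : 0 < k -> solvable k -> forall h, k <= h <= 3 / 2 * k -> solvable h.
  move=> k0 sk h /andP[kh hk]; apply: (@solvable_near k h k^-1) => //.
  - by rewrite invr_ge0 ltW.
  - move=> x Dx.
    have Xd := ip_memB ip (ip_memZ ip k%:C (dis_sub dis Dx)) (dis_range dis Dx).
    have kV : 0 <= k^-1 by rewrite invr_ge0 ltW.
    apply: le_trans (nrm_sub_dis_ge kV Dx) _.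
    rewrite -[x in x - _]scale1r -[1](_ : (k^-1 * k)%:C = _); last by rewrite mulVf ?gt_eqF.
    by rewrite rmorphM /= -scalerA -scalerBr (nrmZr ip)// ger0_norm.
  - rewrite ger0_norm ?subr_ge0// ler_pdivrMr//; lra.
have all_pow n : forall k, 0 < k <= (3 / 2) ^+ n * l1 -> solvable k.
  elim: n => [|n IHn] k; first by rewrite expr0 mul1r; exact: s1.
  move=> /andP[k0 kn]; have [kl|lk] := leP k ((3 / 2) ^+ n * l1).
    by apply: IHn; rewrite k0.
  apply: (step (k * (2 / 3))); first by rewrite mulr_gt0// divr_gt0.
    apply: IHn; rewrite mulr_gt0 ?divr_gt0//=; move: kn; rewrite exprS; lra.
  by apply/andP; split; lra.
move=> l0.
have l10 : 0 < l1 by rewrite invr_gt0.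
have e0 : 0 < l1 / l by rewrite divr_gt0.
have [n hn] := half_pow_lt e0.
(* Bernoulli's inequality: the powers of 3/2 exceed [l / l1], so finitely many enlargements of the
   interval reach [l]. *)
have bern m : 1 + m%:R / 2 <= (3 / 2) ^+ m :> R.
  elim: m => [|m IHm]; first by rewrite mul0r addr0 expr0.
  rewrite exprS -natr1; have : 0 <= m%:R :> R by []; lra.
have [N hN] := natSinv_lt (divr_gt0 l10 l0); have {}hN := hN N (leqnn N).
apply: (all_pow (N.+1 * 2)%N); rewrite l0/=; apply: ltW.
move: hN; rewrite invf_plt ?posrE// invf_div ltr_pdivrMr// => h.
apply: lt_le_trans h _; rewrite ler_pM2r//; apply: le_trans (bern _).
by rewrite natrM mulfK ?lerDr.
Qed.

(* [(1 - h A)^-1 y], a junk value unless [0 < h] and [X y]. *)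
Definition resolvent h y : E :=
  xget 0 [set x | D x /\ x - h%:C *: A x = y].
Local Notation J := resolvent.

Lemma resolventP h y : 0 < h -> X y -> D (J h y) /\ J h y - h%:C *: A (J h y) = y.
Proof.
move=> h0 Xy; rewrite /resolvent; have hV : 0 < h^-1 by rewrite invr_gt0.
have Xhy := ip_memZ ip (h^-1)%:C Xy.
have [x Dx xy] := solvable_gt0 hV Xhy.
case: xgetP => [? -> //|/(_ x) /=]; case; split => //.
have := congr1 (fun z => h%:C *: z) xy.
by rewrite scalerBr !scalerA -rmorphM /= divff ?gt_eqF// !scale1r.
Qed.

Lemma resolvent_mem h y : 0 < h -> X y -> X (J h y).
Proof.
move=> h0 Xy.
by have [/(dis_sub dis)] := resolventP h0 Xy.
Qed.

(** Besides uniqueness, this is the tool for identities about resolvents: the expected value is an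
    [x] in [D], so it suffices to compute [x - h A x]. *)
Lemma resolvent_uniq h x : 0 < h -> D x -> J h (x - h%:C *: A x) = x.
Proof.
move=> h0 Dx.
have Xy := ip_memB ip (dis_sub dis Dx) (ip_memZ ip h%:C (dis_range dis Dx)).
have [DJ JE] := resolventP h0 Xy.
set w := J h _ in DJ JE *; apply/eqP; rewrite -subr_eq0; apply/eqP.
have DB := dis_memB DJ Dx; apply: (nrm_eq0 ip (dis_sub dis DB)).
apply/eqP; rewrite eq_le nrm_ge0 andbT; apply: le_trans (nrm_sub_dis_ge (ltW h0) DB) _.
by rewrite (disB DJ Dx) scalerBr subrACA JE subrr (nrm0 ip).
Qed.

Lemma resolvent_nrm h x : 0 < h -> X x -> nrm (J h x) <= nrm x.
Proof.
move=> h0 Xx.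
have [DJ JE] := resolventP h0 Xx.
by rewrite -{2}JE; exact: (nrm_sub_dis_ge (ltW h0)).
Qed.

Lemma resolvent_linear h a x y : 0 < h -> X x -> X y ->
  J h (a *: x + y) = a *: J h x + J h y.
Proof.
move=> h0 Xx Xy.
have [DJx JxE] := resolventP h0 Xx; have [DJy JyE] := resolventP h0 Xy.
have DJ := dis_memP dis a DJx DJy.
rewrite -[RHS](resolvent_uniq h0 DJ); congr (J h _).
rewrite (dis_linear dis a DJx DJy) -{1}JxE -{1}JyE.
by rewrite scalerBr scalerDr !scalerA mulrC addrACA opprD.
Qed.

(** For [x] in [D] the vector [A (J h x)] equals [(J h x - x) / h], hence lies in [D] again, and
    [resolvent_uniq] applies to it. *)
Lemma dis_resolvent h x : 0 < h -> D x -> A (J h x) = J h (A x).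
Proof.
move=> h0 Dx.
have [DJ JE] := resolventP h0 (dis_sub dis Dx).
have hA : h%:C *: A (J h x) = J h x - x.
  by rewrite -[LHS](subKr (J h x)) JE.
have AE : A (J h x) = (h^-1)%:C *: (J h x - x).
  by rewrite -hA scalerA -rmorphM /= mulVf ?gt_eqF// scale1r.
have DAJ : D (A (J h x)) by rewrite AE; apply: dis_memZ; exact: dis_memB.
rewrite -[LHS](resolvent_uniq h0 DAJ); congr (J h _).
by rewrite -disZ// -disB ?JE//; exact: dis_memZ.
Qed.

Lemma resolventC h k x : 0 < h -> 0 < k -> X x -> J h (J k x) = J k (J h x).
Proof.
move=> h0 k0 Xx; have [DJ JE] := resolventP k0 Xx.
have [DJJ _] := resolventP h0 (dis_sub dis DJ).
rewrite -[LHS](resolvent_uniq k0 DJJ); congr (J k _).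
have XJ := dis_sub dis DJ; have XA := dis_range dis DJ.
have := resolvent_linear (- k)%:C h0 XA XJ.
by rewrite (dis_resolvent h0 DJ) rmorphN !scaleNr [- _ + J k x]addrC JE addrC => ->.
Qed.

(* If [x - p] is orthogonal to [D] and [x - p = w - A w] with [D w], then
   [nrm w ^+ 2 = rdot (A w) w <= 0]. *)
Lemma dense_domain x (e : R) : X x -> 0 < e -> exists2 y, D y & nrm (x - y) < e.
Proof.
move=> Xx e0.
have ipD : inner_product_on D dot.
  split; first exact: (dis_mem0 dis).
  - exact: (dis_memP dis).
  - by move=> a y z w Dy Dz Dw; apply: (ip_linear ip); exact: (dis_sub dis).
  - by move=> y z Dy Dz; apply: (ip_conj ip); exact: (dis_sub dis).
  - by move=> y Dy; apply: (ip_ge0 ip); exact: (dis_sub dis).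
  - by move=> y Dy; apply: (ip_eq0 ip); exact: (dis_sub dis).
(* The limit [p] of a minimising sequence in [D] for the functional [rdot x] plays the part of the
   orthogonal projection of [x] on the closure of [D]. *)
have [u [Du cu] ux] : exists2 u : nat -> E, (forall n, D (u n)) /\ ncauchy dot u &
    forall y, D y -> forall e : R, 0 < e ->
    exists N : nat, forall n, (N <= n)%N -> `|rdot (u n) y - rdot x y| < e.
  apply: (Riesz_minimizing ipD (C := nrm x)).
  - by move=> y z Dy Dz; rewrite (rdotDr ip)//; exact: (dis_sub dis).
  - by move=> k y Dy; rewrite (rdotZr ip)//; exact: (dis_sub dis).
  - by move=> y Dy; apply: (rdot_le ip Xx); exact: (dis_sub dis).
have Xu n := dis_sub dis (Du n).
have [p Xp up] := cX Xu cu.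
have pE y : D y -> rdot p y = rdot x y.
  by move=> Dy; apply: (ncvg_rdot ip Xu Xp (dis_sub dis Dy) up) => d; exact: ux.
have Xq := ip_memB ip Xx Xp.
have [DJ JE] := resolventP ltr01 Xq; set w := J 1 _ in DJ JE.
have Xw := dis_sub dis DJ; have XA := dis_range dis DJ.
have qw : rdot (x - p) w = 0 by rewrite (rdotBl ip)// pE// subrr.
have w0 : w = 0.
  apply: (ip_eq0 ip Xw); apply/eqP; rewrite eq_le (ip_ge0 ip Xw) andbT.
  move: qw; rewrite -{1}JE rmorph1 scale1r (rdotBl ip)// => /eqP.
  by rewrite subr_eq0 => /eqP ww; rewrite -/(rdot w w) ww; exact: (dis_le0 dis).
have : x - p = 0 by rewrite -JE w0 dis0 scaler0 subrr.
move/eqP; rewrite subr_eq0 => /eqP ->.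
have [N /(_ N (leqnn N)) hN] := up _ e0; exists (u N) => //.
by rewrite (nrmBC ip).
Qed.

(** Take [z] in [D] near [x - A x] and [y = J 1 z]. Then [x - y] minus its image under [A] equals
    [(x - A x) - z], which is small; so [x - y] is small, hence also [A x - A y], and [A y = y - z]
    lies in [D]. *)
Lemma dense_domain2 x (e : R) : D x -> 0 < e ->
  exists y, [/\ D y, D (A y), nrm (x - y) < e & nrm (A x - A y) < e].
Proof.
move=> Dx e0; have Xx := dis_sub dis Dx; have XA := dis_range dis Dx.
have e20 : 0 < e / 2 by rewrite divr_gt0.
have Xz := ip_memB ip Xx XA.
have [z Dz xz] := dense_domain Xz e20; have Xz' := dis_sub dis Dz.
have [DJ] := resolventP ltr01 Xz'; set y := J 1 z in DJ *.
rewrite rmorph1 scale1r => JE.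
have XB := dis_memB Dx DJ; have Xd := ip_memB ip Xz Xz'.
have xyE : (x - y) - 1%:C *: A (x - y) = (x - A x) - z.
  by rewrite rmorph1 scale1r disB// subrACA JE.
have xy : nrm (x - y) < e / 2.
  by apply: le_lt_trans xz; rewrite -xyE; exact: nrm_sub_dis_ge.
have AyE : A y = y - z by rewrite -[LHS](subKr y) JE.
have AE : A x - A y = (x - y) - ((x - A x) - z).
  by rewrite -xyE rmorph1 scale1r disB// subKr.
exists y; split=> //.
- by rewrite AyE; exact: dis_memB.
- by apply: lt_trans xy _; rewrite ltr_pdivrMr// ltr_pMr// ltr1n.
- rewrite AE; apply: le_lt_trans (nrmD ip (dis_sub dis XB) (ip_memN ip Xd)) _.
  by rewrite (nrmN ip)// [ltRHS](splitr e) ltrD.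
Qed.

Lemma resolvent_expand h x : 0 < h -> D x -> J h x = x + h%:C *: J h (A x).
Proof.
move=> h0 Dx; have [DJ JE] := resolventP h0 (dis_sub dis Dx).
by rewrite -dis_resolvent// -{2}JE subrK.
Qed.

Lemma resolventB h x y : 0 < h -> X x -> X y -> J h (x - y) = J h x - J h y.
Proof.
by move=> h0 Xx Xy; rewrite addrC -scaleN1r resolvent_linear// scaleN1r addrC.
Qed.

Lemma resolventZ h a x : 0 < h -> X x -> J h (a *: x) = a *: J h x.
Proof.
move=> h0 Xx; have X0 := ip_mem0 ip.
have J0 : J h 0 = 0 by rewrite -[X in J h X](subrr 0) resolventB// subrr.
by have := resolvent_linear a h0 Xx X0; rewrite !addr0 J0 addr0.
Qed.

Lemma resolventD_mem h x : 0 < h -> D x -> D (J h x).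
Proof. by move=> h0 Dx; have [] := resolventP h0 (dis_sub dis Dx). Qed.

Lemma nrm_resolventB h x : 0 < h -> D x -> nrm (J h x - x) <= h * nrm (A x).
Proof.
move=> h0 Dx; have XA := dis_range dis Dx.
rewrite (resolvent_expand h0 Dx) addrC addKr (nrmZr ip); last exact: resolvent_mem.
by rewrite gtr0_norm// ler_pM2l// resolvent_nrm.
Qed.

(** Local error of halving a step. Expanding [(1 - h A) ^ 2] gives
    [(1 - 2 h A) J^2 x = x - h^2 J^2 A^2 x], where [J] is the resolvent for [h]; applying the
    resolvent for [2 * h] leaves an error of order [h ^+ 2]. *)
Lemma nrm_resolvent_double h x : 0 < h -> D x -> D (A x) ->
  nrm (J h (J h x) - J (2 * h) x) <= h ^+ 2 * nrm (A (A x)).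
Proof.
move=> h0 Dx DA; have h20 : 0 < 2 * h by rewrite mulr_gt0.
have DJ := resolventD_mem h0 Dx; have DJJ := resolventD_mem h0 DJ.
have Xx := dis_sub dis Dx; have XAA := dis_range dis DA.
have E1 := resolvent_expand h0 Dx; have E2 := resolvent_expand h0 DJ.
have E3 := resolvent_expand h0 (resolventD_mem h0 DA).
rewrite dis_resolvent// in E2; rewrite dis_resolvent// in E3.
set q := J h (J h (A (A x))) in E3.
have Xq : X q by do 2 apply: resolvent_mem => //.
have Xhq := ip_memZ ip (h ^+ 2)%:C Xq.
have E4 : J h (J h x) - (2 * h)%:C *: A (J h (J h x)) = x - (h ^+ 2)%:C *: q.
  rewrite dis_resolvent// dis_resolvent// E2 {1}E1 -addrA -addrA; congr (_ + _).
  rewrite -{1}[J h (A x)](addrK (h%:C *: q)) -E3 scalerBr scalerA -rmorphM /= -expr2.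
  have -> : (2 * h)%:C *: J h (J h (A x)) = h%:C *: J h (J h (A x)) + h%:C *: J h (J h (A x)).
    by rewrite mulr_natl mulr2n rmorphD scalerDl.
  by rewrite addrAC addrA subrr sub0r.
rewrite -{1}(resolvent_uniq h20 DJJ) E4 resolventB// addrAC subrr sub0r.
have Xhq2 := resolvent_mem h20 Xq.
rewrite resolventZ// (nrmN ip) ?(nrmZr ip)//; last exact: (ip_memZ ip).
rewrite ger0_norm ?sqr_ge0// ler_wpM2l ?sqr_ge0//.
apply: le_trans (resolvent_nrm h20 Xq) _.
apply: le_trans (resolvent_nrm h0 (resolvent_mem h0 XAA)) _.
exact: resolvent_nrm.
Qed.

Section iterates.
Variable h : R.
Hypothesis h_gt0 : 0 < h.
Local Notation F m := (iter m (J h)).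

Lemma iter_resolvent_mem m x : X x -> X (F m x).
Proof. by move=> Xx; elim: m => //= m; exact: resolvent_mem. Qed.

Lemma iter_resolventD_mem m x : D x -> D (F m x).
Proof. by move=> Xx; elim: m => //= m; exact: resolventD_mem. Qed.

Lemma iter_resolvent_nrm m x : X x -> nrm (F m x) <= nrm x.
Proof.
move=> Xx; elim: m => //= m; apply: le_trans; apply: resolvent_nrm => //.
exact: iter_resolvent_mem.
Qed.

Lemma iter_resolvent_linear m a x y : X x -> X y ->
  F m (a *: x + y) = a *: F m x + F m y.
Proof.
by move=> Xx Xy; elim: m => //= m ->; apply: resolvent_linear => //; exact: iter_resolvent_mem.
Qed.

Lemma iter_resolventB m x y : X x -> X y -> F m (x - y) = F m x - F m y.
Proof.
by move=> Xx Xy; rewrite addrC -scaleN1r iter_resolvent_linear// scaleN1r addrC.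
Qed.

Lemma dis_iter_resolvent m x : D x -> A (F m x) = F m (A x).
Proof.
by move=> Dx; elim: m => //= m <-; apply: dis_resolvent => //; exact: iter_resolventD_mem.
Qed.

Lemma resolvent_iterC k m x : 0 < k -> X x -> J k (F m x) = F m (J k x).
Proof.
by move=> k0 Xx; elim: m => //= m <-; apply: resolventC => //; exact: iter_resolvent_mem.
Qed.

Lemma nrm_iter_resolventB m x : D x -> nrm (F m x - x) <= m%:R * h * nrm (A x).
Proof.
move=> Dx; have Xx := dis_sub dis Dx.
elim: m => [|m IHm] /=; first by rewrite subrr (nrm0 ip) !mul0r.
have XF j := iter_resolvent_mem j Xx; have DF := iter_resolventD_mem m Dx.
apply: le_trans (nrm_distD ip (XF m.+1) Xx (XF m)) _.
apply: le_trans (lerD (nrm_resolventB h_gt0 DF) IHm) _.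
have := iter_resolvent_nrm m (dis_range dis Dx); rewrite -dis_iter_resolvent//.
by rewrite -(ler_pM2l h_gt0) -natr1 => ?; lra.
Qed.

(** First order Taylor expansion of the discrete orbit: step [j] misses [h A x] by at most
    [j * h ^ 2] times the norm of [A (A x)], and these errors sum to less than [(m h) ^ 2] times
    that norm or equal it. *)
Lemma nrm_iter_resolvent_expand m x : D x -> D (A x) ->
  nrm (F m x - x - (m%:R * h)%:C *: A x) <= (m%:R * h) ^+ 2 * nrm (A (A x)).
Proof.
move=> Dx DA; have Xx := dis_sub dis Dx; have XA := dis_sub dis DA.
have a0 := nrm_ge0 dot (A (A x)).
have XAA := dis_range dis DA.
elim: m => [|m IHm] /=; first by rewrite !mul0r scale0r subr0 subrr (nrm0 ip) expr0n mul0r.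
have DF := iter_resolventD_mem m Dx.
have XF := iter_resolvent_mem m Xx; have XFA := iter_resolvent_mem m.+1 XA.
have -> : J h (F m x) - x - (m.+1%:R * h)%:C *: A x =
    (F m x - x - (m%:R * h)%:C *: A x) + h%:C *: (F m.+1 (A x) - A x).
  rewrite resolvent_expand// dis_iter_resolvent// -natr1 mulrDl mul1r rmorphD scalerDl.
  rewrite scalerBr opprD !addrA; congr (_ - _); rewrite -!addrA; congr (_ + _).
  by rewrite addrC -addrA.
have X1 := ip_memB ip XFA XA; have X2 := ip_memZ ip h%:C X1.
have X3 := ip_memB ip (ip_memB ip XF Xx) (ip_memZ ip (m%:R * h)%:C XA).
apply: le_trans (nrmD ip X3 X2) _; rewrite (nrmZr ip)// gtr0_norm//.
have := nrm_iter_resolventB m.+1 DA; rewrite -(ler_pM2l h_gt0) => h1.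
apply: le_trans (lerD IHm h1) _; rewrite -natr1.
have m0 : 0 <= m%:R :> R by [].
have := mulr_ge0 (mulr_ge0 m0 (sqr_ge0 h)) a0; rewrite !expr2; lra.
Qed.

End iterates.

(** The local errors add up, since resolvents do not increase norms and commute with [A], so that
    the norm of [A (A w)] along the orbit never exceeds its initial value. *)
Lemma nrm_iter_double h m x : 0 < h -> D x -> D (A x) ->
  nrm (iter (m + m) (J h) x - iter m (J (2 * h)) x) <= m%:R * h ^+ 2 * nrm (A (A x)).
Proof.
move=> h0 Dx DA; have h20 : 0 < 2 * h by rewrite mulr_gt0.
have Xx := dis_sub dis Dx; have XAA := dis_range dis DA.
elim: m => [|m IHm]; first by rewrite subrr (nrm0 ip) !mul0r.
rewrite addnS addSn /=; set w := iter (m + m) _ x in IHm *.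
set v := iter m _ x in IHm *.
have Dw : D w by exact: iter_resolventD_mem.
have DAw : D (A w) by rewrite dis_iter_resolvent//; exact: iter_resolventD_mem.
have Xw := dis_sub dis Dw; have Xv : X v by exact: iter_resolvent_mem.
have XJ k y : 0 < k -> X y -> X (J k y) by exact: resolvent_mem.
have X1 := XJ _ _ h0 (XJ _ _ h0 Xw); have X2 := XJ _ _ h20 Xw.
have X3 := XJ _ _ h20 Xv; have X4 := ip_memB ip Xw Xv.
apply: le_trans (nrm_distD ip X1 X3 X2) _; rewrite -resolventB//.
have := le_trans (resolvent_nrm h20 X4) IHm.
have := nrm_resolvent_double h0 Dw DAw.
have : nrm (A (A w)) <= nrm (A (A x)).
  by rewrite !dis_iter_resolvent//; exact: iter_resolvent_nrm.
rewrite -(ler_pM2l (_ : 0 < h ^+ 2)) ?exprn_gt0// -natr1 => *; lra.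
Qed.

(** The carry [e] of the integer parts is the single extra step by which the Euler scheme misses the
    semigroup law and the doubling of the number of steps. *)
Lemma truncnD_cases (s t : R) : 0 <= s -> 0 <= t ->
  exists e : bool, Num.truncn (s + t) = (e + (Num.truncn s + Num.truncn t))%N.
Proof.
move=> s0 t0; have /andP[s1 s2] := truncn_itv s0; have /andP[t1 t2] := truncn_itv t0.
move: (Num.truncn s) (Num.truncn t) s1 s2 t1 t2 => m n.
rewrite -!natr1 => s1 s2 t1 t2.
exists ((m + n).+1%:R <= s + t); apply: truncn_def.
have [] := leP (m + n).+1%:R (s + t) => st; rewrite -natr1 natrD in st;
  by apply/andP; rewrite -natr1 !natrD /=; split; lra.
Qed.

(* Backward Euler steps of fixed length [2 ^- n]: with this choice the semigroup law holds up to
   one step, and halving the step at most doubles the number of steps plus one. *)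
Definition euler n (t : R) x := iter (Num.truncn (t * 2 ^+ n)) (J (2^-1 ^+ n)) x.
Local Notation P := euler.

Lemma half_pow_gt0 n : 0 < 2^-1 ^+ n :> R.
Proof. by rewrite exprn_gt0. Qed.
#[local] Hint Resolve half_pow_gt0 : core.

Lemma euler_mem n t x : X x -> X (P n t x).
Proof. exact: iter_resolvent_mem. Qed.

(** If [m] is the integer part of [t * 2 ^+ n], then that of [t * 2 ^+ n.+1] is [m + m] or one more.
    The extra step moves by at most [h * nrm (A x)], and halving the [m] steps costs
    [m * h ^+ 2 * nrm (A (A x))], where [m * h <= t]. Both are summable in [n]. *)
Lemma nrm_eulerS n t x : 0 <= t -> D x -> D (A x) ->
  nrm (P n.+1 t x - P n t x) <= (nrm (A x) + t * nrm (A (A x))) * 2^-1 ^+ n.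
Proof.
move=> t0 Dx DA; have Xx := dis_sub dis Dx.
set h : R := 2^-1 ^+ n.+1; have h0 : 0 < h by exact: half_pow_gt0.
have h2 : 2^-1 ^+ n = 2 * h by rewrite /h exprS; field.
have hn : 2 ^+ n * (2 * h) = 1 by rewrite -h2 -exprMn divff ?expr1n.
rewrite /euler -/h h2 exprS mulrCA.
set s := t * 2 ^+ n; have s0 : 0 <= s by rewrite mulr_ge0 ?exprn_ge0.
rewrite [2 * s]mulr_natl [s *+ 2]mulr2n.
have [e ->] := truncnD_cases s0 s0; move: (truncn_itv s0) => /andP[s1 _].
set m := Num.truncn s in s1 *; rewrite iterD; set w := iter (m + m) _ x.
have Dw : D w by exact: iter_resolventD_mem.
have Xw := dis_sub dis Dw; have Xe := iter_resolvent_mem h0 e Xw.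
have Xm : X (iter m (J (2 * h)) x) by apply: iter_resolvent_mem => //; rewrite mulr_gt0.
apply: le_trans (nrm_distD ip Xe Xm Xw) _.
have h3 := nrm_iter_resolventB h0 e Dw.
have h4 := nrm_iter_double m h0 Dx DA.
have XA := dis_sub dis DA.
have h5 : nrm (A w) <= nrm (A x) by rewrite dis_iter_resolvent// iter_resolvent_nrm.
have h6 : e%:R * h * nrm (A w) <= 2 * h * nrm (A x).
  apply: ler_pM; rewrite ?nrm_ge0 ?mulr_ge0 ?(ltW h0)// ler_pM2r//.
  by case: (e); rewrite ?ler1n ?ler_nat.
have h7 : m%:R * h ^+ 2 * nrm (A (A x)) <= 2 * h * (t * nrm (A (A x))).
  have mh : m%:R * h <= t.
    apply: le_trans (_ : s * h <= _); first by rewrite ler_pM2r.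
    by rewrite /s -mulrA -[leRHS]mulr1 ler_wpM2l//; lra.
  have hN : 0 <= h * nrm (A (A x)) by rewrite mulr_ge0 ?nrm_ge0 ?ltW.
  have := ler_wpM2r hN mh; have := mulr_ge0 t0 hN; rewrite expr2; lra.
apply: le_trans (lerD (le_trans h3 h6) (le_trans h4 h7)) _.
by rewrite -mulrDr [leRHS]mulrC.
Qed.

(** The geometric estimate holds for [y] with [y] and [A y] in [D]; contractivity of the scheme
    replaces [x] by such a [y] at a cost of twice [nrm (x - y)]. *)
Lemma euler_cvg t x : 0 <= t -> X x -> exists2 l, X l & ncvg dot (fun n => P n t x) l.
Proof.
move=> t0 Xx; apply: cX => [n|e e0]; first exact: euler_mem.
have e40 : 0 < e / 4 by rewrite divr_gt0.
have [z Dz xz] := dense_domain Xx e40.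
have [y [Dy DA zy _]] := dense_domain2 Dz e40.
have Xy := dis_sub dis Dy; have Xz := dis_sub dis Dz; have Xd := ip_memB ip Xx Xy.
have xy : nrm (x - y) < e / 2.
  by apply: le_lt_trans (nrm_distD ip Xx Xy Xz) _; lra.
have cP n : nrm (P n t x - P n t y) <= nrm (x - y).
  by rewrite -iter_resolventB//; exact: iter_resolvent_nrm.
have Xn n : X (P n t y) by exact: euler_mem.
have d0 : 0 < e - 2 * nrm (x - y) by lra.
have [N hN] := geometric_ncauchy Xn (fun n => nrm_eulerS n t0 Dy DA) d0.
exists N => m n Nm Nn; have := hN m n Nm Nn; have := cP m; have := cP n.
have Xx' j := euler_mem j t Xx.
rewrite (nrmBC ip (Xx' n) (Xn n)) => h1 h2 h3.
apply: le_lt_trans (nrm_distD ip (Xx' m) (Xx' n) (Xn m)) _.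
apply: le_lt_trans (lerD h2 (nrm_distD ip (Xn m) (Xx' n) (Xn n))) _; lra.
Qed.

Definition flow t x := xget 0 [set l | X l /\ ncvg dot (fun n => P n t x) l].
Local Notation T := flow.

Lemma flowP t x : 0 <= t -> X x -> X (T t x) /\ ncvg dot (fun n => P n t x) (T t x).
Proof.
move=> t0 Xx; have [l Xl tl] := euler_cvg t0 Xx.
by rewrite /flow; case: xgetP => [//|/(_ l)]; case; split.
Qed.

Lemma flow_mem t x : 0 <= t -> X x -> X (T t x).
Proof. by move=> t0 Xx; have [] := flowP t0 Xx. Qed.

Lemma flow_uniq t x l : 0 <= t -> X x -> X l -> ncvg dot (fun n => P n t x) l -> T t x = l.
Proof.
move=> t0 Xx Xl ll; have [XT TT] := flowP t0 Xx.
exact: (ncvg_unique ip (fun n => euler_mem n t Xx) XT Xl TT ll).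
Qed.

Lemma flow_nrm t x : 0 <= t -> X x -> nrm (T t x) <= nrm x.
Proof.
move=> t0 Xx; have [XT TT] := flowP t0 Xx.
apply: (ncvg_bound_le ip (fun n => euler_mem n t Xx) XT TT) => n.
exact: iter_resolvent_nrm.
Qed.

Lemma flow_linear t a x y : 0 <= t -> X x -> X y -> T t (a *: x + y) = a *: T t x + T t y.
Proof.
move=> t0 Xx Xy; have [Xl xl] := flowP t0 Xx; have [Xm ym] := flowP t0 Xy.
apply: flow_uniq => //; [exact: (ip_memP ip)|exact: (ip_memP ip)|].
have mx n := euler_mem n t Xx; have my n := euler_mem n t Xy.
have -> : (fun n => P n t (a *: x + y)) = (fun n => a *: P n t x + P n t y).
  by apply/funext => n; exact: iter_resolvent_linear.
exact: (ncvgD ip (fun n => ip_memZ ip a (mx n)) (ip_memZ ip a Xl) my Xm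
  (ncvgZ ip a mx Xl xl) ym).
Qed.

Lemma flowB t x y : 0 <= t -> X x -> X y -> T t (x - y) = T t x - T t y.
Proof.
by move=> t0 Xx Xy; rewrite addrC -scaleN1r flow_linear// scaleN1r addrC.
Qed.

Lemma flowZ t a x : 0 <= t -> X x -> T t (a *: x) = a *: T t x.
Proof.
move=> t0 Xx; have X0 := ip_mem0 ip.
have T0 : T t 0 = 0 by rewrite -[X in T t X](subrr 0) flowB// subrr.
by have := flow_linear a t0 Xx X0; rewrite !addr0 T0 addr0.
Qed.

Lemma flow0 x : X x -> T 0 x = x.
Proof.
move=> Xx; apply: flow_uniq => // e e0; exists 0%N => n _.
by rewrite /euler mul0r truncn0 /= subrr (nrm0 ip).
Qed.

Lemma resolvent_flow h t x : 0 < h -> 0 <= t -> X x -> J h (T t x) = T t (J h x).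
Proof.
move=> h0 t0 Xx; have [Xl xl] := flowP t0 Xx.
have XJ := resolvent_mem h0 Xx; have XJT := resolvent_mem h0 Xl.
symmetry; apply: flow_uniq => // e e0; have [N hN] := xl e e0; exists N => n /hN.
have XP := euler_mem n t Xx; have XB := ip_memB ip XP Xl.
rewrite /euler -resolvent_iterC// -resolventB//.
by apply: le_lt_trans; exact: resolvent_nrm.
Qed.

(** Since [x = J 1 (x - A x)] and [T t] commutes with [J 1], the vector [T t x] is a value of the
    resolvent and therefore lies in [D]. *)
Lemma flowD_mem t x : 0 <= t -> D x -> D (T t x).
Proof.
move=> t0 Dx; have Xy := ip_memB ip (dis_sub dis Dx) (ip_memZ ip 1%:C (dis_range dis Dx)).
rewrite -(resolvent_uniq ltr01 Dx) -resolvent_flow//.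
by have [] := resolventP ltr01 (flow_mem t0 Xy).
Qed.

Lemma dis_flow t x : 0 <= t -> D x -> A (T t x) = T t (A x).
Proof.
move=> t0 Dx; have Xx := dis_sub dis Dx; have XA := dis_range dis Dx.
have Xy := ip_memB ip Xx XA.
have := resolvent_uniq ltr01 Dx; rewrite rmorph1 scale1r => JE.
have TE : T t x = J 1 (T t (x - A x)) by rewrite resolvent_flow// JE.
have [_] := resolventP ltr01 (flow_mem t0 Xy); rewrite -TE rmorph1 scale1r flowB//.
by move/addrI/oppr_inj.
Qed.

Lemma nrm_flow_expand t x : 0 <= t -> D x -> D (A x) ->
  nrm (T t x - x - t%:C *: A x) <= t ^+ 2 * nrm (A (A x)).
Proof.
move=> t0 Dx DA; have Xx := dis_sub dis Dx; have XA := dis_sub dis DA.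
have [Xl xl] := flowP t0 Xx.
have a0 := nrm_ge0 dot (A x); have a1 : 0 < 1 + nrm (A x) by rewrite ltr_wpDr.
apply/ler_addgt0Pr => e e0.
have e20 : 0 < e / 2 by rewrite divr_gt0.
have [N hN] := xl _ e20; have [M hM] := half_pow_lt (divr_gt0 e20 a1).
set n := maxn N M; have {}hN := hN n (leq_maxl _ _); have {}hM := hM n (leq_maxr _ _).
have s0 : 0 <= t * 2 ^+ n by rewrite mulr_ge0 ?exprn_ge0.
have hn : 2 ^+ n * 2^-1 ^+ n = 1 :> R by rewrite -exprMn divff ?expr1n.
have /andP[m1 m2] := truncn_itv s0; have h0 := half_pow_gt0 n.
have := nrm_iter_resolvent_expand h0 (Num.truncn (t * 2 ^+ n)) Dx DA.
rewrite -/(P n t x); set m := Num.truncn _ in m1 m2 *; set h := 2^-1 ^+ n in hn h0 hM *.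
set k := m%:R * h; have kt : 0 <= t - k < h.
  have -> : t = t * 2 ^+ n * h by rewrite -mulrA hn mulr1.
  rewrite -mulrBl mulr_ge0 ?subr_ge0 ?(ltW h0)//= -[ltRHS]mul1r ltr_pM2r//.
  by move: m2; rewrite -natr1; lra.
have k0 : 0 <= k by rewrite mulr_ge0 ?(ltW h0).
move=> h1; have XP := euler_mem n t Xx.
have -> : T t x - x - t%:C *: A x =
    (P n t x - x - k%:C *: A x) - ((P n t x - T t x) + (t - k)%:C *: A x).
  rewrite rmorphB scalerBl [RHS]addrC opprD !opprB -!addrA; congr (_ + _).
  by rewrite (addrCA (- (_ *: _)) (P n t x)) (addrCA _ (P n t x)) addKr addrCA
    (addrCA _ (- x)) subrr addr0 addrC.
have X1 := ip_memZ ip (t - k)%:C XA; have X2 := ip_memB ip XP Xl.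
have X3 := ip_memB ip (ip_memB ip XP Xx) (ip_memZ ip k%:C XA).
apply: le_trans (nrmD ip X3 (ip_memN ip (ip_memD ip X2 X1))) _.
rewrite (nrmN ip); last exact: (ip_memD ip).
apply: lerD.
  apply: le_trans h1 _; rewrite ler_wpM2r ?nrm_ge0// ler_pXn2r//.
  by case/andP: kt; rewrite subr_ge0.
apply: le_trans (nrmD ip X2 X1) _; rewrite [leRHS]splitr.
apply: lerD; first exact: ltW.
case/andP: kt => kt0 kt1; rewrite (nrmZr ip)// ger0_norm//.
move: hM; rewrite ltr_pdivlMr// => hM; apply: le_trans (ltW hM).
by apply: ler_pM => //; [exact: ltW|rewrite lerDr].
Qed.

(** On [D] the discrete scheme satisfies the law up to one resolvent step, coming from the carry,
    which moves by at most [2^-1 ^+ n * nrm (A y)]. The law then holds in the limit and extends to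
    [X] by density and contractivity. *)
Lemma flowS s t x : 0 <= s -> 0 <= t -> X x -> T (s + t) x = T s (T t x).
Proof.
move=> s0 t0 Xx; have st0 : 0 <= s + t by rewrite addr_ge0.
have main y : D y -> T (s + t) y = T s (T t y).
  move=> Dy; have Xy := dis_sub dis Dy; have XA := dis_range dis Dy.
  have [Xt yt] := flowP t0 Xy; have [Xs ys] := flowP s0 Xt.
  apply: flow_uniq => // e e0.
  have e30 : 0 < e / 3 by rewrite divr_gt0.
  have a1 : 0 < 1 + nrm (A y) by rewrite ltr_wpDr ?nrm_ge0.
  have [N1 hN1] := yt _ e30; have [N2 hN2] := ys _ e30.
  have [N3 hN3] := half_pow_lt (divr_gt0 e30 a1).
  exists (maxn N1 (maxn N2 N3)) => n; rewrite !geq_max => /and3P[/hN1 h1 /hN2 h2 /hN3].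
  rewrite ltr_pdivlMr// => h3; have h0 := half_pow_gt0 n.
  have Xn := euler_mem n t Xy; have Xst := euler_mem n (s + t) Xy.
  have Xsn := euler_mem n s Xn; have Xsn' := euler_mem n s Xt.
  have h4 : nrm (P n (s + t) y - P n s (P n t y)) <= 2^-1 ^+ n * nrm (A y).
    have s20 : 0 <= s * 2 ^+ n by rewrite mulr_ge0 ?exprn_ge0.
    have t20 : 0 <= t * 2 ^+ n by rewrite mulr_ge0 ?exprn_ge0.
    rewrite /euler mulrDl; have [e' ->] := truncnD_cases s20 t20.
    rewrite iterD iterD -/(P n t y) -/(P n s (P n t y)).
    have DP : D (P n s (P n t y)) by do 2 apply: iter_resolventD_mem => //.
    apply: le_trans (nrm_iter_resolventB h0 e' DP) _.
    have -> : A (P n s (P n t y)) = P n s (P n t (A y)).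
      by rewrite dis_iter_resolvent// ?dis_iter_resolvent//; exact: iter_resolventD_mem.
    apply: ler_pM; rewrite ?nrm_ge0 ?mulr_ge0 ?(ltW h0)//.
      by case: (e'); rewrite ?mul1r// mul0r ltW.
    by apply: le_trans (iter_resolvent_nrm h0 _ (euler_mem n t XA)) _; exact: iter_resolvent_nrm.
  have h5 : nrm (P n s (P n t y) - P n s (T t y)) <= nrm (P n t y - T t y).
    rewrite -iter_resolventB//; apply: iter_resolvent_nrm => //; exact: (ip_memB ip).
  have h6 := nrm_distD ip Xst Xs Xsn; have h7 := nrm_distD ip Xsn Xs Xsn'.
  have := nrm_ge0 dot (A y); lra.
apply/eqP; rewrite -subr_eq0; apply/eqP.
have Xst := flow_mem st0 Xx; have Xts := flow_mem s0 (flow_mem t0 Xx).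
apply: (nrm_eq0 ip (ip_memB ip Xst Xts)); apply/eqP; rewrite eq_le nrm_ge0 andbT.
apply/ler_addgt0Pl => e e0; rewrite addr0; have e20 : 0 < e / 2 by rewrite divr_gt0.
have [y Dy xy] := dense_domain Xx e20; have Xy := dis_sub dis Dy.
have XB := ip_memB ip Xx Xy.
apply: le_trans (nrm_distD ip Xst Xts (flow_mem st0 Xy)) _.
rewrite -(flowB st0 Xx Xy) (main y Dy).
rewrite -(flowB s0 (flow_mem t0 Xy) (flow_mem t0 Xx)) -(flowB t0 Xy Xx).
have h1 := flow_nrm st0 XB.
have XB' := ip_memB ip Xy Xx.
have h2 := flow_nrm s0 (flow_mem t0 XB'); have h3 := flow_nrm t0 XB'.
by move: h3; rewrite (nrmBC ip Xy Xx) => h3; lra.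
Qed.

Lemma nrm_flowB_le t x : 0 <= t -> D x -> nrm (T t x - x) <= t * nrm (A x).
Proof.
move=> t0 Dx; have Xx := dis_sub dis Dx; have [Xt xt] := flowP t0 Xx.
apply: (ncvg_bound_le ip (u := fun n => P n t x - x)).
- by move=> n; apply: (ip_memB ip) => //; exact: euler_mem.
- exact: (ip_memB ip).
- move=> e e0; have [N hN] := xt e e0; exists N => n /hN.
  by rewrite opprB addrA subrK.
move=> n; have h0 := half_pow_gt0 n; apply: le_trans (nrm_iter_resolventB h0 _ Dx) _.
have s0 : 0 <= t * 2 ^+ n by rewrite mulr_ge0 ?exprn_ge0.
have hn : 2 ^+ n * 2^-1 ^+ n = 1 :> R by rewrite -exprMn divff ?expr1n.
rewrite ler_wpM2r ?nrm_ge0//; apply: (@le_trans _ _ (t * 2 ^+ n * 2^-1 ^+ n)).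
  by rewrite ler_pM2r//; have /andP[] := truncn_itv s0.
by rewrite -mulrA hn mulr1.
Qed.

Lemma flow_continuous0 x (e : R) : X x -> 0 < e ->
  exists2 d : R, 0 < d & forall s, 0 <= s < d -> nrm (T s x - x) < e.
Proof.
move=> Xx e0; have e30 : 0 < e / 3 by rewrite divr_gt0.
have [y Dy xy] := dense_domain Xx e30; have Xy := dis_sub dis Dy.
have a1 : 0 < 1 + nrm (A y) by rewrite ltr_wpDr ?nrm_ge0.
exists (e / 3 / (1 + nrm (A y))); first by rewrite divr_gt0.
move=> s /andP[s0]; rewrite ltr_pdivlMr// => sd.
have Xs := flow_mem s0 Xx; have Xs' := flow_mem s0 Xy; have XB := ip_memB ip Xx Xy.
have h1 := nrm_distD ip Xs Xx Xs'; have h2 := nrm_distD ip Xs' Xx Xy.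
rewrite -flowB// in h1; rewrite (nrmBC ip Xy Xx) in h2.
have := flow_nrm s0 XB; have := nrm_flowB_le s0 Dy; lra.
Qed.

(** With [y] near [x] in the graph norm and [y], [A y] in [D], the remainder splits into a quadratic
    one at [y] and the two terms [T s (x - y) - (x - y)] and [s (A x - A y)], each at most
    [s * nrm (A x - A y)]. *)
Lemma flow_derivative0 x (e : R) : D x -> 0 < e ->
  exists2 d : R, 0 < d & forall s, 0 <= s < d -> nrm (T s x - x - s%:C *: A x) <= e * s.
Proof.
move=> Dx e0; have e30 : 0 < e / 3 by rewrite divr_gt0.
have [y [Dy DA _ xy]] := dense_domain2 Dx e30.
have a1 : 0 < 1 + nrm (A (A y)) by rewrite ltr_wpDr ?nrm_ge0.
exists (e / 3 / (1 + nrm (A (A y)))); first by rewrite divr_gt0.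
move=> s /andP[s0]; rewrite ltr_pdivlMr// => sd.
have Xx := dis_sub dis Dx; have Xy := dis_sub dis Dy.
have XAx := dis_range dis Dx; have XAy := dis_sub dis DA.
have XB := ip_memB ip Xx Xy; have DB := dis_memB Dx Dy.
have XsB := ip_memB ip (flow_mem s0 XB) XB.
have XAB := ip_memZ ip s%:C (ip_memB ip XAx XAy).
have Xs := ip_memB ip (ip_memB ip (flow_mem s0 Xy) Xy) (ip_memZ ip s%:C XAy).
have -> : T s x - x - s%:C *: A x = (T s y - y - s%:C *: A y) +
    ((T s (x - y) - (x - y)) - s%:C *: (A x - A y)).
  rewrite flowB// [T s x - T s y - (x - y)]subrACA scalerBr.
  by rewrite [_ - (_ - s%:C *: A y)]subrACA [RHS]addrC subrK.
apply: le_trans (nrmD ip Xs (ip_memB ip XsB XAB)) _.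
have := nrmD ip XsB (ip_memN ip XAB); rewrite (nrmN ip XAB) (nrmZr ip); last exact: (ip_memB ip).
rewrite ger0_norm//; have := nrm_flowB_le s0 DB; rewrite disB//.
have := nrm_flow_expand s0 Dy DA; have := ler_wpM2l s0 (ltW xy).
have := ler_wpM2l s0 (ltW sd); rewrite expr2; have := mulr_ge0 s0 s0; lra.
Qed.

Lemma flow_derivative t s x : 0 <= t -> 0 <= s -> D x ->
  nrm (T (t + s) x - T t x - s%:C *: T t (A x)) <= nrm (T s x - x - s%:C *: A x).
Proof.
move=> t0 s0 Dx; have Xx := dis_sub dis Dx; have XA := dis_range dis Dx.
have Xs := flow_mem s0 Xx; have XsA := ip_memZ ip s%:C XA.
rewrite flowS// -flowB// -(flowZ s%:C t0 XA) -flowB//; last exact: (ip_memB ip).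
by apply: flow_nrm => //; do 2 apply: (ip_memB ip) => //.
Qed.

(** Subtract [e * t] from [g] to obtain [f], and suppose [f 0 < f t1]. By continuity, the infimum
    [s] of the times with [f t1 <= f t] belongs to this set, and it is positive. The left estimate
    at [s] then puts an earlier time in the set, a contradiction. *)
Lemma le_of_left_derivative (g : R -> R) :
  (forall t, 0 <= t -> forall e : R, 0 < e -> exists2 d : R, 0 < d &
     forall s, 0 <= s -> `|s - t| < d -> `|g s - g t| < e) ->
  (forall t, 0 < t -> forall e : R, 0 < e -> exists2 d : R, 0 < d &
     forall h, 0 < h < d -> h <= t -> g t <= g (t - h) + e * h) ->
  forall t, 0 <= t -> g t <= g 0.
Proof.
move=> gc gd t1 t10; apply/ler_addgt0Pr => e' e'0.
have t11 : 0 < t1 + 1 by rewrite ltr_wpDl.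
pose e := e' / (t1 + 1); have e0 : 0 < e by rewrite divr_gt0.
have eE : e * (t1 + 1) = e' by rewrite mulrVK// unitfE gt_eqF.
rewrite leNgt; apply/negP => lt1.
pose f t := g t - e * t.
have ft1 : f 0 < f t1 by rewrite /f; lra.
pose S := [set t | 0 <= t /\ f t1 <= f t].
have infS : has_inf S by split; [exists t1|exists 0 => t []].
pose s := inf S.
have s0 : 0 <= s by apply: lb_le_inf infS.1 _ => t [].
have fc t : 0 <= t -> forall d : R, 0 < d -> exists2 r : R, 0 < r &
    forall u, 0 <= u -> `|u - t| < r -> `|f u - f t| < d.
  move=> t0 d d0; have d20 : 0 < d / 2 by rewrite divr_gt0.
  have [r r0 hr] := gc t t0 _ d20; exists (Num.min r (d / 2 / e)).
    by rewrite lt_min r0 divr_gt0.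
  move=> u u0; rewrite lt_min ltr_pdivlMr// => /andP[ur ue].
  rewrite /f subrACA -mulrBr (le_lt_trans (ler_normB _ _))//.
  by rewrite normrM (gtr0_norm e0); have := hr u u0 ur; lra.
have fs : f t1 <= f s.
  rewrite leNgt; apply/negP => fst; have d0 : 0 < f t1 - f s by rewrite subr_gt0.
  have [r r0 hr] := fc s s0 _ d0.
  have [u [u0 fu] us] := inf_adherent r0 infS.
  have su : s <= u by apply: (ge_inf infS.2).
  have := hr u u0; rewrite ger0_norm ?subr_ge0// ltrBlDl => /(_ us).
  by move/(le_lt_trans (ler_norm _)); lra.
have sp : 0 < s.
  by rewrite lt0r s0 andbT; apply/eqP => s00; rewrite s00 in fs; lra.
have e20 : 0 < e / 2 by rewrite divr_gt0.
have [d d0 hd] := gd s sp _ e20.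
pose h := Num.min (d / 2) s.
have h0 : 0 < h by rewrite lt_min divr_gt0.
have hS : h <= s by rewrite ge_min lexx orbT.
have hd2 : h < d by apply: (@le_lt_trans _ _ (d / 2)); [rewrite ge_min lexx|lra].
have := hd h; rewrite h0 hd2 => /(_ isT hS) gs.
have : ~ S (s - h) by move=> /(ge_inf infS.2); rewrite -/s; lra.
apply; split; first by rewrite subr_ge0.
apply: le_trans fs _; rewrite /f; have := mulr_gt0 e0 h0; lra.
Qed.

Lemma dissipative_decay (W : R -> E) : (forall t, 0 <= t -> X (W t)) ->
  (forall t, 0 <= t -> forall e : R, 0 < e -> exists2 d : R, 0 < d &
     forall s, 0 <= s -> `|s - t| < d -> nrm (W s - W t) < e) ->
  (forall t, 0 < t -> D (W t) /\ forall e : R, 0 < e -> exists2 d : R, 0 < d &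
     forall h, 0 < h < d -> h <= t -> nrm (W t - W (t - h) - h%:C *: A (W t)) <= e * h) ->
  forall t, 0 <= t -> nrm (W t) <= nrm (W 0).
Proof.
move=> XW cW dW; apply: le_of_left_derivative => t t0 e e0.
  have [d d0 hd] := cW t t0 e e0; exists d => // s s0 /(hd s s0).
  have h1 := nrm_lerB ip (XW t t0) (XW s s0); have h2 := nrm_lerB ip (XW s s0) (XW t t0).
  by rewrite (nrmBC ip (XW t t0) (XW s s0)) in h1; rewrite ltr_norml => h3; apply/andP; split; lra.
have [Dt /(_ e e0)[d d0 hd]] := dW t t0; exists d => // h hd2 ht.
have h0 : 0 < h by case/andP: hd2.
have th0 : 0 <= t - h by rewrite subr_ge0.
have XtA := ip_memZ ip h%:C (dis_range dis Dt); have Xt := XW t (ltW t0); have Xth := XW _ th0.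
have h1 := nrm_sub_dis_ge (ltW h0) Dt; have h2 := hd h hd2 ht.
have := nrm_lerB ip (ip_memB ip Xt XtA) Xth; rewrite addrAC in h2; lra.
Qed.

Lemma flow_modulus s t x : 0 <= s -> 0 <= t -> X x ->
  nrm (T s x - T t x) <= nrm (T `|s - t| x - x).
Proof.
move=> s0 t0 Xx; wlog st : s t s0 t0 / t <= s.
  move=> H; have [|/ltW st] := leP t s; first exact: H.
  by rewrite (nrmBC ip (flow_mem s0 Xx) (flow_mem t0 Xx)) distrC; exact: H.
have st0 : 0 <= s - t by rewrite subr_ge0.
have Xst := flow_mem st0 Xx; rewrite ger0_norm//.
have -> : T s x = T t (T (s - t) x) by rewrite -flowS// [t + _]addrC subrK.
rewrite -flowB//.
by apply: flow_nrm => //; exact: (ip_memB ip).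
Qed.

Lemma flow_continuous t x (e : R) : 0 <= t -> X x -> 0 < e ->
  exists2 d : R, 0 < d & forall s, 0 <= s -> `|s - t| < d -> nrm (T s x - T t x) < e.
Proof.
move=> t0 Xx e0; have [d d0 hd] := flow_continuous0 Xx e0; exists d => // s s0 sd.
by apply: le_lt_trans (flow_modulus s0 t0 Xx) _; apply: hd; rewrite normr_ge0.
Qed.

(** One [d] serves all times. For [s] before [t] the expansion is made from [s], and its velocity
    [T s (A x)] is then exchanged for [T t (A x)] by means of the modulus of continuity. *)
Lemma flow_is_derivative x (e : R) : D x -> 0 < e ->
  exists2 d : R, 0 < d & forall s t, 0 <= t -> 0 <= s -> `|s - t| < d ->
    nrm (T s x - T t x - (s - t)%:C *: T t (A x)) <= e * `|s - t|.
Proof.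
move=> Dx e0; have e20 : 0 < e / 2 by rewrite divr_gt0.
have Xx := dis_sub dis Dx; have XA := dis_range dis Dx.
have [d1 d10 h1] := flow_derivative0 Dx e20; have [d2 d20 h2] := flow_continuous0 XA e20.
exists (Num.min d1 d2); first by rewrite lt_min d10.
move=> s t t0 s0; rewrite lt_min => /andP[st1 st2].
have [ts|/ltW st] := leP t s.
  have st0 : 0 <= s - t by rewrite subr_ge0.
  rewrite ger0_norm// in st1; rewrite ger0_norm//.
  have := flow_derivative t0 st0 Dx; rewrite (addrC t (s - t)) subrK => h3.
  apply: le_trans h3 _; apply: le_trans (h1 (s - t) _) _; first by rewrite st0.
  by rewrite ler_wpM2r//; lra.
have h0 : 0 <= t - s by rewrite subr_ge0.
have := flow_modulus t0 s0 XA; rewrite distrC in st1 st2 *.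
rewrite ger0_norm// in st1 st2 *; move=> h4.
have := flow_derivative s0 h0 Dx; rewrite (addrC s (t - s)) subrK => h3.
have h5 := h1 (t - s); rewrite h0 in h5; have {}h5 := h5 st1.
have h6 := h2 (t - s); rewrite h0 in h6; have {}h6 := h6 st2.
have Xs := flow_mem s0 Xx; have Xt := flow_mem t0 Xx.
have XsA := flow_mem s0 XA; have XtA := flow_mem t0 XA.
have -> : T s x - T t x - (s - t)%:C *: T t (A x) =
    (t - s)%:C *: (T t (A x) - T s (A x)) - (T t x - T s x - (t - s)%:C *: T s (A x)).
  rewrite opprB scalerBr addrA subrK opprB addrC -scaleNr -rmorphN /= opprB.
  by [].
have X1 := ip_memB ip XtA XsA; have X2 := ip_memB ip (ip_memB ip Xt Xs) (ip_memZ ip (t - s)%:C XsA).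
apply: le_trans (nrmD ip (ip_memZ ip (t - s)%:C X1) (ip_memN ip X2)) _.
rewrite (nrmN ip X2) (nrmZr ip _ X1) ger0_norm//.
have := ler_wpM2l h0 (le_trans h4 (ltW h6)); lra.
Qed.

Lemma flow_semigroup : semigroup_C0 X nrm T.
Proof.
split.
- by move=> t t0 x Xx; exact: flow_mem.
- by move=> t t0 a x y Xx Xy; exact: flow_linear.
- by move=> t t0; exists 1 => x Xx; rewrite mul1r; exact: flow_nrm.
- by split=> [|s t s0 t0] x Xx; [exact: flow0|exact: flowS].
move=> x Xx; apply/at_right_cvg0 => [s|e e0]; first exact: nrm_ge0.
have [d d0 hd] := flow_continuous0 Xx e0; exists d => // s /andP[s0 sd].
by apply: hd; rewrite ltW.
Qed.

Lemma flow_generates : generates X nrm D A T.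
Proof.
have quot t x y : 0 < t -> X x -> X y -> 
    nrm ((t^-1)%:C *: (T t x - x) - y) = t^-1 * nrm (T t x - x - t%:C *: y).
  move=> t0 Xx Xy; have XT := flow_mem (ltW t0) Xx.
  rewrite -[t^-1 in RHS]gtr0_norm ?invr_gt0// -(nrmZr ip); last first.
    by apply: (ip_memB ip); [exact: (ip_memB ip)|exact: (ip_memZ ip)].
  by rewrite [in RHS]scalerBr [in RHS]scalerA -rmorphM /= mulVf ?gt_eqF// scale1r.
have gen x : D x -> nrm ((t^-1)%:C *: (T t x - x) - A x) @[t --> 0^'+] --> 0.
  move=> Dx; apply/at_right_cvg0 => [s|e e0]; first exact: nrm_ge0.
  have e20 : 0 < e / 2 by rewrite divr_gt0.
  have [d d0 hd] := flow_derivative0 Dx e20; exists d => // s /andP[s0 sd].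
  rewrite quot//; [|exact: (dis_sub dis)|exact: (dis_range dis)].
  rewrite mulrC ltr_pdivrMr//; apply: le_lt_trans (hd s _) _; first by rewrite (ltW s0).
  by rewrite ltr_pM2r//; lra.
move=> x y; split=> [[Dx ->]|[Xx Xy]].
  by split; [exact: (dis_sub dis)|exact: (dis_range dis)|exact: gen].
move=> /at_right_cvg0 h; have {}h := h (fun s => nrm_ge0 dot _).
(* The generator cannot be larger than [A]: with [p = J 1 (x - y)], the vector [x - p] would have
   derivative [y - A p = x - p] at time 0. But the difference quotients of a contraction have
   nonpositive inner product with the vector, so [x - p = 0]. *)
have [DJ] := resolventP ltr01 (ip_memB ip Xx Xy); set p := J 1 _ in DJ *.
rewrite rmorph1 scale1r => JE.
have Xp := dis_sub dis DJ; have XA := dis_range dis DJ; have Xz := ip_memB ip Xx Xp.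
have zE : y - A p = x - p.
  by rewrite -[A p](subKr p) JE opprB addrA [y + _]addrC subrK.
have hp := (at_right_cvg0 (fun s => nrm_ge0 dot _)).1 (gen p DJ).
have z0 : x - p = 0.
  apply: (nrm_eq0 ip Xz); apply/eqP; rewrite eq_le nrm_ge0 andbT.
  rewrite leNgt; apply/negP => z0.
  (* The two quotients, at [x] and at [p], each err by a third, so together they stay below
     [nrm (x - p)]. *)
  have e0 : 0 < nrm (x - p) / 3 by rewrite divr_gt0.
  have [d1 d10 h1] := h _ e0; have [d2 d20 h2] := hp _ e0.
  pose t := Num.min d1 d2 / 2.
  have m0 : 0 < Num.min d1 d2 by rewrite lt_min d10.
  have t0 : 0 < t by rewrite divr_gt0.
  have tm : t < Num.min d1 d2 by rewrite /t; lra.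
  move: (tm); rewrite lt_min => /andP[t1 t2].
  have := h1 t; rewrite t0 t1 => /(_ isT){}h1; have := h2 t; rewrite t0 t2 => /(_ isT){}h2.
  have Xtx := flow_mem (ltW t0) Xx; have Xtp := flow_mem (ltW t0) Xp.
  have Xq1 := ip_memZ ip (t^-1)%:C (ip_memB ip Xtx Xx).
  have Xq2 := ip_memZ ip (t^-1)%:C (ip_memB ip Xtp Xp).
  have := nrmD ip (ip_memB ip Xq1 Xy) (ip_memN ip (ip_memB ip Xq2 XA)).
  rewrite (nrmN ip (ip_memB ip Xq2 XA)) subrACA -scalerBr subrACA -flowB ?(ltW t0)// zE => h3.
  have Xtz := flow_mem (ltW t0) Xz; have XBz := ip_memB ip Xtz Xz.
  have h4 : rdot (T t (x - p) - (x - p)) (x - p) <= 0.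
    rewrite (rdotBl ip)// subr_le0; apply: le_trans (ler_norm _) _.
    apply: le_trans (rdot_le ip Xtz Xz) _; rewrite -(nrm_sqr ip Xz) expr2.
    by rewrite ler_wpM2r ?nrm_ge0// flow_nrm// ltW.
  set q := _ *: _ in h3; have Xq : X q by exact: (ip_memZ ip).
  have h6 : nrm (x - p) ^+ 2 <= nrm (q - (x - p)) * nrm (x - p).
    rewrite (nrm_sqr ip Xz); apply: le_trans (rdot_le ip (ip_memB ip Xq Xz) Xz).
    rewrite ler_normr; apply/orP; right; rewrite (rdotBl ip Xq Xz Xz) opprB lerBrDr.
    by rewrite gerDl (rdotZl ip _ XBz Xz) mulr_ge0_le0// invr_ge0 ltW.
  by move: h6; rewrite expr2 ler_pM2r//; lra.
move/eqP: z0; rewrite subr_eq0 => /eqP xp; split; first by rewrite xp.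
by move: zE; rewrite xp subrr => /eqP; rewrite subr_eq0 => /eqP.
Qed.

Lemma Rplus_derivativeP (U : R -> E) t l : 0 <= t -> (forall s, 0 <= s -> X (U s)) -> X l ->
  is_derivative_Rplus nrm U t l <->
  forall e : R, 0 < e -> exists2 d : R, 0 < d &
    forall s, 0 <= s -> `|s - t| < d -> nrm (U s - U t - (s - t)%:C *: l) <= e * `|s - t|.
Proof.
move=> t0 XU Xl.
have quot s : 0 <= s -> s != t ->
    nrm (((s - t)^-1)%:C *: (U s - U t) - l) = nrm (U s - U t - (s - t)%:C *: l) / `|s - t|.
  move=> s0 st; have XB := ip_memB ip (XU s s0) (XU t t0).
  rewrite mulrC -normfV -(nrmZr ip); last by apply: (ip_memB ip) => //; exact: (ip_memZ ip).
  by rewrite [in RHS]scalerBr [in RHS]scalerA -rmorphM /= mulVf ?subr_eq0// scale1r.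
split.
  move=> /(within_dnbhs_cvg0 _ _ (fun s => nrm_ge0 dot _)) h e /h[d d0 hd].
  exists d => // s s0 sd.
  have [->|st] := eqVneq s t.
    by rewrite !subrr scale0r subr0 (nrm0 ip) normr0 mulr0.
  have := hd s s0 st sd; rewrite quot// ltr_pdivrMr ?normr_gt0 ?subr_eq0//.
  exact: ltW.
move=> h; apply/within_dnbhs_cvg0 => [s|e e0]; first exact: nrm_ge0.
have e20 : 0 < e / 2 by rewrite divr_gt0.
have [d d0 hd] := h _ e20; exists d => // s s0 st sd.
have st0 : 0 < `|s - t| by rewrite normr_gt0 subr_eq0.
rewrite quot// ltr_pdivrMr//; apply: le_lt_trans (hd s s0 sd) _.
by rewrite ltr_pM2r//; lra.
Qed.

Lemma flow_C1 x : D x -> C1_Rplus X nrm (T^~ x) /\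
  forall t, 0 <= t -> is_derivative_Rplus nrm (T^~ x) t (T t (A x)).
Proof.
move=> Dx; have Xx := dis_sub dis Dx; have XA := dis_range dis Dx.
have cT y : X y -> continuous_Rplus X nrm (T^~ y).
  move=> Xy t t0; split; first exact: flow_mem.
  by apply/within_cvg0 => [s|e]; [exact: nrm_ge0|exact: flow_continuous].
have dT t : 0 <= t -> is_derivative_Rplus nrm (T^~ x) t (T t (A x)).
  move=> t0; apply/Rplus_derivativeP => // [s s0||e e0]; [exact: flow_mem..|].
  by have [d d0 hd] := flow_is_derivative Dx e0; exists d => // s; exact: hd.
by split=> //; split; [exact: cT|exists (T^~ (A x)) => //; exact: cT].
Qed.

Lemma flow_strong x : D x -> strong_solution X nrm D A x (T^~ x).
Proof.
move=> Dx; have Xx := dis_sub dis Dx; have XA := dis_range dis Dx.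
have [C1 dT] := flow_C1 Dx; split=> // [t t0||t t0].
- split; first exact: flowD_mem.
  apply/within_cvg0 => [s|e e0]; first by rewrite addr_ge0 ?nrm_ge0.
  have e20 : 0 < e / 2 by rewrite divr_gt0.
  have [d1 d10 h1] := flow_continuous t0 Xx e20.
  have [d2 d20 h2] := flow_continuous t0 XA e20.
  exists (Num.min d1 d2) => [|s s0]; first by rewrite lt_min d10.
  rewrite lt_min => /andP[st1 st2]; rewrite /graph_norm disB ?dis_flow//; [|exact: flowD_mem..].
  have := h1 s s0 st1; have := h2 s s0 st2; lra.
- exact: flow0.
- by rewrite dis_flow//; exact: dT.
Qed.

Lemma nrm_backward x y l h : X x -> X y -> X l ->
  nrm (x - y - (- h)%:C *: l) = nrm (y - x - h%:C *: l).
Proof.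
move=> Xx Xy Xl; rewrite -(nrmN ip); last first.
  by apply: (ip_memB ip); [exact: (ip_memB ip)|exact: (ip_memZ ip)].
by rewrite rmorphN scaleNr opprK opprD opprB.
Qed.

(** The Riemann sum is compared with the telescoping sum of the increments of [T s w]. On each
    subinterval of length [l] the derivative contributes an error [e1 * l], and the position of the
    tag contributes another. *)
Lemma flow_Riemann w t : D w -> 0 <= t ->
  is_Riemann_integral X nrm (T^~ (A w)) t (T t w - w).
Proof.
move=> Dw t0; have Xw := dis_sub dis Dw; have XA := dis_range dis Dw.
split; first by apply: (ip_memB ip) => //; exact: flow_mem.
move=> e e0; have t1 : 0 < 2 * (t + 1) by rewrite mulr_gt0// ltr_wpDl.
pose e1 := e / (2 * (t + 1)); have e10 : 0 < e1 by rewrite divr_gt0.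
have [d1 d10 h1] := flow_derivative0 Dw e10; have [d2 d20 h2] := flow_continuous0 XA e10.
exists (Num.min d1 d2) => [|m s tau s0 sm hs]; first by rewrite lt_min d10.
have claim j : (j <= m)%N -> 0 <= s j /\
    nrm (\sum_(k < j) (s k.+1 - s k)%:C *: T (tau k) (A w) - (T (s j) w - w)) <= 2 * e1 * s j.
  elim: j => [|j IHj] jm.
    by rewrite big_ord0 s0 flow0// subrr subr0 (nrm0 ip) mulr0.
  have [sj IH] := IHj (ltnW jm); have [/andP[a1 a2]] := hs j jm.
  rewrite lt_min => /andP[sd1 sd2].
  have sj1 : 0 <= s j.+1 by exact: le_trans sj (le_trans a1 a2).
  have tj : 0 <= tau j by exact: le_trans sj a1.
  split=> //; rewrite big_ord_recr /=.
  set S := \sum_(k < j) _ in IH *.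
  have XS : X S.
    apply: (ip_mem_sum ip) => k; apply: (ip_memZ ip); apply: flow_mem => //.
    have kj := ltn_trans (ltn_ord k) jm.
    have [/andP[b1 _] _] := hs k kj; apply: le_trans b1.
    elim: (nat_of_ord k) kj => [|i IHi] im; first by rewrite s0.
    have [/andP[c1 c2] _] := hs i (ltnW im).
    exact: le_trans (IHi (ltnW im)) (le_trans c1 c2).
  have Xj := flow_mem sj Xw; have Xj1 := flow_mem sj1 Xw; have Xt := flow_mem tj XA.
  have XjA := flow_mem sj XA; have l0 : 0 <= s j.+1 - s j by rewrite subr_ge0 (le_trans a1).
  set l := s j.+1 - s j in sd1 sd2 l0 *.
  have XlT := ip_memZ ip l%:C Xt; have XlA := ip_memZ ip l%:C XjA.
  have -> : S + l%:C *: T (tau j) (A w) - (T (s j.+1) w - w) =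
      (S - (T (s j) w - w)) + (l%:C *: (T (tau j) (A w) - T (s j) (A w))
        - (T (s j.+1) w - T (s j) w - l%:C *: T (s j) (A w))).
    rewrite scalerBr (subrACA (l%:C *: T (tau j) (A w))) subrr subr0 [RHS]addrACA -opprD.
    by rewrite [T (s j) w - w + _]addrC addrA subrK.
  have X1 := ip_memB ip XS (ip_memB ip Xj Xw).
  have X2 := ip_memZ ip l%:C (ip_memB ip Xt XjA).
  have X3 := ip_memB ip (ip_memB ip Xj1 Xj) XlA.
  apply: le_trans (nrmD ip X1 (ip_memB ip X2 X3)) _.
  have := nrmD ip X2 (ip_memN ip X3); rewrite (nrmN ip X3) (nrmZr ip _ (ip_memB ip Xt XjA)).
  rewrite (ger0_norm l0) => h3.
  have := flow_derivative sj l0 Dw; rewrite (addrC (s j) l) subrK => h4.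
  have := h1 l; rewrite l0 sd1 => /(_ isT) h5.
  have h6 : nrm (T (tau j) (A w) - T (s j) (A w)) <= e1.
    apply: le_trans (flow_modulus tj sj XA) _; apply/ltW/h2; rewrite normr_ge0 /=.
    by rewrite ger0_norm ?subr_ge0//; apply: le_lt_trans sd2; rewrite /l lerB.
  have := ler_wpM2l l0 h6; have -> : 2 * e1 * s j.+1 = 2 * e1 * s j + 2 * (e1 * l) by rewrite /l; ring.
  move=> *; lra.
have [_] := claim m (leqnn m); rewrite sm => /le_lt_trans; apply.
have e1E : e1 * (2 * (t + 1)) = e by rewrite divfK// gt_eqF.
by rewrite -e1E; lra.
Qed.

Lemma flow_mild x : X x -> mild_solution X nrm D A x (T^~ x).
Proof.
move=> Xx; split=> t t0.
  split; first exact: flow_mem.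
  by apply/within_cvg0 => [s|e]; [exact: nrm_ge0|exact: flow_continuous].
have [w Dw wx] := onto Xx; exists (T t w - w); split.
- by rewrite -wx; exact: flow_Riemann.
- by apply: dis_memB => //; exact: flowD_mem.
- by rewrite disB ?dis_flow ?wx//; [rewrite addrC subrK|exact: flowD_mem].
Qed.

(** * Riemann integrals with values in [X] *)

Section Riemann_integral.
Variables (V I : R -> E).
Hypothesis XV : forall t, 0 <= t -> X (V t).
Hypothesis VI : forall t, 0 <= t -> is_Riemann_integral X nrm V t (I t).

Lemma Riemann_integral0 : I 0 = 0.
Proof.
have [XI hI] := VI (lexx 0); apply: (nrm_eq0 ip XI); apply/eqP.
rewrite eq_le nrm_ge0 andbT; apply/ler_addgt0Pl => e e0; rewrite addr0.
have [d d0 hd] := hI e e0; have := hd 0%N (fun=> 0) (fun=> 0) erefl erefl.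
rewrite big_ord0 [_ - I 0]sub0r (nrmN ip XI) => h.
by apply/ltW/h => k; rewrite ltn0.
Qed.

(** A mean value estimate which yields both the Lipschitz bound and the left derivative of the
    integral. It is read off from a single partition of [[0, t]] having [r] as a node, so that the
    sums for [I r] and [I t] share their first half [S1]. *)
Lemma Riemann_integral_near r t v (e : R) : 0 <= r <= t -> X v ->
  (forall s, r <= s <= t -> nrm (V s - v) <= e) ->
  nrm (I t - I r - (t - r)%:C *: v) <= e * (t - r).
Proof.
move=> /andP[r0 rt] Xv hV; have t0 := le_trans r0 rt.
have [XIt hIt] := VI t0; have [XIr hIr] := VI r0.
apply/ler_addgt0Pr => e1 e10; have e20 : 0 < e1 / 2 by rewrite divr_gt0.
have [d1 d10 h1] := hIt _ e20; have [d2 d20 h2] := hIr _ e20.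
pose d := Num.min d1 d2; have d0 : 0 < d by rewrite lt_min d10.
have t10 : 0 < t + 1 by rewrite ltr_wpDl.
have [N /(_ N (leqnn N)) hN] := natSinv_lt (divr_gt0 d0 t10).
have n0 : 0 < N.+1%:R :> R by [].
have nV : 0 < N.+1%:R^-1 :> R by rewrite invr_gt0.
have nK : N.+1%:R * N.+1%:R^-1 = 1 :> R by rewrite divff// gt_eqF.
move: hN; rewrite ltr_pdivlMr// => hN.
(* [[0, r]] and [[r, t]] are each cut into [N.+1] equal pieces, possibly of length zero, which the
   definition of the integral allows. *)
pose s (k : nat) := if (k <= N.+1)%N then r * k%:R / N.+1%:R
            else r + (t - r) * (k - N.+1)%N%:R / N.+1%:R.
have sS (k : nat) : s k.+1 - s k = (if (k < N.+1)%N then r else t - r) / N.+1%:R.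
  rewrite /s; case: (ltngtP k N.+1) => kN.
  - by rewrite -natr1; ring.
  - by rewrite subSn 1?ltnW// -natr1; ring.
  - by rewrite kN subSnn mulr1 -mulrA divff ?gt_eqF// mulr1 addrC addKr.
have sN : s N.+1 = r by rewrite /s leqnn -mulrA divff ?gt_eqF// mulr1.
have s2N : s (N.+1 + N.+1)%N = t.
  rewrite /s ifF; last by rewrite leqNgt addnS ltnS leq_addr.
  by rewrite addnK -mulrA divff ?gt_eqF// mulr1 addrC subrK.
have s00 : s 0%N = 0 by rewrite /s leq0n mulr0 mul0r.
have l0 (k : nat) : 0 <= s k.+1 - s k by rewrite sS; case: ifP => _; rewrite divr_ge0 ?subr_ge0.
have ls (k : nat) : s k <= s k <= s k.+1 by rewrite lexx /= -subr_ge0.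
have ld (k : nat) : s k.+1 - s k < d.
  rewrite sS; apply: le_lt_trans hN; rewrite [leRHS]mulrC ler_pM2r//.
  by case: ifP => _; lra.
have s_ge0 (k : nat) : 0 <= s k.
  by elim: k => [|k IHk]; [rewrite s00|apply: le_trans IHk _; rewrite -subr_ge0].
have dd1 : d <= d1 by rewrite ge_min lexx.
have dd2 : d <= d2 by rewrite ge_min lexx orbT.
have := h1 (N.+1 + N.+1)%N s s s00 s2N (fun j _ => conj (ls j) (lt_le_trans (ld j) dd1)).
have := h2 N.+1 s s s00 sN (fun j _ => conj (ls j) (lt_le_trans (ld j) dd2)).
rewrite big_split_ord /=; set S1 := \sum_(i < N.+1) _; set S2 := \sum_(i < N.+1) _.
move=> H2 H1.
have XS1 : X S1 by apply: (ip_mem_sum ip) => k; apply: (ip_memZ ip); exact: XV.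
have XS2 : X S2 by apply: (ip_mem_sum ip) => k; apply: (ip_memZ ip); exact: XV.
have sS2 (j : nat) : s (N.+1 + j).+1 - s (N.+1 + j)%N = (t - r) / N.+1%:R.
  by rewrite sS ltnNge leq_addr.
have tE : (t - r)%:C *: v = \sum_(i < N.+1) (s (N.+1 + i).+1 - s (N.+1 + i)%N)%:C *: v.
  rewrite -scaler_suml -rmorph_sum /=; congr (_%:C *: _).
  under eq_bigr do rewrite sS2.
  by rewrite sumr_const card_ord -[RHS]mulr_natl mulrCA nK mulr1.
have H3 : nrm (S2 - (t - r)%:C *: v) <= e * (t - r).
  rewrite tE -sumrB; under eq_bigr do rewrite -scalerBr.
  apply: le_trans (nrm_sum ip _ _) _ => [k|].
    by apply: (ip_memZ ip); apply: (ip_memB ip) => //; exact: XV.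
  apply: (@le_trans _ _ (\sum_(k < N.+1) (t - r) / N.+1%:R * e)).
    apply: ler_sum => k _; rewrite (nrmZr ip); last by apply: (ip_memB ip) => //; exact: XV.
    rewrite ger0_norm// sS2 ler_wpM2l//.
      by rewrite divr_ge0 ?subr_ge0.
    apply: hV; have sr j : r <= s (N.+1 + j)%N.
      elim: j => [|j IHj]; first by rewrite addn0 sN.
      by rewrite addnS; apply: le_trans IHj _; rewrite -subr_ge0.
    have st j : (j <= N.+1)%N -> s (N.+1 + (N.+1 - j))%N <= t.
      elim: j => [|j IHj] jN; first by rewrite subn0 s2N.
      apply: le_trans (IHj (ltnW jN)); rewrite -subr_ge0.
      by rewrite -{1}[(N.+1 - j)%N]prednK ?subn_gt0// -subnS addnS.
    rewrite sr /=; have := st (N.+1 - k)%N (leq_subr _ _); rewrite subKn//.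
    exact: ltnW.
  by rewrite sumr_const card_ord -[leLHS]mulr_natl mulrA mulrCA nK mulr1 mulrC.
have -> : I t - I r - (t - r)%:C *: v =
    (S2 - (t - r)%:C *: v) + ((S1 - I r) - (S1 + S2 - I t)).
  rewrite (subrACA S1) [- (S1 + S2)]opprD addNKr [- (I r - I t)]opprB [- S2 + _]addrC.
  by rewrite [RHS]addrC [RHS]addrA subrK.
have Xtv := ip_memZ ip (t - r)%:C Xv.
have X1 := ip_memB ip XS2 Xtv; have X2 := ip_memB ip XS1 XIr.
have X3 := ip_memB ip (ip_memD ip XS1 XS2) XIt.
apply: le_trans (nrmD ip X1 (ip_memB ip X2 X3)) _.
have := nrmD ip X2 (ip_memN ip X3); rewrite (nrmN ip X3); lra.
Qed.

End Riemann_integral.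

(** A mild solution need not take values in [D], where dissipativity acts, but its integral does;
    this is why integrals are compared. Since [x = A w], the integral of the reference solution is
    [T s w - w]. *)
Lemma mild_solution_uniq x V : X x -> mild_solution X nrm D A x V ->
  forall t, 0 <= t -> V t = T t x.
Proof.
move=> Xx [cV IV] t t0; have [w Dw wx] := onto Xx; have Xw := dis_sub dis Dw.
have XV s : 0 <= s -> X (V s) by move=> /cV[].
have cV' s : 0 <= s -> forall e : R, 0 < e -> exists2 d : R, 0 < d &
    forall r, 0 <= r -> `|r - s| < d -> nrm (V r - V s) < e.
  move=> s0 e e0; have [_ cVs] := cV s s0.
  exact: (within_cvg0 _ _ (fun s => nrm_ge0 dot _)).1 cVs _ e0.
have /choice[I hI] : forall s, exists I, 0 <= s ->
    [/\ is_Riemann_integral X nrm V s I, D I & V s = x + A I].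
  by move=> s; have [s0|_] := leP 0 s; [have [I] := IV s s0; exists I|exists 0].
have VI s : 0 <= s -> is_Riemann_integral X nrm V s (I s) by move=> /hI[].
have DI s : 0 <= s -> D (I s) by move=> /hI[].
have AI s : 0 <= s -> A (I s) = V s - x by move=> /hI[_ _ ->]; rewrite addrC addKr.
have XI s : 0 <= s -> X (I s) by move=> s0; exact: (dis_sub dis (DI s s0)).
(* The difference of the integrals of [V] and [T^~ x] solves [W' = A W], [W 0 = 0]. *)
pose W s := I s - (T s w - w).
have DTw s : 0 <= s -> D (T s w - w) by move=> s0; apply: dis_memB => //; exact: flowD_mem.
have DW s : 0 <= s -> D (W s) by move=> s0; apply: dis_memB; [exact: DI|exact: DTw].
have AW s : 0 <= s -> A (W s) = V s - T s x.
  move=> s0; have DTs := flowD_mem s0 Dw.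
  rewrite (disB (DI s s0) (DTw s s0)) AI// (disB DTs Dw) dis_flow// wx.
  by rewrite subrACA subrr subr0.
have XW s : 0 <= s -> X (W s) by move=> s0; exact: (dis_sub dis (DW s s0)).
(* Continuity of [W] is drawn from this Lipschitz bound, applied with [v] the value of [V] at the
   time under consideration. *)
have lipI r s v (e : R) : 0 <= r <= s -> X v ->
    (forall u, r <= u <= s -> nrm (V u - v) <= e) ->
    nrm (I s - I r) <= (e + nrm v) * (s - r).
  move=> rs Xv hv; have := Riemann_integral_near XV VI rs Xv hv.
  case/andP: rs => r0 rs; have s0 := le_trans r0 rs; have sr0 : 0 <= s - r by rewrite subr_ge0.
  have Xsr := ip_memZ ip (s - r)%:C Xv.
  have := nrm_lerB ip (ip_memB ip (XI s s0) (XI r r0)) Xsr.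
  rewrite (nrmZr ip _ Xv) ger0_norm//; lra.
have := @dissipative_decay W XW _ _ t t0.
have -> : W 0 = 0 by rewrite /W flow0// subrr subr0; exact: (Riemann_integral0 VI).
rewrite (nrm0 ip) => h; apply/eqP; rewrite -subr_eq0 -AW//.
suff -> : W t = 0 by rewrite dis0.
apply: (nrm_eq0 ip (XW t t0)); apply/eqP; rewrite eq_le nrm_ge0 andbT; apply: h.
  move=> s s0 e e0; have e20 : 0 < e / 2 by rewrite divr_gt0.
  have [d1 d10 h1] := cV' s s0 1 ltr01; have [d2 d20 h2] := flow_continuous s0 Xw e20.
  have v1 : 0 < 1 + nrm (V s) by rewrite ltr_wpDr ?nrm_ge0.
  exists (Num.min d1 (Num.min d2 (e / 2 / (1 + nrm (V s))))).
    by rewrite !lt_min d10 d20 !divr_gt0.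
  move=> r r0; rewrite !lt_min => /and3P[rs1 rs2]; rewrite ltr_pdivlMr// => rs3.
  have Xs := flow_mem s0 Xw; have Xr := flow_mem r0 Xw.
  have XIB := ip_memB ip (XI r r0) (XI s s0); have XTB := ip_memB ip Xr Xs.
  have -> : W r - W s = (I r - I s) - (T r w - T s w).
    by rewrite /W subrACA [T r w - w - _]subrACA subrr subr0.
  apply: le_lt_trans (nrmD ip XIB (ip_memN ip XTB)) _; rewrite (nrmN ip XTB).
  have h3 := h2 r r0 rs2; rewrite [ltRHS]splitr; apply: ler_ltD => //.
  apply: le_trans (ltW rs3); rewrite mulrC; have [sr|/ltW rs] := leP s r.
    rewrite ger0_norm ?subr_ge0//; apply: lipI; [by rewrite s0|exact: XV|].
    move=> u /andP[su ur]; apply/ltW/h1; first exact: le_trans su.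
    by apply: le_lt_trans rs1; rewrite !ger0_norm ?subr_ge0// lerB.
  rewrite (nrmBC ip (XI r r0) (XI s s0)) distrC ger0_norm ?subr_ge0//.
  apply: lipI; [by rewrite r0|exact: XV|].
  move=> u /andP[ru us]; apply/ltW/h1; first exact: le_trans ru.
  by apply: le_lt_trans rs1; rewrite ![`|_ - s|]distrC !ger0_norm ?subr_ge0// lerB.
move=> s s0; have s0' := ltW s0; split; first exact: DW.
move=> e e0; have e20 : 0 < e / 2 by rewrite divr_gt0.
have [d1 d10 h1] := cV' s s0' _ e20; have [d2 d20 h2] := flow_is_derivative Dw e20.
exists (Num.min d1 d2) => [|h' /andP[h0]]; first by rewrite lt_min d10.
rewrite lt_min => /andP[hd1 hd2] hs; have sh0 : 0 <= s - h' by rewrite subr_ge0.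
have shE : s - h' - s = - h' by rewrite addrAC subrr sub0r.
have XVs := XV s s0'; have XTx := flow_mem s0' Xx.
have Xs := flow_mem s0' Xw; have Xsh := flow_mem sh0 Xw.
have := h2 (s - h') s s0' sh0; rewrite shE normrN gtr0_norm// wx => /(_ hd2).
rewrite (nrm_backward _ Xsh Xs XTx) => h3.
have shs : 0 <= s - h' <= s by rewrite sh0 gerBl ltW.
have hV u : s - h' <= u <= s -> nrm (V u - V s) <= e / 2.
  move=> /andP[u1 u2]; apply/ltW/h1; first exact: le_trans u1.
  by rewrite distrC ger0_norm ?subr_ge0//; lra.
have := Riemann_integral_near XV VI shs XVs hV; rewrite subKr => h4.
have X1 := ip_memB ip (ip_memB ip (XI s s0') (XI _ sh0)) (ip_memZ ip h'%:C XVs).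
have X2 := ip_memB ip (ip_memB ip Xs Xsh) (ip_memZ ip h'%:C XTx).
have -> : W s - W (s - h') - h'%:C *: A (W s) =
    (I s - I (s - h') - h'%:C *: V s) - (T s w - T (s - h') w - h'%:C *: T s x).
  rewrite AW// /W (subrACA (I s)) [T s w - w - _]subrACA subrr subr0 scalerBr.
  by rewrite (subrACA (I s - I (s - h'))).
by apply: le_trans (nrmD ip X1 (ip_memN ip X2)) _; rewrite (nrmN ip X2); lra.
Qed.

(** Common to strong solutions and to orbits of a second semigroup; for the latter the derivative is
    verified from the left. *)
Lemma left_derivative_uniq x V : D x -> V 0 = x -> (forall t, 0 <= t -> D (V t)) ->
  (forall t, 0 <= t -> forall e : R, 0 < e -> exists2 d : R, 0 < d &
     forall s, 0 <= s -> `|s - t| < d -> nrm (V s - V t) < e) ->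
  (forall t, 0 < t -> forall e : R, 0 < e -> exists2 d : R, 0 < d &
     forall h, 0 < h < d -> h <= t -> nrm (V t - V (t - h) - h%:C *: A (V t)) <= e * h) ->
  forall t, 0 <= t -> V t = T t x.
Proof.
move=> Dx V0 DV cV dV t t0; have Xx := dis_sub dis Dx; have XA := dis_range dis Dx.
have XV s : 0 <= s -> X (V s) by move=> s0; exact: (dis_sub dis (DV s s0)).
pose W s := V s - T s x.
have XW s : 0 <= s -> X (W s) by move=> s0; apply: (ip_memB ip); [exact: XV|exact: flow_mem].
have := @dissipative_decay W XW _ _ t t0; rewrite /W V0 flow0// subrr (nrm0 ip) => h.
apply/eqP; rewrite -subr_eq0; apply/eqP/(nrm_eq0 ip (XW t t0))/eqP.
rewrite eq_le nrm_ge0 andbT; apply: h.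
  move=> s s0 e e0; have e20 : 0 < e / 2 by rewrite divr_gt0.
  have [d1 d10 h1] := cV s s0 _ e20; have [d2 d20 h2] := flow_continuous s0 Xx e20.
  exists (Num.min d1 d2) => [|r r0]; first by rewrite lt_min d10.
  rewrite lt_min => /andP[/(h1 _ r0) r1 /(h2 _ r0) r2]; rewrite subrACA.
  have X1 := ip_memB ip (XV r r0) (XV s s0).
  have X2 := ip_memB ip (flow_mem r0 Xx) (flow_mem s0 Xx).
  by apply: le_lt_trans (nrmD ip X1 (ip_memN ip X2)) _; rewrite (nrmN ip X2); lra.
move=> s s0; have s0' := ltW s0; split; first by apply: dis_memB; [exact: DV|exact: flowD_mem].
move=> e e0; have e20 : 0 < e / 2 by rewrite divr_gt0.
have [d1 d10 h1] := dV s s0 _ e20; have [d2 d20 h2] := flow_is_derivative Dx e20.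
exists (Num.min d1 d2) => [|h /andP[h0]]; first by rewrite lt_min d10.
rewrite lt_min => /andP[hd1 hd2] hs; have sh0 : 0 <= s - h by rewrite subr_ge0.
have shE : s - h - s = - h by rewrite addrAC subrr sub0r.
have XTA := flow_mem s0' XA; have XAV := dis_range dis (DV s s0').
have := h1 h; rewrite h0 hd1 => /(_ isT hs) h3.
have := h2 (s - h) s s0' sh0; rewrite shE normrN gtr0_norm// => /(_ hd2).
rewrite (nrm_backward _ (flow_mem sh0 Xx) (flow_mem s0' Xx) XTA) => h4.
have X1 := ip_memB ip (ip_memB ip (XV s s0') (XV _ sh0)) (ip_memZ ip h%:C XAV).
have X2 := ip_memB ip (ip_memB ip (flow_mem s0' Xx) (flow_mem sh0 Xx)) (ip_memZ ip h%:C XTA).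
rewrite disB ?dis_flow//; [|exact: DV|exact: flowD_mem].
rewrite scalerBr (subrACA (V s)) (subrACA (V s - V (s - h))).
by apply: le_trans (nrmD ip X1 (ip_memN ip X2)) _; rewrite (nrmN ip X2); lra.
Qed.

Lemma strong_solution_uniq x V : D x -> strong_solution X nrm D A x V ->
  forall t, 0 <= t -> V t = T t x.
Proof.
move=> Dx [cV [cXV _] V0 dV].
have DV s : 0 <= s -> D (V s) by move=> /cV[].
have XV s : 0 <= s -> X (V s) by move=> /cXV[].
apply: left_derivative_uniq => // s s0 e e0.
  by have [_ cVs] := cXV s s0; exact: (within_cvg0 _ _ (fun s => nrm_ge0 dot _)).1 cVs _ e0.
have s0' := ltW s0; have XAV := dis_range dis (DV s s0').
have [d d0 hd] := (Rplus_derivativeP s0' XV XAV).1 (dV s s0') _ e0.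
exists d => // h /andP[h0 hd1] hs; have sh0 : 0 <= s - h by rewrite subr_ge0.
have shE : s - h - s = - h by rewrite addrAC subrr sub0r.
have := hd (s - h) sh0; rewrite shE normrN gtr0_norm// => /(_ hd1).
by rewrite (nrm_backward _ (XV _ sh0) (XV s s0') XAV).
Qed.

(** * Uniform boundedness *)

Definition bounded_by (L : E -> E) (M : R) := forall x, X x -> nrm (L x) <= M * nrm x.

(** A substitute for the operator norm: [M] is halved as long as it remains a bound, and [K] is the
    last bound obtained, so [K / 2] fails at some [z]. The vector [y] shows that every bound exceeds
    [c], which makes the halving stop. *)
Lemma half_norming (L : E -> E) (M c : R) y : bounded_by L M -> 0 < c -> X y ->
  c * nrm y < nrm (L y) ->
  exists K, exists z, [/\ c < K, bounded_by L K, X z & K / 2 * nrm z < nrm (L z)].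
Proof.
move=> LM c0 Xy cy.
have ny0 : 0 < nrm y.
  rewrite lt0r nrm_ge0 andbT; apply/eqP => ny; have := LM y Xy.
  by rewrite ny mulr0 leNgt; move: cy; rewrite ny mulr0 => ->.
have cK K : bounded_by L K -> c < K.
  by move=> /(_ y Xy)/(lt_le_trans cy); rewrite ltr_pM2r.
pose Q n := ~~ `[< bounded_by L (M * 2^-1 ^+ n) >].
have exQ : exists n, Q n.
  have M0 : 0 < M by apply: lt_trans c0 _; exact: cK.
  have [n /(_ n (leqnn n)) hn] := half_pow_lt (divr_gt0 c0 M0).
  exists n; apply/asboolPn => /cK; rewrite ltr_pdivlMr// in hn.
  by rewrite mulrC ltNge (ltW hn).
case: (ex_minnP exQ) => -[|m] hm min_m.
  by move: hm => /asboolPn; rewrite expr0 mulr1.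
pose K := M * 2^-1 ^+ m.
have LK : bounded_by L K.
  by apply: contrapT => /asboolPn/min_m; rewrite ltnn.
move: hm => /asboolPn/existsNP[z /not_implyP[Xz /negP]]; rewrite -ltNge => hz.
by exists K, z; split=> //; [exact: cK|move: hz; rewrite exprSr mulrA].
Qed.

(* Sokal's elementary proof of the uniform boundedness principle. *)
Section gliding_hump.
Variables (L : nat -> E -> E) (K : nat -> R) (z : nat -> E).
Hypothesis L_mem : forall n x, X x -> X (L n x).
Hypothesis L_linear : forall n a x y, X x -> X y -> L n (a *: x + y) = a *: L n x + L n y.
Hypothesis LK : forall n, bounded_by (L n) (K n).
Hypothesis K_gt : forall n, 8 ^+ n < K n.
Hypothesis Xz : forall n, X (z n).
Hypothesis z_norming : forall n, K n / 2 * nrm (z n) < nrm (L n (z n)).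

Lemma hump_step n y : X y -> exists2 w, X w &
  nrm (w - y) <= 4^-1 ^+ n /\ K n * 4^-1 ^+ n <= 2 * nrm (L n w).
Proof.
move=> Xy; have Kn0 : 0 < K n by apply: lt_trans (K_gt n); rewrite exprn_gt0.
have nz0 : 0 < nrm (z n).
  rewrite lt0r nrm_ge0 andbT; apply/eqP => nz; have := LK n (Xz n); have := z_norming n.
  by rewrite nz !mulr0 => /lt_le_trans h /h; rewrite ltxx.
pose r := 4^-1 ^+ n / nrm (z n); have r0 : 0 < r by rewrite divr_gt0// exprn_gt0.
have rz : r * nrm (z n) = 4^-1 ^+ n by rewrite divfK// gt_eqF.
have Xr (a : R) := ip_memZ ip a%:C (Xz n).
have nr (a : R) : `|a| = r -> nrm (a%:C *: z n) = 4^-1 ^+ n.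
  by move=> ar; rewrite (nrmZr ip _ (Xz n)) ar rz.
(* One of [y + r z] and [y - r z] works, since their images differ by [2 r (L z)]. *)
pose w (a : R) := a%:C *: z n + y.
have Xw a : X (w a) by exact: (ip_memD ip).
have Lw a : L n (w a) = a%:C *: L n (z n) + L n y by exact: L_linear.
have nw a : `|a| = r -> nrm (w a - y) <= 4^-1 ^+ n.
  by move=> ar; rewrite addrK nr.
have XLz := L_mem n (Xz n).
have : K n * 4^-1 ^+ n <= nrm (L n (w r)) + nrm (L n (w (- r))).
  have XL a := L_mem n (Xw a).
  have := nrmD ip (XL r) (ip_memN ip (XL (- r))); rewrite (nrmN ip (XL _)).
  apply: le_trans; rewrite !Lw opprD addrACA subrr addr0 rmorphN scaleNr opprK.
  rewrite -scalerDl -rmorphD /= (nrmZr ip _ XLz) gtr0_norm ?addr_gt0// -rz.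
  have := ltW (z_norming n); rewrite -(ler_pM2l r0); lra.
have [rr|rr] := leP (nrm (L n (w (- r)))) (nrm (L n (w r))) => h.
  by exists (w r) => //; split; [apply: nw; rewrite gtr0_norm|lra].
by exists (w (- r)) => //; split; [apply: nw; rewrite normrN gtr0_norm|lra].
Qed.

(** Step [n] gains [K n * 4^-1 ^+ n / 2] in the norm of the image under [L n]. The later moves total
    at most [4^-1 ^+ n / 3] and lose at most [K n * 4^-1 ^+ n / 3]. A sixth remains, and
    [K n > 8 ^+ n] makes it at least [2 ^+ n / 6]. *)
Lemma gliding_hump : exists2 x, X x & forall n, 2 ^+ n <= 6 * nrm (L n x).
Proof.
have /choice[S hS] : forall ny : nat * E, exists w, X ny.2 ->
    [/\ X w, nrm (w - ny.2) <= 4^-1 ^+ ny.1 & K ny.1 * 4^-1 ^+ ny.1 <= 2 * nrm (L ny.1 w)].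
  move=> [n y]; have [Xy|nXy] := pselect (X y); last by exists 0.
  by have [w Xw [? ?]] := hump_step n Xy; exists w.
pose u := fix u n := if n is m.+1 then S (m, u m) else 0.
have Xu n : X (u n) by elim: n => [|n IHn]; [exact: (ip_mem0 ip)|have [] := hS (n, u n) IHn].
have du n : nrm (u n.+1 - u n) <= 4^-1 ^+ n by have [] := hS (n, u n) (Xu n).
have Lu n : K n * 4^-1 ^+ n <= 2 * nrm (L n (u n.+1)) by have [] := hS (n, u n) (Xu n).
have q0 n : 0 <= 4^-1 ^+ n :> R by rewrite exprn_ge0.
have cu : ncauchy dot u.
  apply: (@geometric_ncauchy u 1) => // n; apply: le_trans (du n) _.
  by rewrite mul1r lerXn2r ?nnegrE// lef_pV2 ?posrE// ler_nat.
have [x Xx ux] := cX Xu cu; exists x => // n.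
have tail m : nrm (u (n.+1 + m)%N - u n.+1) <= 4^-1 ^+ n / 3 - 4^-1 ^+ (n + m) / 3.
  elim: m => [|m IHm]; first by rewrite !addn0 !subrr (nrm0 ip).
  rewrite !addnS; apply: le_trans (nrm_distD ip (Xu _) (Xu n.+1) (Xu (n.+1 + m)%N)) _.
  apply: le_trans (lerD (du (n.+1 + m)%N) IHm) _.
  by rewrite addSn !exprS le_eqVlt; apply/orP; left; apply/eqP; field.
have hx : nrm (x - u n.+1) <= 4^-1 ^+ n / 3.
  apply: (@ncvg_bound_le _ _ _ _ ip (fun m => u (n.+1 + m)%N - u n.+1)).
  - by move=> m; exact: (ip_memB ip).
  - exact: (ip_memB ip).
  - move=> e e0; have [N hN] := ux e e0; exists N => m Nm.
    by rewrite opprB addrA subrK; apply: hN; rewrite (leq_trans Nm)// leq_addl.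
  - by move=> m; apply: le_trans (tail m) _; rewrite gerBl divr_ge0.
have XB := ip_memB ip Xx (Xu n.+1).
have LE : L n (u n.+1) = L n x - L n (x - u n.+1).
  have := L_linear n (- 1) XB Xx; rewrite !scaleN1r opprB subrK => ->.
  by rewrite addrC.
have := nrmD ip (L_mem n Xx) (ip_memN ip (L_mem n XB)); rewrite -LE (nrmN ip (L_mem n XB)).
have Kn0 : 0 < K n by apply: lt_trans (K_gt n); rewrite exprn_gt0.
have := LK n XB; have := Lu n; have := ler_wpM2l (ltW Kn0) hx.
have : 2 ^+ n <= K n * 4^-1 ^+ n.
  have -> : 2 ^+ n = 8 ^+ n * 4^-1 ^+ n :> R by rewrite -exprMn; congr (_ ^+ _); lra.
  by rewrite ler_wpM2r// ltW.
lra.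
Qed.

End gliding_hump.

(** * Uniqueness of the semigroup generated by [A] *)

Section generated_semigroup.
Variable S : R -> E -> E.
Hypothesis S_C0 : semigroup_C0 X nrm S.
Hypothesis S_generated : generates X nrm D A S.

Let S_mem t x : 0 <= t -> X x -> X (S t x).
Proof. by case: S_C0 => + _ _ _ _ => h t0; exact: h. Qed.

Let S_linear t a x y : 0 <= t -> X x -> X y -> S t (a *: x + y) = a *: S t x + S t y.
Proof. by case: S_C0 => _ + _ _ _ => h t0; exact: h. Qed.

Let SB t x y : 0 <= t -> X x -> X y -> S t (x - y) = S t x - S t y.
Proof.
by move=> t0 Xx Xy; rewrite addrC -scaleN1r S_linear// scaleN1r addrC.
Qed.

Let SZ t a x : 0 <= t -> X x -> S t (a *: x) = a *: S t x.
Proof.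
move=> t0 Xx; have X0 := ip_mem0 ip.
have S0 : S t 0 = 0 by rewrite -[X in S t X](subrr 0) SB// subrr.
by have := S_linear a t0 Xx X0; rewrite !addr0 S0 addr0.
Qed.

Let S0 x : X x -> S 0 x = x.
Proof. by case: S_C0 => _ _ _ [h _] _; exact: h. Qed.

Let SS s t x : 0 <= s -> 0 <= t -> X x -> S (s + t) x = S s (S t x).
Proof. by case: S_C0 => _ _ _ [_ h] _ s0 t0; exact: h. Qed.

Let S_continuous0 x (e : R) : X x -> 0 < e ->
  exists2 d : R, 0 < d & forall s, 0 <= s < d -> nrm (S s x - x) < e.
Proof.
move=> Xx e0; case: S_C0 => _ _ _ _ /(_ x Xx) cS.
have [d d0 hd] := (at_right_cvg0 (fun s => nrm_ge0 dot _)).1 cS e e0.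
exists d => // s /andP[]; rewrite le_eqVlt => /orP[/eqP<- _|s0 sd].
  by rewrite S0// subrr (nrm0 ip).
by apply: hd; rewrite s0.
Qed.

(** Otherwise there are times below [2^-1 ^+ n] at which [8 ^+ n] is not a bound; the gliding hump
    gives one vector whose images at these times are unbounded, against strong continuity at 0. *)
Lemma generated_bounded_near0 : exists2 d : R, 0 < d & exists M : R,
  forall t, 0 <= t < d -> bounded_by (S t) M.
Proof.
apply: contrapT => unb.
have /choice[p hp] : forall n : nat, exists p : R * R * E,
    [/\ 0 <= p.1.1 < 2^-1 ^+ n, 8 ^+ n < p.1.2, bounded_by (S p.1.1) p.1.2, X p.2 &
        p.1.2 / 2 * nrm p.2 < nrm (S p.1.1 p.2)].
  move=> n; have [t [tn [y Xy hy]]] : exists t, 0 <= t < 2^-1 ^+ n /\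
      exists2 y, X y & 8 ^+ n * nrm y < nrm (S t y).
    apply: contrapT => h; apply: unb; exists (2^-1 ^+ n) => //; exists (8 ^+ n) => t tn y Xy.
    by rewrite leNgt; apply/negP => hy; apply: h; exists t; split=> //; exists y.
  have t0 : 0 <= t by case/andP: tn.
  have [_ _ /(_ t t0)[M hM] _ _] := S_C0.
  have c0 : 0 < 8 ^+ n :> R by rewrite exprn_gt0.
  have [K [z [cK LK Xz hz]]] := half_norming hM c0 Xy hy.
  by exists (t, K, z).
pose t n := (p n).1.1.
have t0 n : 0 <= t n by have [/andP[]] := hp n.
have [||||||x Xx hx] := @gliding_hump (S \o t) (fun n => (p n).1.2) (fun n => (p n).2).
- by move=> n x; exact: S_mem.
- by move=> n a x y; exact: S_linear.
- by move=> n; have [] := hp n.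
- by move=> n; have [] := hp n.
- by move=> n; have [] := hp n.
- by move=> n; have [] := hp n.
have [d d0 hd] := S_continuous0 Xx ltr01.
have c0 : 0 < (6 * (1 + nrm x))^-1.
  by rewrite invr_gt0 mulr_gt0// ltr_wpDr ?nrm_ge0.
have [N1 hN1] := half_pow_lt d0; have [N2 hN2] := half_pow_lt c0.
set n := maxn N1 N2; have {}hN1 := hN1 n (leq_maxl _ _); have := hN2 n (leq_maxr _ _).
rewrite exprVn ltf_pV2 ?posrE ?exprn_gt0 ?mulr_gt0 ?ltr_wpDr ?nrm_ge0// => h1.
have := hd (t n); rewrite t0 (lt_trans _ hN1); last by have [/andP[]] := hp n.
move=> /(_ isT) h2; have := nrm_lerB ip (S_mem (t0 n) Xx) Xx.
by have /= := hx n; lra.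
Qed.

Lemma generated_bounded t : exists2 M : R, 1 <= M & forall s, 0 <= s <= t -> bounded_by (S s) M.
Proof.
have [d d0 [M0 hM0]] := generated_bounded_near0; pose M := 1 + `|M0|.
have M1 : 1 <= M by rewrite lerDl.
have hM s : 0 <= s < d -> bounded_by (S s) M.
  move=> sd x Xx; apply: le_trans (hM0 s sd x Xx) _; rewrite ler_wpM2r ?nrm_ge0//.
  by apply: le_trans (ler_norm _) _; rewrite lerDr.
(* Steps of length [d / 2], since the bound is known for times strictly below [d]. *)
have d20 : 0 < d / 2 by rewrite divr_gt0.
have step n : forall s, 0 <= s <= n%:R * (d / 2) -> bounded_by (S s) (M ^+ n).
  elim: n => [|n IHn] s /andP[s0 sn] x Xx.
    move: sn; rewrite mul0r => sn; have -> : s = 0 by apply/eqP; rewrite eq_le sn.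
    by rewrite S0// expr0 mul1r.
  have [sd|ds] := ltP s d.
    apply: le_trans (hM s _ x Xx) _; first by rewrite s0.
    by rewrite ler_wpM2r ?nrm_ge0// exprS ler_peMr ?exprn_ege1// (le_trans _ M1).
  have sd0 : 0 <= s - d / 2 by lra.
  rewrite -(subrKC (d / 2) s) SS// ?(ltW d20)//.
  apply: le_trans (hM (d / 2) _ _ (S_mem sd0 Xx)) _; first by apply/andP; split; lra.
  rewrite exprS -mulrA ler_wpM2l ?(le_trans _ M1)//; apply: IHn => //.
  by move: sn; rewrite -natr1 sd0 /=; lra.
pose n := (Num.truncn (t / (d / 2))).+1; exists (M ^+ n); first by rewrite exprn_ege1.
move=> s /andP[s0 st]; apply: step; rewrite s0 /=; apply: le_trans st _.
by rewrite -ler_pdivrMr//; apply/ltW/truncnS_gt.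
Qed.

Lemma generated_continuous t x (e : R) : 0 <= t -> X x -> 0 < e ->
  exists2 d : R, 0 < d & forall s, 0 <= s -> `|s - t| < d -> nrm (S s x - S t x) < e.
Proof.
move=> t0 Xx e0; have [M M1 hM] := generated_bounded (t + 1).
have M0 : 0 < M by exact: lt_le_trans M1.
have [d d0 hd] := S_continuous0 Xx (divr_gt0 e0 M0).
exists (Num.min d 1) => [|s s0]; first by rewrite lt_min d0/=.
rewrite lt_min => /andP[sd s1].
have main r q : 0 <= r -> r <= q -> q <= t + 1 -> q - r < d -> nrm (S q x - S r x) < e.
  move=> r0 rq qt qd; have qr0 : 0 <= q - r by rewrite subr_ge0.
  rewrite -{1}(subrKC r q) SS// -SB//; last exact: S_mem.
  have := hd (q - r); rewrite qr0 qd => /(_ isT); rewrite ltr_pdivlMr// mulrC.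
  apply: le_lt_trans; apply: hM; last by apply: (ip_memB ip) => //; exact: S_mem.
  by rewrite r0 (le_trans rq).
move: sd s1; have [ts|/ltW st] := leP t s.
  by rewrite ger0_norm ?subr_ge0// => sd s1; apply: main => //; lra.
rewrite (nrmBC ip (S_mem s0 Xx) (S_mem t0 Xx)) distrC ger0_norm ?subr_ge0// => sd s1.
by apply: main => //; lra.
Qed.

Lemma generated_derivative0 x (e : R) : D x -> 0 < e ->
  exists2 d : R, 0 < d & forall s, 0 < s < d -> nrm (S s x - x - s%:C *: A x) <= e * s.
Proof.
move=> Dx e0; have [Xx XA] := (S_generated x (A x)).1 (conj Dx erefl).
move=> /(at_right_cvg0 (fun s => nrm_ge0 dot _))/(_ e e0)[d d0 hd].
exists d => // s /[dup] /andP[s0 _] /hd/ltW h.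
have Xq := ip_memB ip (ip_memZ ip (s^-1)%:C (ip_memB ip (S_mem (ltW s0) Xx) Xx)) XA.
have -> : S s x - x - s%:C *: A x = s%:C *: ((s^-1)%:C *: (S s x - x) - A x).
  by rewrite [RHS]scalerBr scalerA -rmorphM /= mulfV ?gt_eqF// scale1r.
by rewrite (nrmZr ip _ Xq) gtr0_norm// mulrC ler_pM2r.
Qed.

(** The difference quotient at [S t x] is the image under [S t] of the quotient at [x]. It converges
    by boundedness of [S t], and the limit puts [S t x] in [D] because the generator is exactly
    [A]. *)
Lemma generated_dom t x : 0 <= t -> D x -> D (S t x) /\ A (S t x) = S t (A x).
Proof.
move=> t0 Dx; have Xx := dis_sub dis Dx; have XA := dis_range dis Dx.
have XS := S_mem t0 Xx; have XSA := S_mem t0 XA.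
suff [? ->] : D (S t x) /\ S t (A x) = A (S t x) by [].
apply/S_generated; split=> //; apply/at_right_cvg0 => [s|e e0]; first exact: nrm_ge0.
have [M M1 hM] := generated_bounded t; have M0 : 0 < M by exact: lt_le_trans M1.
have e20 : 0 < e / 2 by rewrite divr_gt0.
have [d d0 hd] := generated_derivative0 Dx (divr_gt0 e20 M0).
exists d => // s /[dup] sd /andP[s0 _]; have s0' := ltW s0.
have Xs := S_mem s0' Xx; have Xd := ip_memB ip Xs Xx; have XsA := ip_memZ ip s%:C XA.
have -> : (s^-1)%:C *: (S s (S t x) - S t x) - S t (A x) =
    (s^-1)%:C *: S t (S s x - x - s%:C *: A x).
  rewrite SB// SB// SZ// -!SS// [t + s]addrC scalerBr [in RHS]scalerBr.
  by rewrite [in RHS]scalerBr !scalerA -!rmorphM /= mulVf ?gt_eqF// scale1r.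
have Xr := ip_memB ip Xd XsA.
rewrite (nrmZr ip _ (S_mem t0 Xr)) gtr0_norm ?invr_gt0//.
rewrite mulrC ltr_pdivrMr//; apply: le_lt_trans (hM t _ _ Xr) _; first by rewrite t0 lexx.
have := hd s sd; rewrite -(ler_pM2l M0) => h; apply: le_lt_trans h _.
by rewrite mulrA [M * _]mulrC divfK ?gt_eqF// ltr_pM2r//; lra.
Qed.

Lemma generated_semigroup_uniq t x : 0 <= t -> X x -> S t x = T t x.
Proof.
move=> t0; have main y : D y -> forall s, 0 <= s -> S s y = T s y.
  move=> Dy; have Xy := dis_sub dis Dy; have XA := dis_range dis Dy.
  apply: (left_derivative_uniq Dy (S0 Xy)).
  - by move=> s s0; have [] := generated_dom s0 Dy.
  - by move=> s s0 e; exact: generated_continuous.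
  move=> s s0 e e0; have s0' := ltW s0; have [_ ->] := generated_dom s0' Dy.
  have [M M1 hM] := generated_bounded s; have M0 : 0 < M by exact: lt_le_trans M1.
  have e20 : 0 < e / 2 by rewrite divr_gt0.
  have [d1 d10 h1] := generated_derivative0 Dy (divr_gt0 e20 M0).
  have [d2 d20 h2] := generated_continuous s0' XA e20.
  exists (Num.min d1 d2) => [|h /andP[h0]]; first by rewrite lt_min d10.
  rewrite lt_min => /andP[hd1 hd2] hs; have sh0 : 0 <= s - h by rewrite subr_ge0.
  have h0' := ltW h0; have Xh := S_mem h0' Xy; have XhA := ip_memZ ip h%:C XA.
  have Xd := ip_memB ip (ip_memB ip Xh Xy) XhA.
  have XSd := S_mem sh0 Xd; have XSA := S_mem s0' XA; have XShA := S_mem sh0 XA.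
  (* The increment is expanded from [s - h], where the semigroup law gives the derivative at 0
     transported by [S (s - h)]. The local bound on this operator and continuity of the orbit of
     [A y] control the two terms. *)
  have -> : S s y - S (s - h) y - h%:C *: S s (A y) =
      S (s - h) (S h y - y - h%:C *: A y) + h%:C *: (S (s - h) (A y) - S s (A y)).
    rewrite SB//; last exact: (ip_memB ip).
    by rewrite SB// SZ// -SS// subrK scalerBr addrA subrK.
  have XB := ip_memB ip XShA XSA.
  apply: le_trans (nrmD ip XSd (ip_memZ ip h%:C XB)) _.
  rewrite (nrmZr ip _ XB) gtr0_norm//.
  have h3 : nrm (S (s - h) (A y) - S s (A y)) < e / 2.
    by apply: h2 => //; rewrite addrAC subrr sub0r normrN gtr0_norm.
  have := hM (s - h) _ _ Xd; rewrite sh0 gerBl h0' => /(_ isT) h4.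
  have := h1 h; rewrite h0 hd1 => /(_ isT); rewrite -(ler_pM2l M0) => h5.
  have := le_trans h4 h5; rewrite mulrA [M * _]mulrC divfK ?gt_eqF//.
  by have := ler_wpM2l h0' (ltW h3); lra.
move=> Xx; apply/eqP; rewrite -subr_eq0; apply/eqP.
have XS := S_mem t0 Xx; have XT := flow_mem t0 Xx.
apply: (nrm_eq0 ip (ip_memB ip XS XT)); apply/eqP; rewrite eq_le nrm_ge0 andbT.
apply/ler_addgt0Pl => e e0; rewrite addr0.
have [M M1 hM] := generated_bounded t; have M0 : 0 < M + 1 by lra.
have [y Dy xy] := dense_domain Xx (divr_gt0 e0 M0); have Xy := dis_sub dis Dy.
have XB := ip_memB ip Xx Xy.
have XTy := flow_mem t0 Xy; have := nrm_distD ip XS XT XTy.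
rewrite -[X in _ <= nrm (_ - X) + _](main y Dy t t0) -(SB t0 Xx Xy) (nrmBC ip XTy XT) -flowB//.
have := hM t _ _ XB; rewrite t0 lexx => /(_ isT); have := flow_nrm t0 XB.
by move: xy; rewrite ltr_pdivlMr//; lra.
Qed.

End generated_semigroup.

Lemma generation_theorem : exists T : R -> E -> E,
  [/\ is_C0_semigroup_generated_by X nrm D A T,
      forall T', is_C0_semigroup_generated_by X nrm D A T' ->
        forall t x, 0 <= t -> X x -> T' t x = T t x,
      forall x, X x -> unique_solution (mild_solution X nrm D A x) (T^~ x) &
      forall x, D x -> unique_solution (strong_solution X nrm D A x) (T^~ x)].
Proof.
exists T; split=> [|T' [C0 gen] t x|x Xx|x Dx].
- by split; [exact: flow_semigroup|exact: flow_generates].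
- exact: generated_semigroup_uniq.
- by split; [exact: flow_mild|move=> V; exact: mild_solution_uniq].
- by split; [exact: flow_strong|move=> V; exact: strong_solution_uniq].
Qed.

End generation.

(** * The coupled wave operator *)

Section product_space.
Context {R : realType} {E F : lmodType R[i]}.
Variables (X : set E) (Y : set F) (dX : E -> E -> R[i]) (dY : F -> F -> R[i]).
Hypotheses (ipX : inner_product_on X dX) (ipY : inner_product_on Y dY).

(** The energy space is a product of four spaces; its inner product axioms and its completeness
    result from three uses of this binary construction. *)
Definition dot_prod (p q : E * F) : R[i] := dX p.1 q.1 + dY p.2 q.2.
Local Notation XY := [set p : E * F | X p.1 /\ Y p.2].

Lemma dot_prod_inner_product : inner_product_on XY dot_prod.
Proof.
split.
- by split; [exact: (ip_mem0 ipX)|exact: (ip_mem0 ipY)].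
- by move=> a p q [? ?] [? ?]; split; [exact: (ip_memP ipX)|exact: (ip_memP ipY)].
- move=> a p q r [? ?] [? ?] [? ?]; rewrite /dot_prod /= (ip_linear ipX)// (ip_linear ipY)//.
  by rewrite mulrDr addrACA.
- move=> p q [? ?] [? ?]; rewrite /dot_prod (ip_conj ipX (x := p.1))//.
  by rewrite (ip_conj ipY (x := p.2))// rmorphD.
- by move=> p [? ?]; rewrite ReD addr_ge0 ?(ip_ge0 ipX) ?(ip_ge0 ipY).
- move=> [p1 p2] [/= X1 Y2] /eqP; rewrite ReD /= paddr_eq0 ?(ip_ge0 ipX) ?(ip_ge0 ipY)//.
  by move=> /andP[/eqP/(ip_eq0 ipX X1)-> /eqP/(ip_eq0 ipY Y2)->].
Qed.

Lemma nrm_fst_le p : XY p -> nrm dX p.1 <= nrm dot_prod p.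
Proof.
by move=> [? ?]; rewrite ler_sqrt /rdot ReD ?addr_ge0 ?lerDl ?(ip_ge0 ipX) ?(ip_ge0 ipY).
Qed.

Lemma nrm_snd_le p : XY p -> nrm dY p.2 <= nrm dot_prod p.
Proof.
by move=> [? ?]; rewrite ler_sqrt /rdot ReD ?addr_ge0 ?lerDr ?(ip_ge0 ipX) ?(ip_ge0 ipY).
Qed.

Lemma nrm_prod_le p : XY p -> nrm dot_prod p <= nrm dX p.1 + nrm dY p.2.
Proof.
move=> [X1 Y2]; suff : nrm dot_prod p ^+ 2 <= (nrm dX p.1 + nrm dY p.2) ^+ 2.
  by rewrite ler_pXn2r ?nnegrE ?addr_ge0 ?nrm_ge0.
rewrite (nrm_sqr dot_prod_inner_product)// sqrrD (nrm_sqr ipX)// (nrm_sqr ipY)//.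
by rewrite /rdot ReD lerD2r lerDl mulrn_wge0// mulr_ge0 ?nrm_ge0.
Qed.

Lemma dot_prod_complete : complete_on X dX -> complete_on Y dY -> complete_on XY dot_prod.
Proof.
move=> cX cY u XYu cu.
have XYB m n : XY (u m - u n) := ip_memB dot_prod_inner_product (XYu m) (XYu n).
have [|l Xl ul] := cX (fun n => (u n).1) (fun n => (XYu n).1).
  move=> e e0; have [N hN] := cu e e0; exists N => m n Nm Nn.
  exact: le_lt_trans (nrm_fst_le (XYB m n)) (hN m n Nm Nn).
have [|m Ym um] := cY (fun n => (u n).2) (fun n => (XYu n).2).
  move=> e e0; have [N hN] := cu e e0; exists N => m n Nm Nn.
  exact: le_lt_trans (nrm_snd_le (XYB m n)) (hN m n Nm Nn).
exists (l, m) => // e e0; have e20 : 0 < e / 2 by rewrite divr_gt0.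
have [N hN] := ul _ e20; have [M hM] := um _ e20; exists (maxn N M) => n.
rewrite geq_max => /andP[/hN h1 /hM h2].
have XYlm : XY (l, m) by [].
have XYl := ip_memB dot_prod_inner_product (XYu n) XYlm.
by apply: le_lt_trans (nrm_prod_le XYl) _; rewrite [ltRHS]splitr; exact: ltrD h1 h2.
Qed.

End product_space.

Lemma linear_subE {K : pzRingType} {V : lmodType K} (a : K) (x y p q r s : V) :
  x = a *: p + q -> y = a *: r + s -> x - y = a *: (p - r) + (q - s).
Proof. by move=> -> ->; rewrite opprD scalerBr addrACA. Qed.

Lemma linear_addE {K : pzRingType} {V : lmodType K} (a : K) (x y p q r s : V) :
  x = a *: p + q -> y = a *: r + s -> x + y = a *: (p + r) + (q + s).
Proof. by move=> -> ->; rewrite scalerDr addrACA. Qed.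

Lemma Ad_arith {V : realDomainType} (B G1 G2 c1 : V) : 0 <= B ->
  (- (G1 + B) - c1) + G1 + (- G2 + c1) + G2 <= 0.
Proof. lra. Qed.

(** Here [N] is the energy norm of the image, [Cp] the Poincare constant, [Mb] and [Mc] bound the
    multiplications, and [nn] is the dimension; [u] and [y] are gradient norms, [v] and [z] are
    norms in [L2], [dF] and [dy] are the norms of the two divergences, [cz] and [cv] those of the
    coupling terms, and [s] that of the damping flux. The constant collects the four bounds. *)
Lemma Ad_bound_arith {V : realFieldType} (Cp Mb Mc N nn u v y z dF dy cz cv s : V) :
  0 <= Cp -> 0 <= Mc -> 0 <= N ->
  u <= Cp * dF + s -> s <= nn * (Mb * N) -> dF <= cz + N -> cz <= Mc * z ->
  z <= Cp * N -> v <= Cp * N -> y <= Cp * dy -> dy <= N + cv -> cv <= Mc * v ->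
  u + v + y + z <= (2 * Cp * (2 + Mc * Cp) + nn * Mb) * N.
Proof.
move=> C0 M0 N0 hu hs hF hcz hz hv hy hdy hcv.
have h1 := ler_wpM2l C0 (le_trans hF (lerD (le_trans hcz (ler_wpM2l M0 hz)) (lexx _))).
have h2 := ler_wpM2l C0 (le_trans hdy (lerD (lexx N) (le_trans hcv (ler_wpM2l M0 hv)))).
lra.
Qed.

Section wave_operator.
Context {R : realType} {n : nat}.
Variable Omega : set 'rV[R]_n.
Hypothesis oOmega : open Omega.
Hypothesis bOmega : bounded_set Omega.
Variable i0 : 'I_n.
Variables b c : 'rV[R]_n -> R.
Hypothesis boo : Linfty Omega b.
Hypothesis coo : Linfty Omega c.
Hypothesis b_ge0 : {ae @lebesgue_rV R n, forall x, Omega x -> 0 <= b x}.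
Local Notation aefun := (aefun Omega).
Local Notation L2 := (@L2 R n Omega).
Local Notation H10 := (@H10 R n Omega).
Local Notation dotL2 := (@dotL2 R n Omega).
Local Notation dotgrad := (@dotgrad R n Omega).
Local Notation grad := (@grad R n Omega).
Local Notation ipL2 := (dotL2_inner_product oOmega).
Local Notation ipG := (dotgrad_inner_product oOmega bOmega i0).
Local Notation L2D := (ip_memD ipL2).
Local Notation L2B := (ip_memB ipL2).
Local Notation flux := (@flux R n Omega b).
#[local] Opaque rdot nrm Defs.dotL2 Defs.dotgrad Defs.grad Defs.mulf Defs.divergence.
Implicit Types (p q : 'I_n -> aefun) (f g u v w y z : aefun).

Local Notation dot4 := (dot_prod (dot_prod (dot_prod dotgrad dotL2) dotgrad) dotL2).

Lemma dotE_prod : @dotE R n Omega = dot4.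
Proof.
apply/funext => -[[[u v] y] z]; apply/funext => -[[[u1 v1] y1] z1].
by rewrite /dotE /dot_prod /= [dotgrad u u1 + _]addrC [RHS]addrAC.
Qed.

Lemma energy_space_prod : energy_space Omega =
  [set U | [set p | [set p | H10 p.1 /\ L2 p.2] p.1 /\ H10 p.2] U.1 /\ L2 U.2].
Proof.
by apply/seteqP; split => -[[[u v] y] z] /=; [case|move=> [[[? ?] ?] ?]].
Qed.

Lemma dotE_inner_product : inner_product_on (energy_space Omega) (@dotE R n Omega).
Proof.
rewrite dotE_prod energy_space_prod.
have i2 := dot_prod_inner_product ipG ipL2; have i3 := dot_prod_inner_product i2 ipG.
exact: dot_prod_inner_product i3 ipL2.
Qed.

Lemma dotE_complete : complete_on (energy_space Omega) (@dotE R n Omega).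
Proof.
rewrite dotE_prod energy_space_prod.
have cL := L2_complete oOmega; have cG := dotgrad_complete oOmega bOmega i0.
have i2 := dot_prod_inner_product ipG ipL2; have i3 := dot_prod_inner_product i2 ipG.
have c2 := dot_prod_complete ipG ipL2 cG cL.
exact: dot_prod_complete i3 ipL2 (dot_prod_complete i2 ipG c2 cG) cL.
Qed.

Lemma nrm_dotE_le u v y z : energy_space Omega (u, v, y, z) ->
  nrm (@dotE R n Omega) (u, v, y, z) <=
    nrm dotgrad u + nrm dotL2 v + nrm dotgrad y + nrm dotL2 z.
Proof.
move=> [Hu Lv Hy Lz]; rewrite dotE_prod.
have i2 := dot_prod_inner_product ipG ipL2; have i3 := dot_prod_inner_product i2 ipG.
have h1 := nrm_prod_le i3 ipL2 (p := (u, v, y, z)) (conj (conj (conj Hu Lv) Hy) Lz).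
have h2 := nrm_prod_le i2 ipG (p := (u, v, y)) (conj (conj Hu Lv) Hy).
have h3 := nrm_prod_le ipG ipL2 (p := (u, v)) (conj Hu Lv).
exact: le_trans h1 (lerD (le_trans h2 (lerD h3 (lexx _))) (lexx _)).
Qed.

Lemma nrm_le_dotE u v y z : energy_space Omega (u, v, y, z) ->
  let N := nrm (@dotE R n Omega) (u, v, y, z) in
  [/\ nrm dotgrad u <= N, nrm dotL2 v <= N, nrm dotgrad y <= N & nrm dotL2 z <= N].
Proof.
move=> [Hu Lv Hy Lz] N; rewrite /N dotE_prod.
have i2 := dot_prod_inner_product ipG ipL2; have i3 := dot_prod_inner_product i2 ipG.
have m3 := conj (conj Hu Lv) Hy; have m4 := conj m3 Lz.
have h1 := nrm_fst_le i3 ipL2 (p := (u, v, y, z)) m4.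
have h2 := le_trans (nrm_fst_le i2 ipG (p := (u, v, y)) m3) h1.
split.
- exact: le_trans (nrm_fst_le ipG ipL2 (p := (u, v)) (conj Hu Lv)) h2.
- exact: le_trans (nrm_snd_le ipG ipL2 (p := (u, v)) (conj Hu Lv)) h2.
- exact: le_trans (nrm_snd_le i2 ipG (p := (u, v, y)) m3) h1.
- exact: (nrm_snd_le i3 ipL2 (p := (u, v, y, z)) m4).
Qed.

Lemma rdotvD p q w : (forall i, L2 (p i)) -> (forall i, L2 (q i)) -> H10 w ->
  rdotv (fun i => p i + q i) (grad w) = rdotv p (grad w) + rdotv q (grad w).
Proof.
move=> Lp Lq Hw; rewrite /rdotv -big_split /=; apply: eq_bigr => i _.
exact: (rdotDl ipL2 (Lp i) (Lq i) (H10_L2_grad oOmega bOmega i Hw)).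
Qed.

(** The weak form prescribes the inner product of the gradients of [u] and [w] as [ell w], which the
    Poincare inequality makes bounded on [H10], so the Riesz theorem applies. The field [q] will be
    the damping flux, a datum once the velocity is known. *)
Lemma weak_div_solve q f : (forall i, L2 (q i)) -> L2 f ->
  exists2 u, H10 u & weak_div (fun i => grad u i + q i) f.
Proof.
move=> Lq Lf; have [C C0 hC] := Poincare oOmega bOmega i0.
pose ell w := - (rdot dotL2 f w + rdotv q (grad w)).
have ellE w : ell w = - (rdot dotL2 f w + rdotv q (grad w)) by [].
have ellD x y : H10 x -> H10 y -> ell (x + y) = ell x + ell y.
  move=> Hx Hy; rewrite /ell (rdotDr ipL2 (H10_L2 Hx) (H10_L2 Hy) Lf).
  have -> : rdotv q (grad (x + y)) = rdotv q (grad x) + rdotv q (grad y).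
    rewrite /rdotv -big_split /=; apply: eq_bigr => i _.
    have := grad_linear oOmega bOmega 1 i (H10_H1 Hx) (H10_H1 Hy); rewrite !scale1r => ->.
    have Lx := H10_L2_grad oOmega bOmega i Hx; have Ly := H10_L2_grad oOmega bOmega i Hy.
    exact: (rdotDr ipL2 Lx Ly (Lq i)).
  by rewrite addrACA opprD.
have ellZ (k : R) x : H10 x -> ell (k%:C *: x) = k * ell x.
  move=> Hx; rewrite /ell (rdotZr ipL2 k (H10_L2 Hx) Lf).
  have -> : rdotv q (grad (k%:C *: x)) = k * rdotv q (grad x).
    rewrite /rdotv mulr_sumr; apply: eq_bigr => i _.
    have := grad_linear oOmega bOmega k%:C i (H10_H1 Hx) (H1_0 oOmega).
    rewrite addr0 (grad0 oOmega bOmega) addr0 => ->.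
    exact: (rdotZr ipL2 k (H10_L2_grad oOmega bOmega i Hx) (Lq i)).
  by rewrite mulrN mulrDr.
have ell_le x : H10 x -> `|ell x| <=
    (nrm dotL2 f * C + \sum_(i < n) nrm dotL2 (q i)) * nrm dotgrad x.
  move=> Hx; rewrite /ell normrN mulrDl; apply: le_trans (ler_normD _ _) _.
  apply: lerD; last exact: (rdotv_le oOmega bOmega Lq (H10_H1 Hx)).
  apply: le_trans (rdot_le ipL2 Lf (H10_L2 Hx)) _.
  by have := ler_wpM2l (nrm_ge0 dotL2 f) (hC x Hx); rewrite [nrm dotL2 f * (_ * _)]mulrA.
have [u Hu uE] := Riesz_representation ipG ellD ellZ ell_le
  (dotgrad_complete oOmega bOmega i0).
have Lgu i := H10_L2_grad oOmega bOmega i Hu.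
exists u => //; apply: (weak_div_real oOmega bOmega) => // [i|w Hw].
  exact: L2D (Lgu i) (Lq i).
rewrite (rdotvD Lgu Lq Hw) rdotv_grad (uE w Hw) ellE opprD.
by rewrite addrNK.
Qed.

(** Green's formula is tested with [u] itself; one factor [nrm dotgrad u] cancels on both sides. *)
Lemma weak_div_bound (C : R) q f u : 0 <= C -> (forall w, H10 w -> nrm dotL2 w <= C * nrm dotgrad w) ->
  (forall i, L2 (q i)) -> L2 f -> H10 u ->
  weak_div (fun i => grad u i + q i) f ->
  nrm dotgrad u <= C * nrm dotL2 f + \sum_(i < n) nrm dotL2 (q i).
Proof.
move=> C0 hC Lq Lf Hu wf; have Lgu i := H10_L2_grad oOmega bOmega i Hu.
set s := \sum_(i < n) _.
have Lgq i : L2 (grad u i + q i) := L2D (Lgu i) (Lq i).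
have := Green oOmega bOmega Lgq Lf wf Hu.
rewrite (rdotvD Lgu Lq Hu) rdotv_grad -(nrm_sqr ipG Hu) => h.
have h1 := rdotv_le oOmega bOmega Lq (H10_H1 Hu).
have h2 := le_trans (rdot_le ipL2 Lf (H10_L2 Hu)) (ler_wpM2l (nrm_ge0 dotL2 f) (hC u Hu)).
have G0 := nrm_ge0 dotgrad u; have N0 := nrm_ge0 dotL2 f.
have s0 : 0 <= s by apply: sumr_ge0 => i _; exact: nrm_ge0.
move: h h1 h2 G0 N0 s0; rewrite -/s.
move: (nrm dotgrad u) (rdotv _ _) (rdot _ _ _) (nrm dotL2 f) s => G A B N s.
rewrite !ler_norml => h /andP[h1 h1'] /andP[h2 h2'] G0 N0 s0.
have CN := mulr_ge0 C0 N0.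
move: G0; rewrite le_eqVlt => /orP[/eqP <-|G0]; first exact: addr_ge0.
by rewrite -(ler_pM2r G0) mulrDl -expr2; lra.
Qed.

Lemma L2_flux u v i : H10 u -> H10 v -> L2 (flux u v i).
Proof.
move=> Hu Hv; apply: L2D (H10_L2_grad oOmega bOmega i Hu) _.
exact: (L2_mulf oOmega boo (H10_L2_grad oOmega bOmega i Hv)).
Qed.

Lemma flux_linear a u v u' v' : H10 u -> H10 v -> H10 u' -> H10 v' ->
  flux (a *: u + u') (a *: v + v') = (fun i => a *: flux u v i + flux u' v' i).
Proof.
move=> Hu Hv Hu' Hv'; apply/funext => i; rewrite /flux.
rewrite (grad_linear oOmega bOmega a i (H10_H1 Hu) (H10_H1 Hu')).
rewrite (grad_linear oOmega bOmega a i (H10_H1 Hv) (H10_H1 Hv')).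
have Lv := H10_L2_grad oOmega bOmega i Hv; have Lv' := H10_L2_grad oOmega bOmega i Hv'.
by rewrite (mulf_linear oOmega boo a Lv Lv') [in RHS]scalerDr addrACA.
Qed.

Lemma divergence_linear a p q : (forall i, L2 (p i)) -> (forall i, L2 (q i)) ->
  div_in_L2 p -> div_in_L2 q ->
  div_in_L2 (fun i => a *: p i + q i) /\
  divergence (fun i => a *: p i + q i) = a *: divergence p + divergence q.
Proof.
move=> Lp Lq /divergenceP[Ldp wp] /divergenceP[Ldq wq].
have wpq := weak_div_linear oOmega a Lp Lq Ldp Ldq wp wq.
have Lpq i : L2 (a *: p i + q i) := L2_memP oOmega a (Lp i) (Lq i).
have Ld := L2_memP oOmega a Ldp Ldq; split; first by exists (a *: divergence p + divergence q).
exact: (divergence_uniq oOmega bOmega Lpq Ld wpq).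
Qed.

Lemma mulf0 (a : 'rV[R]_n -> R) : Linfty Omega a -> mulf a (0 : aefun) = 0.
Proof.
move=> aoo; have L0 := L2_0 oOmega.
have := mulf_linear oOmega aoo (-1) L0 L0.
by rewrite scaler0 addr0 scaleN1r addNr.
Qed.

Lemma domAd0 : domAd b (0 : state Omega).
Proof.
have H0 := H10_0 oOmega bOmega; have L0 := L2_0 oOmega.
have w0 : div_in_L2 (fun _ : 'I_n => 0 : aefun).
  exists 0 => //; apply: (weak_div_real oOmega bOmega) => // w Hw.
  rewrite {1}/rdotv big1 => [|i _].
    by rewrite rdotE (dot0l ipL2 (H10_L2 Hw)) oppr0.
  by rewrite rdotE (dot0l ipL2 (H10_L2_grad oOmega bOmega i Hw)).
split; first by split.
have g0 : grad 0 = fun _ => 0 by apply/funext => i; exact: (grad0 oOmega bOmega).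
have f0 : flux 0 0 = fun _ => 0.
  by apply/funext => i; rewrite /flux g0 (mulf0 boo) addr0.
split=> //; first by rewrite f0.
by rewrite g0.
Qed.

Lemma domAd_memP a U W : domAd b U -> domAd b W -> domAd b (a *: U + W : state Omega).
Proof.
case: U => -[[u v] y] z; case: W => -[[u' v'] y'] z'.
move=> [[Hu Lv Hy Lz] [Hv Hz du dy]] [[Hu' Lv' Hy' Lz'] [Hv' Hz' du' dy']].
have HP := H10_memP oOmega bOmega a; have LP := L2_memP oOmega a.
have d1 : div_in_L2 (flux (a *: u + u') (a *: v + v')).
  rewrite (flux_linear a Hu Hv Hu' Hv').
  have Lp i := L2_flux i Hu Hv; have Lq i := L2_flux i Hu' Hv'.
  exact: (divergence_linear a Lp Lq du du').1.
have d2 : div_in_L2 (grad (a *: y + y')).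
  have -> : grad (a *: y + y') = (fun i => a *: grad y i + grad y' i).
    by apply/funext => i; exact: (grad_linear oOmega bOmega a i (H10_H1 Hy) (H10_H1 Hy')).
  have Lp i := H10_L2_grad oOmega bOmega i Hy; have Lq i := H10_L2_grad oOmega bOmega i Hy'.
  exact: (divergence_linear a Lp Lq dy dy').1.
exact (conj (And4 (HP _ _ Hu Hu') (LP _ _ Lv Lv') (HP _ _ Hy Hy') (LP _ _ Lz Lz'))
  (And4 (HP _ _ Hv Hv') (HP _ _ Hz Hz') d1 d2)).
Qed.

Lemma Ad_linear a U W : domAd b U -> domAd b W ->
  Ad b c (a *: U + W : state Omega) = a *: Ad b c U + Ad b c W.
Proof.
case: U => -[[u v] y] z; case: W => -[[u' v'] y'] z'.
move=> [[Hu Lv Hy Lz] [Hv Hz du dy]] [[Hu' Lv' Hy' Lz'] [Hv' Hz' du' dy']].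
have e1 : divergence (flux (a *: u + u') (a *: v + v')) =
    a *: divergence (flux u v) + divergence (flux u' v').
  rewrite (flux_linear a Hu Hv Hu' Hv').
  have Lp i := L2_flux i Hu Hv; have Lq i := L2_flux i Hu' Hv'.
  exact: (divergence_linear a Lp Lq du du').2.
have e2 : divergence (grad (a *: y + y')) = a *: divergence (grad y) + divergence (grad y').
  have -> : grad (a *: y + y') = (fun i => a *: grad y i + grad y' i).
    by apply/funext => i; exact: (grad_linear oOmega bOmega a i (H10_H1 Hy) (H10_H1 Hy')).
  have Lp i := H10_L2_grad oOmega bOmega i Hy; have Lq i := H10_L2_grad oOmega bOmega i Hy'.
  exact: (divergence_linear a Lp Lq dy dy').2.
have e3 := mulf_linear oOmega coo a Lz Lz'; have e4 := mulf_linear oOmega coo a Lv Lv'.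
have d1 : divergence (flux (a *: u + u') (a *: v + v')) - mulf c (a *: z + z') =
    a *: (divergence (flux u v) - mulf c z) + (divergence (flux u' v') - mulf c z').
  exact: linear_subE e1 e3.
have d2 : divergence (grad (a *: y + y')) + mulf c (a *: v + v') =
    a *: (divergence (grad y) + mulf c v) + (divergence (grad y') + mulf c v').
  exact: linear_addE e2 e4.
exact (f_equal2 (fun p q : aefun => (a *: v + v', p, a *: z + z', q) : state Omega) d1 d2).
Qed.

Lemma Ad_dissipative : dissipative_on (energy_space Omega) (@dotE R n Omega) (domAd b) (Ad b c).
Proof.
split; [by move=> U []|exact: domAd0|exact: domAd_memP| |exact: Ad_linear|].
- move=> [[[u v] y] z] [[Hu Lv Hy Lz] [Hv Hz /divergenceP[Ldu _] /divergenceP[Ldy _]]].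
  have Lcz := L2_mulf oOmega coo Lz; have Lcv := L2_mulf oOmega coo Lv.
  by split; [exact: Hv|exact: L2B Ldu Lcz|exact: Hz|exact: L2D Ldy Lcv].
move=> [[[u v] y] z] [[Hu Lv Hy Lz] [Hv Hz /divergenceP[Ldu wu] /divergenceP[Ldy wy]]].
have Lcz := L2_mulf oOmega coo Lz; have Lcv := L2_mulf oOmega coo Lv.
have Lgu i := H10_L2_grad oOmega bOmega i Hu; have Lgv i := H10_L2_grad oOmega bOmega i Hv.
have Lbv i : L2 (mulf b (grad v i)) := L2_mulf oOmega boo (Lgv i).
have Lgy i := H10_L2_grad oOmega bOmega i Hy.
pose B := rdotv (fun i => mulf b (grad v i)) (grad v).
have B0 : 0 <= B by apply: sumr_ge0 => i _; exact: (mulf_ge0 oOmega boo b_ge0 (Lgv i)).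
have e1 : rdot dotL2 (divergence (flux u v)) v = - (rdot dotgrad u v + B).
  have Lf i := L2_flux i Hu Hv.
  rewrite -[LHS]opprK -(Green oOmega bOmega Lf Ldu wu Hv) (rdotvD Lgu Lbv Hv).
  by rewrite rdotv_grad.
have e2 : rdot dotL2 (divergence (grad y)) z = - rdot dotgrad y z.
  by rewrite -[LHS]opprK -(Green oOmega bOmega Lgy Ldy wy Hz) rdotv_grad.
(* Multiplication by the real function [c] is symmetric, so the coupling terms of the two equations
   are opposite in the energy balance. *)
have e3 : rdot dotL2 (mulf c z) v = rdot dotL2 (mulf c v) z.
  by rewrite rdotE (dotL2_mulf oOmega coo Lz Lv) -rdotE (rdotC ipL2 Lz Lcv).
have e4 := rdotBl ipL2 Ldu Lcz Lv; have e5 := rdotDl ipL2 Ldy Lcv Lz.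
have e6 := rdotC ipG Hv Hu; have e7 := rdotC ipG Hz Hy.
have -> : rdot (@dotE R n Omega) (Ad b c (u, v, y, z)) (u, v, y, z) =
    rdot dotL2 (divergence (flux u v) - mulf c z) v + rdot dotgrad v u
    + rdot dotL2 (divergence (grad y) + mulf c v) z + rdot dotgrad z y.
  by rewrite [LHS]rdotE /dotE /Ad !ReD.
rewrite e4 e5 e6 e7 e1 e2 e3; exact: Ad_arith B0.
Qed.

Lemma Ad_onto U : energy_space Omega U -> exists2 W, domAd b W & Ad b c W = U.
Proof.
case: U => -[[f g] h] k [Hf Lg Hh Lk].
have Lf := H10_L2 Hf; have Lh := H10_L2 Hh.
have Lcf := L2_mulf oOmega coo Lf; have Lch := L2_mulf oOmega coo Lh.
have Lgf i := H10_L2_grad oOmega bOmega i Hf.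
have Lbf i : L2 (mulf b (grad f i)) := L2_mulf oOmega boo (Lgf i).
have Lgc := L2D Lg Lch; have Lkc := L2B Lk Lcf.
(* The remaining equations are [div (grad u + b grad f) = g + c h] and, with [q = 0],
   [div (grad y) = k - c f]. *)
have [u Hu wu] := weak_div_solve Lbf Lgc.
have [y Hy wy] := weak_div_solve (q := fun=> 0) (fun=> L2_0 oOmega) Lkc.
have gy0 : (fun i => grad y i + 0) = grad y by apply/funext => i; rewrite addr0.
rewrite gy0 in wy.
have Lgy i := H10_L2_grad oOmega bOmega i Hy; have Lfl i := L2_flux i Hu Hf.
have e1 : divergence (flux u f) - mulf c h = g.
  by rewrite (divergence_uniq oOmega bOmega Lfl Lgc wu) addrK.
have e2 : divergence (grad y) + mulf c f = k.
  by rewrite (divergence_uniq oOmega bOmega Lgy Lkc wy) subrK.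
exists (u, f, y, h); last exact (f_equal2 (fun p q : aefun => (f, p, h, q) : state Omega) e1 e2).
split; split; [exact: Hu|exact: Lf|exact: Hy|exact: Lh|exact: Hf|exact: Hh| |].
  by exists (g + mulf c h).
by exists (k - mulf c f).
Qed.

Lemma Ad_bounded_below : exists2 C : R, 0 <= C & forall U, domAd b U ->
  nrm (@dotE R n Omega) U <= C * nrm (@dotE R n Omega) (Ad b c U).
Proof.
have [Cp Cp0 hCp] := Poincare oOmega bOmega i0.
have [Mb Mb0 hMb] := nrm_mulf oOmega boo; have [Mc Mc0 hMc] := nrm_mulf oOmega coo.
exists (2 * Cp * (2 + Mc * Cp) + n%:R * Mb).
  by apply: addr_ge0; apply: mulr_ge0 => //; [exact: mulr_ge0|apply: addr_ge0 => //; exact: mulr_ge0].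
move=> U DU; have EU := dis_sub Ad_dissipative DU; have EAU := dis_range Ad_dissipative DU.
case: U DU EU EAU => -[[u v] y] z.
move=> [[Hu Lv Hy Lz] [Hv Hz /divergenceP[Ldu wu] /divergenceP[Ldy wy]]] EU EAU.
have [h1 h2 h3 h4] := nrm_le_dotE EAU; have h5 := nrm_dotE_le EU.
have N0 := nrm_ge0 (@dotE R n Omega) (Ad b c (u, v, y, z)).
set N := nrm _ (Ad b c _) in h1 h2 h3 h4 N0 *.
have Lcz := L2_mulf oOmega coo Lz; have Lcv := L2_mulf oOmega coo Lv.
have Lgv i := H10_L2_grad oOmega bOmega i Hv.
have Lbv i : L2 (mulf b (grad v i)) := L2_mulf oOmega boo (Lgv i).
have hu := weak_div_bound Cp0 hCp Lbv Ldu Hu wu.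
have gy0 : (fun i => grad y i + 0) = grad y by apply/funext => i; rewrite addr0.
have wy0 : weak_div (fun i => grad y i + 0) (divergence (grad y)) by rewrite gy0.
have := weak_div_bound (q := fun=> 0) Cp0 hCp (fun=> L2_0 oOmega) Ldy Hy wy0.
rewrite big1 => [|i _]; last exact: (nrm0 ipL2).
rewrite addr0 => hy.
have hs : \sum_(i < n) nrm dotL2 (mulf b (grad v i)) <= n%:R * (Mb * N).
  apply: (@le_trans _ _ (\sum_(i < n) Mb * N)).
    apply: ler_sum => i _; apply: le_trans (hMb _ (Lgv i)) (ler_wpM2l Mb0 _).
    exact: le_trans (nrm_grad_le oOmega bOmega i (H10_H1 Hv)) h1.
  by rewrite sumr_const card_ord -[leLHS]mulr_natl.
have hF := le_trans (nrm_lerB ipL2 Ldu Lcz) (lerD (lexx _) h2).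
have hdy : nrm dotL2 (divergence (grad y)) <= N + nrm dotL2 (mulf c v).
  have Lk := L2D Ldy Lcv; apply: le_trans (nrm_lerB ipL2 Ldy Lk) _.
  by apply: lerD h4 _; rewrite opprD addNKr (nrmN ipL2 Lcv).
have hz := le_trans (hCp z Hz) (ler_wpM2l Cp0 h3).
have hv := le_trans (hCp v Hv) (ler_wpM2l Cp0 h1).
apply: le_trans h5 _.
exact: (Ad_bound_arith Cp0 Mc0 N0 hu hs hF (hMc z Lz) hz hv hy hdy (hMc v Lv)).
Qed.

End wave_operator.

Theorem theorem3p1 (R : realType) (d : nat) (Omega omegab omegac : set 'rV[R]_d)
    (b c : 'rV[R]_d -> R) (b0 c0 : R) :
  (2 <= d)%N ->
  open Omega -> bounded_set Omega -> C2_boundary Omega ->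
  Linfty Omega b -> Linfty Omega c ->
  {ae lebesgue_rV d, forall x, Omega x -> 0 <= b x} ->
  omegab `<=` Omega -> omegac `<=` Omega ->
  0 < b0 -> {ae lebesgue_rV d, forall x, omegab x -> b0 <= b x} ->
  0 < c0 -> {ae lebesgue_rV d, forall x, omegac x -> c0 <= c x} ->
  {ae lebesgue_rV d, forall x, (Omega `\` omegac) x -> c x = 0} ->
  (0 < hausdorff d.-1 (closure omegac `&` boundary Omega))%E ->
  closure omegab `&` closure omegac = set0 ->
  exists T : R -> state Omega -> state Omega,
    [/\ is_C0_semigroup_generated_by (energy_space Omega) (normE Omega)
          (domAd b) (Ad b c) T,
        forall T',
          is_C0_semigroup_generated_by (energy_space Omega) (normE Omega)
            (domAd b) (Ad b c) T' ->
          forall t U, 0 <= t -> energy_space Omega U -> T' t U = T t U,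
        forall U0, energy_space Omega U0 ->
          unique_solution
            (mild_solution (energy_space Omega) (normE Omega)
               (domAd b) (Ad b c) U0)
            (fun t => T t U0) &
        forall U0, domAd b U0 ->
          unique_solution
            (strong_solution (energy_space Omega) (normE Omega)
               (domAd b) (Ad b c) U0)
            (fun t => T t U0)].
Proof.
move=> d2 oOmega bOmega _ boo coo b_ge0 _ _ _ _ _ _ _ _ _.
(* The coordinate 0, along which the Poincare inequality is taken. *)
have i0 : 'I_d := Ordinal (ltnW d2).
have [C C0 hC] := Ad_bounded_below oOmega bOmega i0 boo coo b_ge0.
exact (generation_theorem (dotE_inner_product oOmega bOmega i0)
  (dotE_complete oOmega bOmega i0) (Ad_dissipative oOmega bOmega i0 boo coo b_ge0)
  (Ad_onto oOmega bOmega i0 boo coo) C0 hC).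
Qed.
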